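(* Let $\alpha > 1$, $\alpha^* = \frac{\alpha}{\alpha-1}$, $d\ge 1$. Let $X, X_1, X_2,\dots$ be i.i.d. random vectors in $\mathbb{R}^d$ with mean zero and identity covariance matrix, let $Z_n = (X_1+\dots+X_n)/\sqrt{n}$, and let $Z$ be a standard normal random vector in $\mathbb{R}^d$ with density $\varphi$. Suppose that $D_\alpha(Z_n||Z)$ is finite for some $n=n_0$ and that $$\mathbb{E}\, e^{\langle t,X\rangle} < e^{\alpha^*|t|^2/2} \quad \text{for all } t\in\mathbb{R}^d,\ t\neq 0.$$ Then, for all $n$ large enough and for all $x\in\mathbb{R}^d$, the density $p_n$ of $Z_n$ satisfies $$|p_n(x)-\varphi(x)| \leq \frac{c}{\sqrt{n}}\, e^{-|x|^2/(2\alpha^* )}$$ with some constant $c$ which does not depend on $n$ (nor on $x$). Moreover, the rate $1/\sqrt{n}$ on the right-hand side may be improved to $1/n$, provided that the distribution of $X$ is symmetric about the origin.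
   Context: $\langle\cdot,\cdot\rangle$ and $|\cdot|$ are the Euclidean inner product and norm on $\mathbb{R}^d$, and $\varphi(x) = (2\pi)^{-d/2}e^{-|x|^2/2}$. The Rényi divergence of order $\alpha>1$ of a random vector $Y$ with density $p$ from $Z$ is $D_\alpha(Y||Z) = \frac{1}{\alpha-1}\log\int_{\mathbb{R}^d} \big(\frac{p(x)}{\varphi(x)}\big)^\alpha \varphi(x)\,dx \in [0,\infty]$; if $Y$ has no density, then $D_\alpha(Y||Z)=\infty$. For $n$ large, $p_n$ denotes the continuous version of the density of $Z_n$ (which exists under the hypotheses). *)

(* Defs.v *)
From HB Require Import structures.
From mathcomp Require Import all_boot all_order all_algebra.
From mathcomp Require Import finmap.
From mathcomp Require Import all_classical all_reals all_analysis.
From mathcomp Require Import measurable_realfun.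

Set Implicit Arguments.
Unset Strict Implicit.
Unset Printing Implicit Defensive.

Import Order.TTheory GRing.Theory Num.Theory.
Import numFieldNormedType.Exports.

Local Open Scope classical_set_scope.
Local Open Scope ring_scope.

(* 'rV[R]_n carries the product sigma-algebra of the Borel sigma-algebras of
   its coordinates, exactly as the library does for n.-tuple R. *)
Definition measure_row_display : measure_display -> measure_display.
Proof. exact. Qed.

Section measurable_row.
Context {R : realType} {n : nat}.

Let coords : 'I_n -> 'rV[R]_n -> R := fun i x => x 0 i.

Let row_set0 : g_sigma_preimage coords set0.
Proof. exact: sigma_algebra0. Qed.

Let row_setC A : g_sigma_preimage coords A -> g_sigma_preimage coords (~` A).
Proof. exact: sigma_algebraC. Qed.

Let row_bigcup (F : (set 'rV[R]_n)^nat) :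
  (forall i, g_sigma_preimage coords (F i)) ->
  g_sigma_preimage coords (\bigcup_i (F i)).
Proof. exact: sigma_algebra_bigcup. Qed.

HB.instance Definition _ := @isMeasurable.Build
  (measure_row_display default_measure_display)
  'rV[R]_n (g_sigma_preimage coords) row_set0 row_setC row_bigcup.

Lemma measurable_coord (i : 'I_n) :
  measurable_fun [set: 'rV[R]_n] (fun x : 'rV[R]_n => x 0 i).
Proof.
move=> _ Y mY; rewrite setTI; apply: sub_sigma_algebra => /=.
rewrite -bigcup_seq/=; exists i => /=; first by rewrite mem_index_enum.
by exists Y => //; rewrite setTI.
Qed.

Lemma measurable_fun_rowP d (T : measurableType d) (f : T -> 'rV[R]_n) :
  measurable_fun [set: T] f <->
  forall i, measurable_fun [set: T] (fun t => f t 0 i).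
Proof.
split=> [mf i|mf].
  by apply: (measurableT_comp (measurable_coord i)).
have E : @measurable _ 'rV[R]_n =
    <<s \big[setU/set0]_(i < n) preimage_set_system setT (coords i) measurable >>.
  by [].
refine (measurability _ E _).
move=> _ [B + <-]; rewrite -bigcup_seq/= => -[i _ [C mC <-]].
by rewrite (setTI (_ @^-1` C)) -comp_preimage; exact: mf.
Qed.

End measurable_row.

Section lebesgue_row.
Context {R : realType}.

Definition consrow n (p : measurableTypeR R * 'rV[R]_n) : 'rV[R]_n.+1 :=
  \row_j oapp (p.2 0) p.1 (unlift ord0 j).

Definition unconsrow n (x : 'rV[R]_n.+1) : measurableTypeR R * 'rV[R]_n :=
  (x 0 ord0, \row_j x 0 (lift ord0 j)).

Lemma consrowK n : cancel (@consrow n) (@unconsrow n).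
Proof.
move=> [a y]; rewrite /consrow /unconsrow mxE unlift_none /=; congr pair.
by apply/rowP => j; rewrite !mxE liftK.
Qed.

Lemma measurable_consrow n : measurable_fun setT (@consrow n).
Proof.
apply/measurable_fun_rowP => i.
case: (unliftP ord0 i) => [j ->|->].
  rewrite (_ : (fun _ => _) = (fun x : 'rV[R]_n => x 0 j) \o snd).
    by apply: measurableT_comp => //; exact: measurable_coord.
  by apply/funext => p; rewrite /= mxE liftK.
rewrite (_ : (fun _ => _) = fst); first exact: measurable_fst.
by apply/funext => p; rewrite mxE unlift_none.
Qed.

Lemma measurable_unconsrow n : measurable_fun setT (@unconsrow n).
Proof.
apply: measurable_fun_pair; first exact: measurable_coord.
apply/measurable_fun_rowP => i.
rewrite (_ : (fun _ => _) = (fun x : 'rV[R]_n.+1 => x 0 (lift ord0 i))).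
  exact: measurable_coord.
by apply/funext => x; rewrite mxE.
Qed.

Section step.
Local Open Scope ereal_scope.
Context {n : nat} (mu : {sigma_finite_measure set 'rV[R]_n -> \bar R}).

Definition lebesgue_step : set 'rV[R]_n.+1 -> \bar R :=
  pushforward (lebesgue_measure \x mu) (@consrow n).

Let step0 : lebesgue_step set0 = 0.
Proof. by rewrite /lebesgue_step /pushforward preimage_set0 measure0. Qed.

Let step_ge0 A : 0 <= lebesgue_step A.
Proof. exact: (measure_ge0 (lebesgue_measure \x mu)). Qed.

Let step_sigma_additive : semi_sigma_additive lebesgue_step.
Proof.
move=> F mF tF mUF; rewrite /lebesgue_step /pushforward preimage_bigcup.
apply: measure_semi_sigma_additive.
- by move=> k; rewrite -[X in measurable X]setTI; exact: measurable_consrow.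
- apply/trivIsetP => /= i j _ _ ij; rewrite -preimage_setI.
  by move/trivIsetP : tF => /(_ _ _ _ _ ij) ->//; rewrite preimage_set0.
- rewrite -preimage_bigcup -[X in measurable X]setTI.
  exact: measurable_consrow.
Qed.

HB.instance Definition _ := isMeasure.Build _ _ _ lebesgue_step
  step0 step_ge0 step_sigma_additive.

Let step_sigma_finite : sigma_finite setT lebesgue_step.
Proof.
have /sigma_finiteP[F [TF ndF Foo]] := sigma_finiteT (@lebesgue_measure R).
have /sigma_finiteP[G [TG ndG Goo]] := sigma_finiteT mu.
have ndX x y i j k : (i <= k)%N -> (j <= k)%N -> F i x -> G j y ->
    F k x /\ G k y.
  by move=> ik jk Fx Gy; split; [move: x Fx; exact/subsetPset/ndF|
                                 move: y Gy; exact/subsetPset/ndG].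
exists (fun k => @unconsrow n @^-1` (F k `*` G k)).
  rewrite -preimage_bigcup (_ : \bigcup_k _ = setT) ?preimage_setT//.
  apply/seteqP; split=> // -[x y] _.
  have [i _ Fx] : (\bigcup_i F i) x by rewrite -TF.
  have [j _ Gy] : (\bigcup_i G i) y by rewrite -TG.
  by exists (maxn i j) => //; apply: (ndX x y i j); rewrite ?leq_maxl ?leq_maxr.
move=> k; have [mF Fk] := Foo k; have [mG Gk] := Goo k; split.
  rewrite -[X in measurable X]setTI; apply: measurable_unconsrow => //.
  exact: measurableX.
rewrite /lebesgue_step /pushforward -comp_preimage (_ : _ \o _ = id); last first.
  by apply/funext => p; rewrite /= consrowK.
by rewrite preimage_id product_measure1E// lte_mul_pinfty// ge0_fin_numE.
Qed.

HB.instance Definition _ := Measure_isSigmaFinite.Build _ _ _ lebesgue_step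
  step_sigma_finite.

End step.

Fixpoint lebesgue_row (n : nat) :
    {sigma_finite_measure set 'rV[R]_n -> \bar R} :=
  if n is m.+1 then lebesgue_step (lebesgue_row m)
  else \d_(0 : 'rV[R]_0).

(* Together with uniqueness of extension, this identifies [lebesgue_row n] as
   Lebesgue measure on R^n; the case of intervals gives volumes of boxes. *)
Lemma lebesgue_row_box n (A : 'I_n -> set (measurableTypeR R)) :
  (forall i, measurable (A i)) ->
  (lebesgue_row n [set x : 'rV[R]_n | forall i, A i (x 0%R i)] =
   \prod_(i < n) lebesgue_measure (A i))%E.
Proof.
elim: n A => [|n IH] A mA.
  by rewrite big_ord0 /= diracE mem_set// => -[].
have mB : measurable [set x : 'rV[R]_n | forall i, A (lift ord0 i) (x 0 i)].
  rewrite (_ : [set x | _] = \big[setI/setT]_(i < n)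
      ((fun x : 'rV[R]_n => x 0 i) @^-1` A (lift ord0 i))).
    apply: bigsetI_measurable => i _.
    by rewrite -[X in measurable X]setTI; exact: (measurable_coord i measurableT (mA _)).
  rewrite -bigcap_seq; apply/seteqP; split=> x /= Ax i; first by move=> _; exact: Ax.
  by apply: Ax; rewrite /= mem_index_enum.
rewrite big_ord_recl -IH//= -product_measure1E// /lebesgue_step /pushforward.
congr (product_measure1 _ _ _); apply/seteqP; split=> -[a y] /=.
  move=> h; split=> [|i] /=.
    by move: (h ord0); rewrite mxE unlift_none.
  by move: (h (lift ord0 i)); rewrite mxE liftK.
move=> [/= Aa h] i; rewrite mxE.
by case: (unliftP ord0 i) => [j ->|->] /=.
Qed.

End lebesgue_row.

Section euclidean.
Context {R : realType} {d : nat}.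
Implicit Types x y : 'rV[R]_d.

Definition dotp x y : R := \sum_i x 0 i * y 0 i.

(* The norm [`|x|] on ['rV[R]_d] in the library is the sup norm. *)
Definition enorm x : R := Num.sqrt (dotp x x).

Definition gauss_density x : R :=
  (2 * pi) `^ (- (d%:R / 2)) * expR (- (enorm x ^+ 2 / 2)).

End euclidean.

Definition conj_exponent (R : realType) (alpha : R) : R := alpha / (alpha - 1).

Section random_vectors.
Context d (T : measurableType d) (R : realType) (P : probability T R).
Local Open Scope ereal_scope.

Definition mutually_independent d' (T' : measurableType d') (I : choiceType)
    (X : I -> {RV P >-> T'}) :=
  forall (J : {fset I}) (A : I -> set T'),
    (forall i, i \in J -> measurable (A i)) ->
    P (\bigcap_(i in [set` J]) (X i @^-1` A i)) =
    \prod_(i <- J) P (X i @^-1` A i).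

Definition identically_distributed d' (T' : measurableType d') (I : Type)
    (X : I -> {RV P >-> T'}) :=
  forall i j A, measurable A -> distribution P (X i) A = distribution P (X j) A.

Definition iid d' (T' : measurableType d') (I : choiceType)
    (X : I -> {RV P >-> T'}) :=
  mutually_independent X /\ identically_distributed X.

Context {n : nat}.
Implicit Types (X Y : {RV P >-> 'rV[R]_n}) (p : 'rV[R]_n -> R).

(* No separate moment hypotheses are needed in the next two definitions: a
   coordinate with expectation 0 is integrable, since the library's expectation
   of a non-integrable measurable function is infinite (+oo - +oo being -oo),
   and a centered coordinate with variance 1 is square integrable. *)
Definition mean_zero X := forall i, 'E_P[fun w => X w 0%R i] = 0.

Definition identity_covariance X := forall i j,
  covariance P (fun w => X w 0%R i) (fun w => X w 0%R j) = (i == j)%:R%:E.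

Definition symmetric_about_origin X := forall A, measurable A ->
  P ((fun w => (- X w)%R) @^-1` A) = P (X @^-1` A).

Definition is_density Y p :=
  [/\ measurable_fun setT p, forall x, (0 <= p x)%R &
      forall A, measurable A ->
        distribution P Y A = \int[lebesgue_row n]_(x in A) (p x)%:E].

(* Order-[alpha] divergence from the standard normal law of a law with
   density [p]. *)
Definition renyi_gauss_density (alpha : R) p : \bar R :=
  (alpha - 1)^-1%:E *
  lne (\int[lebesgue_row n]_x
         ((p x / gauss_density x) `^ alpha * gauss_density x)%:E).

(* Any two densities of [Y] agree almost everywhere, so the value does not
   depend on the one that is chosen. *)
Definition renyi_gauss (alpha : R) Y : \bar R :=
  if pselect (exists p, is_density Y p) is left Yp
  then renyi_gauss_density alpha (projT1 (cid Yp)) else +oo.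

End random_vectors.

Section normalized_sum.
Context d (T : measurableType d) (R : realType) (P : probability T R) (n : nat).
Variable X : nat -> {RV P >-> 'rV[R]_n}.

(* The sum runs over [X 1, ..., X m]; [X 0] is reserved for the generic vector
   having the common distribution. *)
Definition sum_over_sqrt (m : nat) (w : T) : 'rV[R]_n :=
  (Num.sqrt m%:R)^-1 *: \sum_(1 <= i < m.+1) X i w.

Lemma measurable_sum_over_sqrt m : measurable_fun setT (sum_over_sqrt m).
Proof.
apply/measurable_fun_rowP => j.
rewrite (_ : (fun _ => _) = fun w =>
    (Num.sqrt m%:R)^-1 * \sum_(1 <= i < m.+1) X i w 0 j); last first.
  by apply/funext => w; rewrite mxE summxE.
apply: measurable_funM => //=; apply: measurable_sum => i.
exact: (measurableT_comp (measurable_coord j)).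
Qed.

HB.instance Definition _ m := @isMeasurableFun.Build _ _ _ _
  (sum_over_sqrt m) (measurable_sum_over_sqrt m).

Definition normalized_sum m : {RV P >-> 'rV[R]_n} := sum_over_sqrt m.

End normalized_sum.

(* Main.v *)
(* Write beta for the exponent conjugate to alpha and L(s,eta) = E exp <s + i eta, X>.
   The transform of Z_n is L(t/sqrt n, xi/sqrt n)^n. Evaluating the inversion formula
   on the line of real part t = x/beta, for Z_n and for Z, gives
     |p_n(x) - phi(x)| exp(|x|^2/(2 beta)) <= (2 pi)^-d Int D_n(t,xi) dxi,
   where D_n is the modulus of the difference of the two transforms multiplied by
   exp(-beta |t|^2/2). With W(s,eta) = |L(s,eta)| exp(-beta |s|^2/2), three estimates,
   all uniform in t, bound this integral.
   Near the origin L(s,eta) differs from exp ((|s|^2 - |eta|^2)/2 + i <s,eta>) by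
   O(|(s,eta)|^3), or by O(|(s,eta)|^4) if X is symmetric; telescoping the n-th powers
   gives the two rates.
   If q is the density of Z_n0, finiteness of the divergence says that
   g = q exp(|x|^2/(2 beta)) is in L^alpha, and a power of W is, up to scaling, the
   modulus of the Fourier transform of g times a Gaussian centered at a multiple of s.
   Truncation and Plancherel bound the integral of a high power of W in eta.
   The same representation keeps W away from 1 when eta is far from 0 or s is large;
   for the remaining s this is the hypothesis on the moment generating function, with
   compactness. *)
From HB Require Import structures.
Require Import Defs.
From mathcomp Require Import all_boot all_order all_algebra.
From mathcomp Require Import finmap.
From mathcomp Require Import all_classical all_reals all_analysis.
From mathcomp Require Import measurable_realfun.
From mathcomp Require Import complex.
From mathcomp Require Import ring lra.
Import Order.TTheory GRing.Theory Num.Theory.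
Import numFieldNormedType.Exports.
Import Normc.
Set Implicit Arguments.
Unset Strict Implicit.
Unset Printing Implicit Defensive.
Local Open Scope classical_set_scope.
Local Open Scope complex_scope.
Local Open Scope ring_scope.

(** * Real-valued integrals *)

(** Among all lines of integration, t = x/beta minimizes exp(-<t,x> + beta |t|^2/2), and the minimum
    exp(-|x|^2/(2 beta)) is exactly the factor claimed. As x is arbitrary, t/sqrt n runs over the
    whole space however large n is, so a local expansion cannot suffice and each bound on W must be
    uniform in s. Uniformity comes from the Gaussian factor, which depends on s only through its
    center and a scalar, while the estimates on g times a Gaussian hold for every center. Near the
    origin the analogue of W for the normal law is exp(-((beta-1)|s|^2 + |eta|^2)/2), and beta > 1
    makes it decay in s as well as in eta. Finiteness of the divergence at one n0 carries no
    regularity of the density, so the continuous density for large n is built from the transform and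
    then identified by testing against Lipschitz functions. The change of line is obtained after
    smoothing by a small normal law, where it is an exact shift of the argument. *)

Section real_integrals.
Context d (T : measurableType d) (R : realType).
Implicit Types (m : {measure set T -> \bar R}) (f g : T -> R).

(** A real-valued integral is the finite part of an extended one and takes a default value when that
    one is infinite; [rint] is the side condition that makes the algebra of real integrals valid. *)
Definition rint m f : Prop := m.-integrable setT (EFin \o f).

Lemma rint_measurable m f : rint m f -> measurable_fun setT f.
Proof. by move=> /(measurable_int _) /measurable_EFinP. Qed.

Lemma eq_rint m f g : f =1 g -> rint m f -> rint m g.
Proof. by move=> /funext ->. Qed.

Lemma rint_le m f g : measurable_fun setT f -> rint m g ->
  (forall x, `|f x| <= g x) -> rint m f.
Proof.
move=> mf ig fg; apply: le_integrable ig => //; first exact/measurable_EFinP.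
move=> x _ /=; rewrite lee_fin; apply: (le_trans (fg x)); exact: ler_norm.
Qed.

Lemma rintD m f g : rint m f -> rint m g -> rint m (fun x => f x + g x).
Proof. exact: integrableD. Qed.

Lemma rintB m f g : rint m f -> rint m g -> rint m (fun x => f x - g x).
Proof. exact: integrableB. Qed.

Lemma rintZ m c f : rint m f -> rint m (fun x => c * f x).
Proof. exact: integrableZl. Qed.

Lemma rint0 m : rint m (fun=> 0).
Proof. exact: integrable0. Qed.

Lemma rint_sum m (I : Type) (s : seq I) (f : I -> T -> R) :
  (forall i, rint m (f i)) -> rint m (fun x => \sum_(i <- s) f i x).
Proof.
move=> h; elim: s => [|i s IH].
  by apply: eq_rint (rint0 m) => x; rewrite big_nil.
by apply: eq_rint (rintD (h i) IH) => x; rewrite big_cons.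
Qed.

Lemma rint_norm m f : rint m f -> rint m (fun x => `|f x|).
Proof. exact: integrable_norm. Qed.

Lemma rint_cst (m : {finite_measure set T -> \bar R}) c : rint m (fun=> c).
Proof. exact: finite_measure_integrable_cst. Qed.

Lemma rint_bounded (m : {finite_measure set T -> \bar R}) f c :
  measurable_fun setT f -> (forall x, `|f x| <= c) -> rint m f.
Proof. by move=> mf h; apply: (rint_le mf (rint_cst m c)). Qed.

Lemma rintM_bounded m f g c : rint m f -> measurable_fun setT g ->
  (forall x, `|g x| <= c) -> rint m (fun x => f x * g x).
Proof.
move=> fi mg h; apply: (@rint_le _ _ (fun x => c * `|f x|)).
- by apply: measurable_funM => //; exact: rint_measurable fi.
- exact/rintZ/rint_norm.
- by move=> x; rewrite normrM mulrC ler_wpM2r.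
Qed.

Lemma rint_of_finite m f : measurable_fun setT f -> (forall x, 0 <= f x) ->
  (\int[m]_x (f x)%:E < +oo)%E -> rint m f.
Proof.
move=> mf f0 h; apply/integrableP; split; first exact/measurable_EFinP.
by under eq_integral => x _ do rewrite /= ger0_norm//.
Qed.

Lemma Rint_EFin m f : rint m f ->
  (\int[m]_x f x)%:E = (\int[m]_x (f x)%:E)%E.
Proof. by move=> fi; rewrite fineK//; exact: integrable_fin_num. Qed.

Lemma eq_Rint m f g : f =1 g -> \int[m]_x f x = \int[m]_x g x.
Proof. by move=> /funext ->. Qed.

Lemma RintD m f g : rint m f -> rint m g ->
  \int[m]_x (f x + g x) = \int[m]_x f x + \int[m]_x g x.
Proof. by move=> fi gi; rewrite RintegralD. Qed.

Lemma RintB m f g : rint m f -> rint m g ->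
  \int[m]_x (f x - g x) = \int[m]_x f x - \int[m]_x g x.
Proof. by move=> fi gi; rewrite RintegralB. Qed.

Lemma RintZ m c f : rint m f -> \int[m]_x (c * f x) = c * \int[m]_x f x.
Proof. by move=> fi; rewrite RintegralZl. Qed.

Lemma RintZr m c f : rint m f -> \int[m]_x (f x * c) = (\int[m]_x f x) * c.
Proof. by move=> fi; rewrite RintegralZr. Qed.

Lemma Rint0 m : \int[m]_x (0 : R) = 0.
Proof. by rewrite /Rintegral integral0. Qed.

Lemma RintN m f : rint m f -> \int[m]_x (- f x) = - \int[m]_x f x.
Proof.
by move=> fi; rewrite -mulN1r -RintZ//; apply: eq_Rint => x; rewrite mulN1r.
Qed.

Lemma Rint_sum m (I : Type) (s : seq I) (f : I -> T -> R) :
  (forall i, rint m (f i)) ->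
  \int[m]_x (\sum_(i <- s) f i x) = \sum_(i <- s) \int[m]_x f i x.
Proof.
move=> h; elim: s => [|i s IH].
  by rewrite big_nil -[RHS](Rint0 m); apply: eq_Rint => x; rewrite big_nil.
rewrite big_cons -IH -RintD//; last exact: rint_sum.
by apply: eq_Rint => x; rewrite big_cons.
Qed.

Lemma le_Rint m f g : rint m f -> rint m g -> (forall x, f x <= g x) ->
  \int[m]_x f x <= \int[m]_x g x.
Proof. by move=> fi gi h; apply: le_Rintegral. Qed.

Lemma Rint_ge0 m f : (forall x, 0 <= f x) -> 0 <= \int[m]_x f x.
Proof. by move=> h; apply: Rintegral_ge0. Qed.

Lemma Rint_norm m f : rint m f -> `|\int[m]_x f x| <= \int[m]_x `|f x|.
Proof. by move=> fi; apply: le_normr_Rintegral. Qed.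

Lemma Rint_cst (m : probability T R) c : \int[m]_x c = c.
Proof.
rewrite (Rintegral_cst m measurableT) [X in _ * X](_ : _ = 1) ?mulr1//.
exact: (congr1 fine (probability_setT m)).
Qed.

Lemma Rint_dominated m (f_ : nat -> T -> R) f g :
  (forall n, measurable_fun setT (f_ n)) -> measurable_fun setT f ->
  (forall x, f_ n x @[n --> \oo] --> f x) -> rint m g ->
  (forall n x, `|f_ n x| <= g x) ->
  \int[m]_x f_ n x @[n --> \oo] --> \int[m]_x f x.
Proof.
move=> mf_ mf cf ig h.
have [] := @dominated_convergence _ T R m setT measurableT
  (fun n x => (f_ n x)%:E) (EFin \o f) (EFin \o g).
- by move=> n; apply/measurable_EFinP.
- exact/measurable_EFinP.
- by apply: aeW => x _; apply: cvg_EFin; [exact: nearW|exact: cf].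
- exact: ig.
- by apply: aeW => x n _; rewrite /= lee_fin.
move=> fi _ cv.
by rewrite /= -(Rint_EFin fi) in cv; exact: (fine_cvg cv).
Qed.

End real_integrals.
Arguments rint {d T R} m f.
Arguments eq_rint {d T R m} f {g}.
Arguments eq_Rint {d T R m} f {g}.
Arguments rint_le {d T R m f} g.

Section measurability.
Context d (T : measurableType d) (R : realType).
Implicit Types f g : T -> R.

Lemma measurable_comp_expR f :
  measurable_fun setT f -> measurable_fun setT (fun x => expR (f x)).
Proof. by move=> mf; apply: measurableT_comp mf. Qed.

Lemma measurable_comp_cos f :
  measurable_fun setT f -> measurable_fun setT (fun x => cos (f x)).
Proof.
move=> mf; apply: measurableT_comp mf.
by apply: continuous_measurable_fun => x; exact: continuous_cos.
Qed.

Lemma measurable_comp_sin f :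
  measurable_fun setT f -> measurable_fun setT (fun x => sin (f x)).
Proof.
move=> mf; apply: measurableT_comp mf.
by apply: continuous_measurable_fun => x; exact: continuous_sin.
Qed.

Lemma measurable_comp_norm f :
  measurable_fun setT f -> measurable_fun setT (fun x => `|f x|).
Proof. by move=> mf; apply: measurableT_comp mf. Qed.

Lemma measurable_comp_sqrt f :
  measurable_fun setT f -> measurable_fun setT (fun x => Num.sqrt (f x)).
Proof.
move=> mf; apply: measurableT_comp mf.
by apply: continuous_measurable_fun => x; exact: sqrt_continuous.
Qed.

Lemma measurable_comp_oppr f :
  measurable_fun setT f -> measurable_fun setT (fun x => - f x).
Proof. by move=> mf; apply: measurableT_comp mf. Qed.

Lemma measurable_comp_powR f p :
  measurable_fun setT f -> measurable_fun setT (fun x => f x `^ p).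
Proof. by move=> mf; exact: (measurableT_comp (measurable_powR p) mf). Qed.

Lemma measurable_comp_row n (u : T -> 'rV[R]_n) i :
  measurable_fun setT u -> measurable_fun setT (fun x => u x 0 i).
Proof. by move=> /measurable_fun_rowP. Qed.

Lemma measurable_rowD n (u v : T -> 'rV[R]_n) : measurable_fun setT u ->
  measurable_fun setT v -> measurable_fun setT (fun x => u x + v x).
Proof.
move=> /measurable_fun_rowP mu /measurable_fun_rowP mv.
apply/measurable_fun_rowP => i; under eq_fun do rewrite mxE.
exact: measurable_funD.
Qed.

Lemma measurable_rowN n (u : T -> 'rV[R]_n) : measurable_fun setT u ->
  measurable_fun setT (fun x => - u x).
Proof.
move=> /measurable_fun_rowP mu.
apply/measurable_fun_rowP => i; under eq_fun do rewrite mxE.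
exact: measurable_comp_oppr.
Qed.

Lemma measurable_rowZ n (c : T -> R) (u : T -> 'rV[R]_n) : measurable_fun setT c ->
  measurable_fun setT u -> measurable_fun setT (fun x => c x *: u x).
Proof.
move=> mc /measurable_fun_rowP mu.
apply/measurable_fun_rowP => i; under eq_fun do rewrite mxE.
exact: measurable_funM.
Qed.

Lemma measurable_comp_dotp n (u v : T -> 'rV[R]_n) : measurable_fun setT u ->
  measurable_fun setT v -> measurable_fun setT (fun x => dotp (u x) (v x)).
Proof.
move=> /measurable_fun_rowP mu /measurable_fun_rowP mv.
by apply: measurable_sum => i; apply: measurable_funM.
Qed.

Lemma measurable_compT d2 (T2 : measurableType d2) d3 (T3 : measurableType d3)
    (h : T2 -> T3) (u : T -> T2) : measurable_fun setT h ->
  measurable_fun setT u -> measurable_fun setT (fun x => h (u x)).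
Proof. by move=> mh mu; apply: (measurableT_comp mh mu). Qed.

Lemma measurable_pair d2 (T2 : measurableType d2) d3 (T3 : measurableType d3)
    (h : T -> T2) (u : T -> T3) : measurable_fun setT h ->
  measurable_fun setT u -> measurable_fun setT (fun x => (h x, u x)).
Proof. by move=> mh mu; apply: measurable_fun_pair. Qed.

End measurability.

Section measurability_pair.
Context d d2 d3 (T : measurableType d) (T2 : measurableType d2)
  (T3 : measurableType d3).
Lemma measurable_comp_fst (u : T -> T2 * T3) : measurable_fun setT u ->
  measurable_fun setT (fun x => (u x).1).
Proof. by move=> mu; apply: (measurableT_comp measurable_fst mu). Qed.

Lemma measurable_comp_snd (u : T -> T2 * T3) : measurable_fun setT u ->
  measurable_fun setT (fun x => (u x).2).
Proof. by move=> mu; apply: (measurableT_comp measurable_snd mu). Qed.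
End measurability_pair.

(** The second-order patterns recover the functions under the binder, so measurability is proved by
    descending through the expression; hypotheses of measurability or integrability close the
    leaves. *)
Ltac mstep := first
  [ assumption
  | match goal with
    | |- measurable_fun _ (fun _ => ?c) => exact: measurable_cst
    | |- measurable_fun _ (fun x => x) => exact: measurable_id
    | |- measurable_fun _ (fun x => fst (@?f x)) => apply: (measurable_comp_fst (u := f))
    | |- measurable_fun _ (fun x => snd (@?f x)) => apply: (measurable_comp_snd (u := f))
    | |- measurable_fun _ (fun x => pair (@?f x) (@?g x)) => apply: (measurable_pair (h := f) (u := g))
    | |- measurable_fun _ (fun x => expR (@?f x)) => apply: (measurable_comp_expR (f := f))
    | |- measurable_fun _ (fun x => cos (@?f x)) => apply: (measurable_comp_cos (f := f))
    | |- measurable_fun _ (fun x => sin (@?f x)) => apply: (measurable_comp_sin (f := f))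
    | |- measurable_fun _ (fun x => powR (@?f x) _) => apply: (measurable_comp_powR (f := f))
    | |- measurable_fun _ (fun x => Num.sqrt (@?f x)) => apply: (measurable_comp_sqrt (f := f))
    | |- measurable_fun _ (fun x => dotp (@?f x) (@?g x)) => apply: (measurable_comp_dotp (u := f) (v := g))
    | |- measurable_fun _ (fun x => fun_of_matrix (@?f x) _ _) => apply: (measurable_comp_row (u := f))
    | |- measurable_fun _ (fun x => GRing.scale (@?f x) (@?g x)) => apply: (measurable_rowZ (c := f) (u := g))
    | |- measurable_fun _ (fun x => GRing.add (@?f x) (@?g x)) =>
        first [apply: (measurable_funD (f := f) (g := g)) | apply: (measurable_rowD (u := f) (v := g))]
    | |- measurable_fun _ (fun x => GRing.mul (@?f x) (@?g x)) => apply: (measurable_funM (f := f) (g := g))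
    | |- measurable_fun _ (fun x => GRing.opp (@?f x)) =>
        first [apply: (measurable_comp_oppr (f := f)) | apply: (measurable_rowN (u := f))]
    | |- measurable_fun _ (fun x => Num.norm (@?f x)) => apply: (measurable_comp_norm (f := f))
    | |- measurable_fun _ (fun x => GRing.exp (@?f x) _) => apply: (measurable_funX (f := f))
    | |- measurable_fun _ (fun x => Order.max (@?f x) (@?g x)) => apply: (measurable_maxr (f := f) (g := g))
    | |- measurable_fun _ (fun x => bigop _ _ _) => apply: measurable_sum => ?
    | mh : measurable_fun _ ?h |- measurable_fun _ (fun x => ?h (@?u x)) => apply: (measurable_compT (h := h) (u := u)); first exact: mh
    | mh : rint _ ?h |- measurable_fun _ (fun x => ?h (@?u x)) => apply: (measurable_compT (h := h) (u := u)); first exact: (rint_measurable mh)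
    | mh : forall _, measurable_fun _ (?h _) |- measurable_fun _ (fun x => ?h ?i (@?u x)) => apply: (measurable_compT (h := h i) (u := u)); first exact: mh
    | |- measurable_fun _ ?h => is_var h; match goal with mh : rint _ h |- _ => exact: (rint_measurable mh) end
    end ].
Ltac mfun := repeat (cbv beta; mstep).

Section fubini.
Context d1 d2 (T1 : measurableType d1) (T2 : measurableType d2) (R : realType).
Variables (m1 : {sigma_finite_measure set T1 -> \bar R})
  (m2 : {sigma_finite_measure set T2 -> \bar R}).
Implicit Types f : T1 * T2 -> R.

Lemma rint_iterated f : measurable_fun setT f ->
  (forall y, rint m1 (fun x => f (x, y))) ->
  rint m2 (fun y => \int[m1]_x `|f (x, y)|) -> rint (m1 \x m2)%E f.
Proof.
move=> mf h1 h2; apply/integrable21ltyP; first exact/measurable_EFinP.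
rewrite (_ : integral _ _ _ = \int[m2]_y (\int[m1]_x `|f (x, y)|)%:E)%E.
  by rewrite -Rint_EFin// ltry.
by apply: eq_integral => y _; rewrite Rint_EFin//; exact/rint_norm.
Qed.

Lemma rint_prod (g : T1 -> R) (h : T2 -> R) : rint m1 g -> rint m2 h ->
  rint (m1 \x m2)%E (fun z => g z.1 * h z.2).
Proof.
move=> gi hi; apply: rint_iterated => /=.
- by mfun.
- by move=> y; apply: eq_rint (rintZ (h y) gi) => x; rewrite mulrC.
- apply: (@eq_rint _ _ _ _ (fun y => (\int[m1]_x `|g x|) * `|h y|)).
    move=> y; rewrite mulrC -RintZ; last exact: rint_norm.
    by apply: eq_Rint => x; rewrite normrM mulrC.
  exact/rintZ/rint_norm.
Qed.

Section integrable.
Variable f : T1 * T2 -> R.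
Hypothesis fi : rint (m1 \x m2)%E f.

(** A partial integral of an integrable function may be infinite on a null set; applying [fine]
    pointwise changes it only there. *)
Let fineF (F : T1 -> \bar R) : m1.-integrable setT F ->
  fine (\int[m1]_x F x)%E = \int[m1]_x fine (F x).
Proof.
move=> Fi; congr fine; apply: ae_eq_integral => //.
- exact: measurable_int Fi.
- by apply/measurable_EFinP; apply: measurableT_comp (measurable_int _ Fi).
- apply: filterS (integrable_ae measurableT Fi) => x h _ /=.
  by rewrite fineK// h.
Qed.

Let fineG (F : T2 -> \bar R) : m2.-integrable setT F ->
  fine (\int[m2]_x F x)%E = \int[m2]_x fine (F x).
Proof.
move=> Fi; congr fine; apply: ae_eq_integral => //.
- exact: measurable_int Fi.
- by apply/measurable_EFinP; apply: measurableT_comp (measurable_int _ Fi).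
- apply: filterS (integrable_ae measurableT Fi) => x h _ /=.
  by rewrite fineK// h.
Qed.

Let fiE : (m1 \x m2)%E.-integrable setT (EFin \o f) := fi.

Lemma Rint_fubini1 :
  \int[(m1 \x m2)%E]_z f z = \int[m1]_x \int[m2]_y f (x, y).
Proof.
rewrite /Rintegral -(integral12_prod_meas1 fiE) fineF//.
exact: (integrable_fubini_F fiE).
Qed.

Lemma Rint_fubini2 :
  \int[(m1 \x m2)%E]_z f z = \int[m2]_y \int[m1]_x f (x, y).
Proof.
rewrite /Rintegral -(integral21_prod_meas1 fiE) fineG//.
have mf : measurable_fun setT (EFin \o f) by exact: measurable_int fiE.
apply/integrableP; split; first exact: (measurable_fubini_G fiE).
apply: le_lt_trans ((integrable21ltyP m1 m2 mf).1 fiE).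
apply: ge0_le_integral => //.
- by apply: measurableT_comp => //; exact: (measurable_fubini_G fiE).
- apply: (@measurable_fun_fubini_tonelli_G _ _ _ _ _ m1 (fun z => `|(f z)%:E|%E)) => //.
  exact: measurableT_comp.
- move=> y _; apply: le_abse_integral => //.
  exact: measurableT_comp mf _.
Qed.

Lemma Rint_fubini :
  \int[m1]_x \int[m2]_y f (x, y) = \int[m2]_y \int[m1]_x f (x, y).
Proof. by rewrite -Rint_fubini1 Rint_fubini2. Qed.

End integrable.

Lemma measurable_Rint2 f : measurable_fun setT f -> (forall z, 0 <= f z) ->
  measurable_fun setT (fun x => \int[m2]_y f (x, y)).
Proof.
move=> mf f0; apply: (measurableT_comp (f := fine)) => //.
apply: (@measurable_fun_fubini_tonelli_F _ _ _ _ _ m2 (EFin \o f)) => //.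
exact/measurable_EFinP.
Qed.

Lemma Rint_prod (g : T1 -> R) (h : T2 -> R) : rint m1 g -> rint m2 h ->
  \int[(m1 \x m2)%E]_z (g z.1 * h z.2) = (\int[m1]_x g x) * \int[m2]_y h y.
Proof.
move=> gi hi; rewrite (Rint_fubini1 (rint_prod gi hi)) /= -RintZr//.
by apply: eq_Rint => x; rewrite RintZ.
Qed.

End fubini.

Section pushforward.
Context d1 d2 (T1 : measurableType d1) (T2 : measurableType d2) (R : realType).
Variables (m : {measure set T1 -> \bar R}) (phi : T1 -> T2).
Hypothesis mphi : measurable_fun setT phi.
Variables (m' : {measure set T2 -> \bar R}).
Hypothesis mE : forall A, measurable A -> m' A = m (phi @^-1` A).

Let int_pushforward_ge0 (f : T2 -> \bar R) : measurable_fun setT f ->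
  (forall x, 0 <= f x)%E -> (\int[m']_y f y = \int[m]_x f (phi x))%E.
Proof.
move=> mf f0.
have <- := @ge0_integral_pushforward _ _ _ _ _ _ mphi m setT f measurableT.
  by apply: eq_measure_integral => A mA _; rewrite mE.
by [].
by move=> x _; exact: f0.
Qed.

(** The image measure enters only through its values on measurable sets, so the same statement
    serves laws of random vectors, affine maps of Lebesgue measure and the recursive structure of
    [lebesgue_row]. *)
Lemma rint_image (f : T2 -> R) : measurable_fun setT f ->
  rint m' f <-> rint m (fun x => f (phi x)).
Proof.
move=> mf.
have E : (\int[m']_y `|(f y)%:E| = \int[m]_x `|(f (phi x))%:E|)%E.
  apply: (int_pushforward_ge0 (f := fun x => `|(f x)%:E|%E)) => //.
  by apply/measurable_EFinP; mfun.
rewrite /rint; split=> /integrableP[_ h]; apply/integrableP; split.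
- by apply/measurable_EFinP; exact: measurable_compT.
- exact: etrans (congr1 (fun z => z < +oo)%E (esym E)) h.
- exact/measurable_EFinP.
- exact: etrans (congr1 (fun z => z < +oo)%E E) h.
Qed.

Lemma Rint_image (f : T2 -> R) : measurable_fun setT f ->
  \int[m']_y f y = \int[m]_x f (phi x).
Proof.
move=> mf; rewrite /Rintegral; congr fine.
have mf' : measurable_fun setT (fun y => (f y)%:E) by exact/measurable_EFinP.
have Ep := int_pushforward_ge0 (measurable_funepos mf') (funepos_ge0 _).
have En := int_pushforward_ge0 (measurable_funeneg mf') (funeneg_ge0 _).
rewrite integralE [RHS]integralE Ep En; congr (_ - _)%E.
  by apply: eq_integral => x _; rewrite !funeposE.
by apply: eq_integral => x _; rewrite !funenegE.
Qed.

End pushforward.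

(** * The complex exponential *)

Section derivatives.
Context (R : realType).
Implicit Types f g : R -> R.

Lemma is_derive_funD f g (x a b : R) : is_derive x 1 f a -> is_derive x 1 g b ->
  is_derive x 1 (fun t => f t + g t) (a + b).
Proof. exact: is_deriveD. Qed.

Lemma is_derive_funB f g (x a b : R) : is_derive x 1 f a -> is_derive x 1 g b ->
  is_derive x 1 (fun t => f t - g t) (a - b).
Proof. exact: is_deriveB. Qed.

Lemma is_derive_funM f g (x a b : R) : is_derive x 1 f a -> is_derive x 1 g b ->
  is_derive x 1 (fun t => f t * g t) (a * g x + f x * b).
Proof.
by move=> fa gb; apply: (is_derive_eq (is_deriveM fa gb)); rewrite addrC mulrC.
Qed.

Lemma is_derive_funZ f (x a c : R) : is_derive x 1 f a ->
  is_derive x 1 (fun t => c * f t) (c * a).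
Proof. exact: is_deriveZ. Qed.

Lemma is_derive_fun_cst (x c : R) : is_derive x 1 (fun=> c) 0.
Proof. exact: is_derive_cst. Qed.

Lemma is_derive_comp f g (x a b : R) : is_derive (g x) 1 f a ->
  is_derive x 1 g b -> is_derive x 1 (fun t => f (g t)) (b * a).
Proof.
by move=> fa gb; apply: (is_derive_eq (is_derive1_comp fa gb)); rewrite mulrC.
Qed.

Lemma is_derive_scaled f (x a v : R) : is_derive (x * v) 1 f a ->
  is_derive x 1 (fun t => f (t * v)) (v * a).
Proof.
move=> fa; apply: (is_derive_comp (g := fun t => t * v)) => //.
apply: (is_derive_eq (is_derive_funM (is_derive_id x 1) (is_derive_fun_cst x v))).
by rewrite mul1r mulr0 addr0.
Qed.

Lemma is_derive_sum (I : Type) (s : seq I) (f df : I -> R -> R) (x : R) :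
  (forall i, is_derive x 1 (f i) (df i x)) ->
  is_derive x 1 (fun t => \sum_(i <- s) f i t) (\sum_(i <- s) df i x).
Proof.
move=> h; elim: s => [|i s IH].
  rewrite big_nil (_ : (fun _ => _) = fun=> 0); first exact: is_derive_fun_cst.
  by apply/funext => t; rewrite big_nil.
rewrite big_cons (_ : (fun _ => _) = fun t => f i t + \sum_(j <- s) f j t).
  exact: is_derive_funD.
by apply/funext => t; rewrite big_cons.
Qed.

Lemma is_derive_Xfact n (x : R) :
  is_derive x 1 (fun t => t ^+ n.+1 / n.+1`!%:R) (x ^+ n / n`!%:R).
Proof.
have h : is_derive x 1 (fun t : R => t ^+ n.+1) (n.+1%:R * x ^+ n).
  rewrite (_ : (fun _ => _) = (@id R) ^+ n.+1).
    by apply: (is_derive_eq (is_deriveX n.+1 (is_derive_id x 1))); rewrite /= scaler1.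
  by apply/funext => t; rewrite exprfctE.
apply: (is_derive_eq (is_derive_funM h (is_derive_fun_cst x _))).
rewrite mulr0 addr0 factS natrM invfM mulrA; congr (_ / _).
by rewrite mulrAC mulfV ?mul1r// pnatr_eq0.
Qed.

Lemma le_init_of_derive_le0 f (df : R -> R) (x : R) : 0 <= x ->
  (forall t : R, is_derive t 1 f (df t)) ->
  (forall t, 0 <= t <= x -> df t <= 0) -> f x <= f 0.
Proof.
move=> x0 h h0.
have [//|c] := @MVT_segment _ f df 0 x x0 (fun t _ => h t).
  by apply: derivable_within_continuous => t _; case: (h t).
rewrite in_itv/= => cx E; rewrite -subr_le0 E subr0.
by rewrite mulr_le0_ge0// h0.
Qed.

End derivatives.

Section complex_exponential.
Context (R : realType).
Implicit Types (z : R[i]) (a b x y : R).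

Definition expi x : R[i] := cos x +i* sin x.
Definition cexp z : R[i] := (expR (complex.Re z))%:C * expi (complex.Im z).

Lemma complexP z w : complex.Re z = complex.Re w ->
  complex.Im z = complex.Im w -> z = w.
Proof. by case: z w => [a b] [c e] /= -> ->. Qed.

Lemma complex_mulE a b x y :
  (a +i* b) * (x +i* y) = (a * x - b * y) +i* (a * y + b * x).
Proof. by []. Qed.

Lemma complex_addE a b x y : (a +i* b) + (x +i* y) = (a + x) +i* (b + y).
Proof. by []. Qed.

Lemma ReZ a z : complex.Re (a%:C * z) = a * complex.Re z.
Proof. by case: z => x y /=; rewrite mul0r subr0. Qed.

Lemma ImZ a z : complex.Im (a%:C * z) = a * complex.Im z.
Proof. by case: z => x y /=; rewrite mul0r addr0. Qed.

Lemma expiD x y : expi (x + y) = expi x * expi y.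
Proof.
rewrite /expi complex_mulE cosD sinD; congr (_ +i* _).
by rewrite addrC [cos x * sin y + _]addrC addrC.
Qed.

Lemma expi0 : expi 0 = 1.
Proof. by rewrite /expi cos0 sin0. Qed.

Lemma normc_expi x : normc (expi x) = 1.
Proof. by rewrite /= cos2Dsin2 sqrtr1. Qed.

Lemma cexpD z w : cexp (z + w) = cexp z * cexp w.
Proof.
rewrite /cexp raddfD raddfD /= expRD expiD rmorphM /=.
by rewrite -!mulrA; congr (_ * _); rewrite mulrCA.
Qed.

Lemma cexp0 : cexp 0 = 1.
Proof. by rewrite /cexp /= expR0 expi0 mulr1. Qed.

Lemma cexp_natM z n : cexp (z *+ n) = cexp z ^+ n.
Proof.
elim: n => [|n IH]; first by rewrite cexp0.
by rewrite mulrS cexpD IH exprS.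
Qed.

Lemma normc_real a : normc a%:C = `|a|.
Proof. by rewrite /= expr0n /= addr0 sqrtr_sqr. Qed.

Lemma normc_cexp z : normc (cexp z) = expR (complex.Re z).
Proof. by rewrite normcM normc_expi mulr1 normc_real gtr0_norm// expR_gt0. Qed.

Lemma normc_ge0 z : 0 <= normc z.
Proof. by case: z => a b; rewrite sqrtr_ge0. Qed.

Lemma normc_sqr z : normc z ^+ 2 = complex.Re z ^+ 2 + complex.Im z ^+ 2.
Proof. by case: z => a b /=; rewrite sqr_sqrtr// addr_ge0 ?sqr_ge0. Qed.

Lemma normcX z n : normc (z ^+ n) = normc z ^+ n.
Proof.
elim: n => [|n IH]; first by rewrite !expr0 normc1.
by rewrite !exprS normcM IH.
Qed.

Lemma normcD_le z w : normc (z + w) <= normc z + normc w.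
Proof. exact: le_normcD. Qed.

Lemma normcB_sym z w : normc (z - w) = normc (w - z).
Proof. by rewrite -(opprB w z); exact: normcN. Qed.

Lemma normcB_le z w : normc (z - w) <= normc z + normc w.
Proof.
have <- : normc (- w) = normc w by exact: normcN.
exact: normcD_le.
Qed.

Lemma normc_le_add a b : normc (a +i* b) <= `|a| + `|b|.
Proof.
rewrite -(ler_pXn2r (n := 2)) ?nnegrE ?normc_ge0 ?addr_ge0//.
rewrite normc_sqr /= sqrrD !real_normK ?num_real// -addrA lerD2l.
by rewrite lerDr mulrn_wge0// mulr_ge0.
Qed.

(** Cauchy-Schwarz in the plane, from multiplicativity of the modulus: the left side is the real
    part of z times the conjugate of a + ib. *)
Lemma dot_le_normc a b z :
  a * complex.Re z + b * complex.Im z <= normc (a +i* b) * normc z.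
Proof.
rewrite -normcM.
have -> : normc ((a +i* b) * z) = normc ((a -i* b) * z).
  rewrite !normcM; congr (_ * _); by rewrite /= sqrrN.
case: z => x y; rewrite complex_mulE /= mulNr opprK.
apply: (le_trans (ler_norm _)); rewrite -sqrtr_sqr ler_wsqrtr//.
by rewrite lerDl sqr_ge0.
Qed.

Lemma Re_le_normc z : `|complex.Re z| <= normc z.
Proof. by case: z => a b; rewrite -sqrtr_sqr ler_wsqrtr// lerDl sqr_ge0. Qed.

(** [acos] yields only angles with nonnegative sine, so the sign of the imaginary part decides
    between acos c and its opposite. *)
Lemma expi_arg z : exists x, z = (normc z)%:C * expi x.
Proof.
case: (eqVneq z 0) => [->|z0].
  by exists 0; rewrite normc0 mul0r.
have n0 : 0 < normc z.
  by rewrite lt_neqAle normc_ge0 eq_sym andbT; apply: contra z0 => /eqP/eq0_normc ->.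
set c := complex.Re z / normc z; set s := complex.Im z / normc z.
have cs : c ^+ 2 + s ^+ 2 = 1.
  by rewrite !expr_div_n -mulrDl -normc_sqr divff// expf_neq0// gt_eqF.
have c1 : -1 <= c <= 1.
  rewrite -ler_norml -(ler_pXn2r (n := 2)) ?nnegrE// real_normK ?num_real//.
  by rewrite expr1n -cs lerDl sqr_ge0.
have ss : sin (acos c) = `|s|.
  by rewrite sin_acos// -cs addrAC subrr add0r sqrtr_sqr.
have zE x : cos x = c -> sin x = s -> z = (normc z)%:C * expi x.
  move=> h1 h2; rewrite /expi h1 h2; apply: complexP => /=.
    by rewrite mul0r subr0 /c mulrC divfK// gt_eqF.
  by rewrite mul0r addr0 /s mulrC divfK// gt_eqF.
have cc : cos (acos c) = c by apply: acosK; rewrite in_itv.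
case: (lerP 0 s) => s0.
  by exists (acos c); apply: zE => //; rewrite ss ger0_norm.
exists (- acos c); apply: zE; first by rewrite cosN.
by rewrite sinN ss ltr0_norm// opprK.
Qed.

Section taylor.
Variables (u v : R).
Let z : R[i] := u +i* v.
(** [ER k] and [EI k] are the real and imaginary parts of the remainder of exp(t z) after k Taylor
    terms. Differentiating remainder k+1 in t gives z times remainder k, which drives the
    induction. *)
Let ER k (t : R) : R := expR (t * u) * cos (t * v) -
  \sum_(j < k) complex.Re (z ^+ j) * (t ^+ j / j`!%:R).
Let EI k (t : R) : R := expR (t * u) * sin (t * v) -
  \sum_(j < k) complex.Im (z ^+ j) * (t ^+ j / j`!%:R).
Let M := expR `|u|.

Let der_sum (h : R[i] -> R) k (t : R) :
  is_derive t 1 (fun t => \sum_(j < k.+1) h (z ^+ j) * (t ^+ j / j`!%:R))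
    (\sum_(j < k) h (z ^+ j.+1) * (t ^+ j / j`!%:R)).
Proof.
rewrite (_ : (fun _ => _) = fun t => h (z ^+ 0) +
    \sum_(j < k) h (z ^+ j.+1) * (t ^+ j.+1 / j.+1`!%:R)).
  rewrite -[X in is_derive _ _ _ X]add0r.
  apply: (is_derive_funD (is_derive_fun_cst _ _)).
  apply: (@is_derive_sum _ _ _ _
    (fun (j : 'I_k) t => h (z ^+ j.+1) * (t ^+ j / j`!%:R))) => j.
  exact/is_derive_funZ/is_derive_Xfact.
apply/funext => x; rewrite big_ord_recl /= fact0 expr0 divr1 mulr1; congr (_ + _).
Qed.

Let derER k (t : R) : is_derive t 1 (ER k.+1) (u * ER k t - v * EI k t).
Proof.
rewrite /ER; apply: is_derive_eq.
  exact: (is_derive_funB (is_derive_funM (is_derive_scaled (is_derive_expR _))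
    (is_derive_scaled (is_derive_cos _))) (der_sum _ _ _)).
rewrite /EI !mulrBr !mulr_sumr.
have -> : \sum_(j < k) complex.Re (z ^+ j.+1) * (t ^+ j / j`!%:R) =
    \sum_(j < k) u * (complex.Re (z ^+ j) * (t ^+ j / j`!%:R)) -
    \sum_(j < k) v * (complex.Im (z ^+ j) * (t ^+ j / j`!%:R)).
  rewrite -sumrB; apply: eq_bigr => j _; rewrite exprS.
  by case: (z ^+ j) => a b /=; ring.
ring.
Qed.

Let derEI k (t : R) : is_derive t 1 (EI k.+1) (v * ER k t + u * EI k t).
Proof.
rewrite /EI; apply: is_derive_eq.
  exact: (is_derive_funB (is_derive_funM (is_derive_scaled (is_derive_expR _))
    (is_derive_scaled (is_derive_sin _))) (der_sum _ _ _)).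
rewrite /ER !mulrBr !mulr_sumr.
have -> : \sum_(j < k) complex.Im (z ^+ j.+1) * (t ^+ j / j`!%:R) =
    \sum_(j < k) v * (complex.Re (z ^+ j) * (t ^+ j / j`!%:R)) +
    \sum_(j < k) u * (complex.Im (z ^+ j) * (t ^+ j / j`!%:R)).
  rewrite -big_split; apply: eq_bigr => j _; rewrite exprS.
  by case: (z ^+ j) => a b /=; ring.
ring.
Qed.

Let E0 k : ER k.+1 0 = 0 /\ EI k.+1 0 = 0.
Proof.
rewrite /ER /EI !mul0r expR0 cos0 sin0 !mul1r !big_ord_recl /= fact0.
rewrite !big1 => [|j _|j _].
- by rewrite expr0 divr1 mulr1 mul0r !addr0 subrr subr0.
- by rewrite expr0n /= mul0r mulr0.
- by rewrite expr0n /= mul0r mulr0.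
Qed.

(** The mean value theorem has no equality form for complex values, so the remainder is bounded
    after pairing with each real direction (c, s). Differentiation multiplies by z, and moving z to
    the other side of the pairing replaces c + is by its product with the conjugate of z. *)
Let taylor_dir k : forall (c s t : R), 0 <= t <= 1 ->
  c * ER k t + s * EI k t <=
    normc (c +i* s) * normc z ^+ k * M * (t ^+ k / k`!%:R).
Proof.
elim: k => [|k IH] c s t /andP[t0 t1].
  rewrite /ER /EI !big_ord0 !subr0 expr0 mulr1 fact0 expr0 divr1 mulr1.
  have := dot_le_normc c s (cexp ((t * u) +i* (t * v))).
  rewrite normc_cexp /= !mul0r subr0 addr0 => /le_trans; apply.
  apply: ler_wpM2l; first exact: sqrtr_ge0.
  rewrite ler_expR; apply: (le_trans (ler_norm _)).
  by rewrite normrM ger0_norm// ler_piMl.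
pose B t := c * ER k.+1 t + s * EI k.+1 t -
  normc (c +i* s) * normc z ^+ k.+1 * M * (t ^+ k.+1 / k.+1`!%:R).
have [e1 e2] := E0 k.
rewrite -subr_le0 -/(B t).
have -> : 0 = B 0.
  by rewrite /B e1 e2 !mulr0 expr0n /= mul0r mulr0 addr0 subr0.
apply: (le_init_of_derive_le0 t0 (df := fun x => c * (u * ER k x - v * EI k x) +
   s * (v * ER k x + u * EI k x) -
   normc (c +i* s) * normc z ^+ k.+1 * M * (x ^+ k / k`!%:R))).
  move=> x; apply: is_derive_funB; first apply: is_derive_funD.
  - exact: is_derive_funZ.
  - exact: is_derive_funZ.
  - exact/is_derive_funZ/is_derive_Xfact.
move=> x /andP[x0 xt]; rewrite subr_le0.
have := IH (c * u + s * v) (s * u - c * v) x.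
rewrite x0 (le_trans xt t1) => /(_ isT).
rewrite (_ : normc _ = normc (c +i* s) * normc z).
  rewrite -[_ * normc z * _]mulrA -exprS => H; apply: le_trans H.
  by rewrite le_eqVlt; apply/orP; left; apply/eqP; ring.
rewrite (_ : normc (c +i* s) * normc z = normc ((c +i* s) * (u -i* v))); last first.
  by rewrite normcM; congr (_ * _); rewrite /z /= sqrrN.
by rewrite complex_mulE; congr (normc (_ +i* _)); ring.
Qed.

Lemma cexp_taylor_aux k :
  normc (cexp z - \sum_(j < k) (j`!%:R^-1)%:C * z ^+ j) <=
  normc z ^+ k / k`!%:R * expR `|u|.
Proof.
set D := _ - _.
have DE : D = ER k 1 +i* EI k 1.
  apply: complexP.
    rewrite /D raddfB /= /ER !mul1r /cexp /= mul0r subr0; congr (_ - _).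
    rewrite raddf_sum; apply: eq_bigr => j _; rewrite expr1n mul1r.
    by rewrite -[LHS]/(complex.Re _) ReZ mulrC.
  rewrite /D raddfB /= /EI !mul1r /cexp /= mul0r addr0; congr (_ - _).
  rewrite raddf_sum; apply: eq_bigr => j _; rewrite expr1n mul1r.
  by rewrite -[LHS]/(complex.Im _) ImZ mulrC.
have [D0|D0] := eqVneq (normc D) 0.
  by rewrite D0 !mulr_ge0 ?exprn_ge0 ?normc_ge0 ?invr_ge0 ?expR_ge0.
have Dp : 0 < normc D by rewrite lt_neqAle eq_sym D0 normc_ge0.
(* With the remainder itself as direction, the left side becomes its squared modulus. *)
have := @taylor_dir k (ER k 1) (EI k 1) 1; rewrite ler01 lexx => /(_ isT).
have -> : ER k 1 * ER k 1 + EI k 1 * EI k 1 = normc D * normc D.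
  by rewrite -[RHS]expr2 normc_sqr DE /= !expr2.
rewrite -DE -!mulrA ler_pM2l// => /le_trans; apply.
by rewrite expr1n mul1r le_eqVlt; apply/orP; left; apply/eqP; rewrite /M; ring.
Qed.

End taylor.

Lemma cexp_taylor z k :
  normc (cexp z - \sum_(j < k) (j`!%:R^-1)%:C * z ^+ j) <=
  normc z ^+ k / k`!%:R * expR `|complex.Re z|.
Proof. by case: z => u v; exact: cexp_taylor_aux. Qed.

Lemma expi_sub_le x y : normc (expi x - expi y) <= `|x - y|.
Proof.
rewrite -[x in expi x](subrK y) expiD -[X in _ - X]mul1r -mulrBl normcM.
rewrite normc_expi mulr1.
have := cexp_taylor (0 +i* (x - y)) 1.
rewrite big_ord1 expr0 mulr1 fact0 invr1 /cexp /= expR0 mul1r.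
by rewrite !mul0r mul1r !subr0 addr0 expr1 expr0n /= add0r sqrtr_sqr normr0 expR0 !mulr1.
Qed.

Lemma norm_sin_natM x k : `|sin (x *+ k)| <= k%:R * `|sin x|.
Proof.
elim: k => [|k IH]; first by rewrite mulr0n sin0 normr0 mul0r.
rewrite mulrS sinD -natr1 mulrDl mul1r addrC.
apply: (le_trans (ler_normD _ _)); rewrite !normrM lerD//.
  rewrite -[leRHS]mul1r ler_pM//; apply: cos_max.
by rewrite -[leRHS]mulr1 ler_wpM2l// cos_max.
Qed.

(** The half-angle formula 1 - cos y = 2 sin^2(y/2) reduces this to |sin(k y)| <= k |sin y|. *)
Lemma onem_cos_natM x k : 1 - cos (x *+ k) <= k%:R ^+ 2 * (1 - cos x).
Proof.
have E y : 1 - cos y = 2 * sin (y / 2) ^+ 2.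
  have -> : cos y = cos (y / 2 *+ 2) by rewrite -mulr_natr divfK.
  by rewrite cos_mulr2n cos2sin2; ring.
rewrite !E [leRHS]mulrCA ler_wpM2l// -exprMn.
have -> : (x *+ k) / 2 = (x / 2) *+ k by rewrite mulrnAl.
rewrite -real_normK ?num_real// -[leRHS]real_normK ?num_real//.
by rewrite ler_pXn2r ?nnegrE// normrM normr_nat norm_sin_natM.
Qed.

End complex_exponential.

(** * Oscillatory integrals *)

Section oscillatory_integrals.
Context d (T : measurableType d) (R : realType).
Implicit Types (m : {measure set T -> \bar R}) (w theta : T -> R).

(** The integral of w e^(i theta), kept as a pair of real integrals so that real integration theory
    applies to it. *)
Definition osc m w theta : R[i] :=
  (\int[m]_x (w x * cos (theta x))) +i* (\int[m]_x (w x * sin (theta x))).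

Lemma rint_cos m w theta : rint m w -> measurable_fun setT theta ->
  rint m (fun x => w x * cos (theta x)).
Proof.
by move=> wi mt; apply: (rintM_bounded (c := 1)) => [//||x]; [mfun|exact: cos_max].
Qed.

Lemma rint_sin m w theta : rint m w -> measurable_fun setT theta ->
  rint m (fun x => w x * sin (theta x)).
Proof.
by move=> wi mt; apply: (rintM_bounded (c := 1)) => [//||x]; [mfun|exact: sin_max].
Qed.

Lemma eq_osc m w w' theta theta' : w =1 w' -> theta =1 theta' ->
  osc m w theta = osc m w' theta'.
Proof. by move=> /funext -> /funext ->. Qed.

(** Pair the integral with itself, apply Cauchy-Schwarz under the integral sign and divide by its
    modulus. *)
Lemma normc_Rint_le m (f g h : T -> R) : rint m f -> rint m g -> rint m h ->
  (forall x, normc (f x +i* g x) <= h x) ->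
  normc ((\int[m]_x f x) +i* (\int[m]_x g x)) <= \int[m]_x h x.
Proof.
move=> fi gi hi le; set a := Rintegral m setT f; set b := Rintegral m setT g.
set z := a +i* b.
have [->|z0] := eqVneq (normc z) 0.
  by apply: Rint_ge0 => x; apply: le_trans (le x); exact: normc_ge0.
have zp : 0 < normc z by rewrite lt_neqAle eq_sym z0 normc_ge0.
have zz : normc z * normc z = \int[m]_x (a * f x + b * g x).
  by rewrite RintD ?RintZ//; [rewrite -expr2 normc_sqr /= !expr2|exact: rintZ|exact: rintZ].
rewrite -(ler_pM2l zp) zz.
rewrite -RintZ//; apply: le_Rint; [|exact: rintZ|move=> x].
  by apply: rintD; exact: rintZ.
apply: (le_trans (dot_le_normc _ _ (f x +i* g x))).
by apply: ler_wpM2l (le x); exact: ltW.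
Qed.

Lemma normc_osc_le m w theta : rint m w -> measurable_fun setT theta ->
  normc (osc m w theta) <= \int[m]_x `|w x|.
Proof.
move=> wi mt; apply: normc_Rint_le.
- exact: rint_cos.
- exact: rint_sin.
- exact: rint_norm.
move=> x; rewrite (_ : _ +i* _ = (w x)%:C * expi (theta x)); last first.
  by rewrite complex_mulE !mul0r subr0 addr0.
by rewrite normcM normc_expi mulr1 normc_real.
Qed.

Lemma osc_phase m w theta c : rint m w -> measurable_fun setT theta ->
  osc m w (fun x => theta x + c) = osc m w theta * expi c.
Proof.
move=> wi mt; rewrite /osc /expi complex_mulE.
have ic := rint_cos wi mt; have si := rint_sin wi mt.
congr (_ +i* _).
  rewrite -!RintZr// -RintB.
  - by apply: eq_Rint => x; rewrite cosD mulrBr !mulrA.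
  - by apply: eq_rint (rintZ (cos c) ic) => x; rewrite mulrC.
  - by apply: eq_rint (rintZ (sin c) si) => x; rewrite mulrC.
rewrite -!RintZr// -RintD.
- by apply: eq_Rint => x; rewrite sinD mulrDr !mulrA addrC.
- by apply: eq_rint (rintZ (sin c) ic) => x; rewrite mulrC.
- by apply: eq_rint (rintZ (cos c) si) => x; rewrite mulrC.
Qed.

Lemma Re_osc_phase m w theta c : rint m w -> measurable_fun setT theta ->
  complex.Re (osc m w theta * expi c) = \int[m]_x (w x * cos (theta x + c)).
Proof. by move=> wi mt; rewrite -osc_phase. Qed.

Lemma oscD m w w' theta : rint m w -> rint m w' -> measurable_fun setT theta ->
  osc m (fun x => w x + w' x) theta = osc m w theta + osc m w' theta.
Proof.
move=> wi wi' mt; rewrite /osc complex_addE -!RintD;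
  try exact: rint_cos; try exact: rint_sin.
by congr (_ +i* _); apply: eq_Rint => x; rewrite mulrDl.
Qed.

Lemma oscZ m w theta c : rint m w -> measurable_fun setT theta ->
  osc m (fun x => c * w x) theta = c%:C * osc m w theta.
Proof.
move=> wi mt; rewrite /osc complex_mulE !mul0r subr0 addr0 -!RintZ.
- by congr (_ +i* _); apply: eq_Rint => x; rewrite mulrA.
- exact: rint_sin.
- exact: rint_cos.
Qed.

Lemma osc0 m w : osc m w (fun=> 0) = (\int[m]_x w x)%:C.
Proof.
rewrite /osc; congr (_ +i* _).
  by apply: eq_Rint => x; rewrite cos0 mulr1.
by rewrite -[RHS](Rint0 m); apply: eq_Rint => x; rewrite sin0 mulr0.
Qed.

Lemma osc_sub_le m w theta theta' : rint m w -> measurable_fun setT theta ->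
  measurable_fun setT theta' -> rint m (fun x => `|w x| * `|theta x - theta' x|) ->
  normc (osc m w theta - osc m w theta') <=
  \int[m]_x (`|w x| * `|theta x - theta' x|).
Proof.
move=> wi mt mt' hi.
have -> : osc m w theta - osc m w theta' =
  (\int[m]_x (w x * cos (theta x) - w x * cos (theta' x))) +i*
  (\int[m]_x (w x * sin (theta x) - w x * sin (theta' x))).
  by rewrite !RintB//; try exact: rint_cos; try exact: rint_sin.
apply: normc_Rint_le => //.
- by apply: rintB; exact: rint_cos.
- by apply: rintB; exact: rint_sin.
move=> x; rewrite (_ : _ +i* _ = (w x)%:C * (expi (theta x) - expi (theta' x))).
  by rewrite normcM normc_real ler_wpM2l// expi_sub_le.
rewrite /expi (_ : (_ +i* _) - (_ +i* _) = (cos (theta x) - cos (theta' x)) +i*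
   (sin (theta x) - sin (theta' x)))//.
by rewrite complex_mulE !mul0r subr0 addr0 !mulrBr.
Qed.

(* With the phase c of the integral at theta absorbed, this integrates
   [1 - cos (k y) <= k^2 (1 - cos y)] at [y = theta x + c]. *)
Lemma osc_multiple m w theta k : rint m w -> (forall x, 0 <= w x) ->
  measurable_fun setT theta ->
  \int[m]_x w x - normc (osc m w (fun x => theta x *+ k)) <=
  k%:R ^+ 2 * (\int[m]_x w x - normc (osc m w theta)).
Proof.
move=> wi w0 mt; have [c cE] := expi_arg (osc m w theta).
have mk : measurable_fun setT (fun x => theta x *+ k).
  rewrite (_ : (fun _ => _) = fun x => theta x * k%:R); last first.
    by apply/funext => x; rewrite mulr_natr.
  by mfun.
have -> : normc (osc m w theta) = \int[m]_x (w x * cos (theta x - c)).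
  by rewrite -(Re_osc_phase (- c) wi mt) [in RHS]cE -mulrA -expiD subrr expi0 mulr1.
have h : \int[m]_x (w x * cos (theta x *+ k + (- c) *+ k)) <=
    normc (osc m w (fun x => theta x *+ k)).
  rewrite -Re_osc_phase//; apply: (le_trans (ler_norm _)).
  by apply: (le_trans (Re_le_normc _)); rewrite normcM normc_expi mulr1.
apply: (@le_trans _ _ (\int[m]_x w x - \int[m]_x (w x * cos (theta x *+ k + (- c) *+ k)))).
  by rewrite lerD2l lerN2.
have i1 : rint m (fun x => w x * cos (theta x *+ k - c *+ k)).
  by apply: rint_cos => //; mfun.
have i2 : rint m (fun x => w x * cos (theta x - c)).
  by apply: rint_cos => //; mfun.
rewrite mulNrn -!RintB// -RintZ; last exact: rintB.
apply: le_Rint; [exact: rintB|exact/rintZ/rintB|move=> x].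
have E y : w x - w x * y = w x * (1 - y) by rewrite mulrBr mulr1.
rewrite !E [leRHS]mulrCA.
by rewrite ler_wpM2l// -mulrnBl; exact: onem_cos_natM.
Qed.

End oscillatory_integrals.

Lemma osc_image d1 d2 (T1 : measurableType d1) (T2 : measurableType d2)
    (R : realType) (m : {measure set T1 -> \bar R}) (phi : T1 -> T2)
    (m' : {measure set T2 -> \bar R}) (w theta : T2 -> R) :
  measurable_fun setT phi ->
  (forall A, measurable A -> m' A = m (phi @^-1` A)) ->
  measurable_fun setT w -> measurable_fun setT theta ->
  osc m' w theta = osc m (fun x => w (phi x)) (fun x => theta (phi x)).
Proof.
move=> mphi mE mw mt; rewrite /osc.
by congr (_ +i* _); rewrite (Rint_image mphi mE)//; mfun.
Qed.

Lemma osc_prod d1 d2 (T1 : measurableType d1) (T2 : measurableType d2)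
    (R : realType) (m1 : {sigma_finite_measure set T1 -> \bar R})
    (m2 : {sigma_finite_measure set T2 -> \bar R})
    (w1 t1 : T1 -> R) (w2 t2 : T2 -> R) :
  rint m1 w1 -> rint m2 w2 -> measurable_fun setT t1 -> measurable_fun setT t2 ->
  osc (m1 \x m2)%E (fun z => w1 z.1 * w2 z.2) (fun z => t1 z.1 + t2 z.2) =
  osc m1 w1 t1 * osc m2 w2 t2.
Proof.
move=> i1 i2 mt1 mt2; rewrite /osc complex_mulE.
have c1 := rint_cos i1 mt1; have s1 := rint_sin i1 mt1.
have c2 := rint_cos i2 mt2; have s2 := rint_sin i2 mt2.
have cc := rint_prod c1 c2; have ss := rint_prod s1 s2.
have cs := rint_prod c1 s2; have sc := rint_prod s1 c2.
rewrite -(Rint_prod c1 c2) -(Rint_prod s1 s2) -(Rint_prod c1 s2) -(Rint_prod s1 c2).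
rewrite -(RintB cc ss) -(RintD cs sc).
congr (_ +i* _); apply: eq_Rint => z.
  by rewrite cosD; ring.
by rewrite sinD; ring.
Qed.

(** * Inner product and l^1 norm of row vectors *)

Section row_geometry.
Context (R : realType) (n : nat).
Implicit Types x y z : 'rV[R]_n.

(** The l^1 norm serves in every estimate that is stable under equivalent norms: it is a plain sum
    over coordinates, and it bounds the inner product directly. *)
Definition nrm x : R := \sum_i `|x 0 i|.

Lemma dotpC x y : dotp x y = dotp y x.
Proof. by apply: eq_bigr => i _; rewrite mulrC. Qed.

Lemma dotpDr x y z : dotp x (y + z) = dotp x y + dotp x z.
Proof. by rewrite /dotp -big_split; apply: eq_bigr => i _; rewrite mxE mulrDr. Qed.

Lemma dotpDl x y z : dotp (x + y) z = dotp x z + dotp y z.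
Proof. by rewrite dotpC dotpDr !(dotpC z). Qed.

Lemma dotpZr c x y : dotp x (c *: y) = c * dotp x y.
Proof. by rewrite /dotp mulr_sumr; apply: eq_bigr => i _; rewrite mxE mulrCA. Qed.

Lemma dotpZl c x y : dotp (c *: x) y = c * dotp x y.
Proof. by rewrite dotpC dotpZr dotpC. Qed.

Lemma dotpNr x y : dotp x (- y) = - dotp x y.
Proof. by rewrite -scaleN1r dotpZr mulN1r. Qed.

Lemma dotpNl x y : dotp (- x) y = - dotp x y.
Proof. by rewrite dotpC dotpNr dotpC. Qed.

Lemma dotpBr x y z : dotp x (y - z) = dotp x y - dotp x z.
Proof. by rewrite dotpDr dotpNr. Qed.

Lemma dotpBl x y z : dotp (x - y) z = dotp x z - dotp y z.
Proof. by rewrite dotpDl dotpNl. Qed.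

Lemma dotp0r x : dotp x 0 = 0.
Proof. by rewrite -(scale0r x) dotpZr mul0r. Qed.

Lemma dotp0l x : dotp 0 x = 0.
Proof. by rewrite dotpC dotp0r. Qed.

Lemma dotp_sqr x : dotp x x = \sum_i x 0 i ^+ 2.
Proof. by apply: eq_bigr => i _; rewrite expr2. Qed.

Lemma dotp_ge0 x : 0 <= dotp x x.
Proof. by rewrite dotp_sqr sumr_ge0// => i _; rewrite sqr_ge0. Qed.

Lemma enorm_sqr x : enorm x ^+ 2 = dotp x x.
Proof. by rewrite sqr_sqrtr// dotp_ge0. Qed.

Lemma dotp_sqrD x y : dotp (x + y) (x + y) = dotp x x + 2 * dotp x y + dotp y y.
Proof. by rewrite dotpDl !dotpDr (dotpC y x); ring. Qed.

Lemma dotp_sqrB x y : dotp (x - y) (x - y) = dotp x x - 2 * dotp x y + dotp y y.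
Proof. by rewrite dotp_sqrD !dotpNr dotpNl opprK mulrN. Qed.

Lemma nrm_ge0 x : 0 <= nrm x.
Proof. by rewrite sumr_ge0. Qed.

Lemma nrm0 : nrm 0 = 0.
Proof. by rewrite /nrm big1// => i _; rewrite mxE normr0. Qed.

Lemma nrmD x y : nrm (x + y) <= nrm x + nrm y.
Proof. by rewrite -big_split ler_sum// => i _; rewrite mxE ler_normD. Qed.

Lemma nrmZ c x : nrm (c *: x) = `|c| * nrm x.
Proof. by rewrite mulr_sumr; apply: eq_bigr => i _; rewrite mxE normrM. Qed.

Lemma nrmN x : nrm (- x) = nrm x.
Proof. by rewrite -scaleN1r nrmZ normrN1 mul1r. Qed.

Lemma coord_le_nrm x i : `|x 0 i| <= nrm x.
Proof. by rewrite /nrm (bigD1 i)//= lerDl sumr_ge0. Qed.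

Lemma nrm_eq0 x : (nrm x == 0) = (x == 0).
Proof.
apply/idP/eqP => [/eqP x0|->]; last by rewrite nrm0.
apply/rowP => i; rewrite mxE; apply/eqP.
by rewrite -normr_le0 -x0 coord_le_nrm.
Qed.

Lemma norm_dotp_le x y : `|dotp x y| <= nrm x * nrm y.
Proof.
apply: (le_trans (ler_norm_sum _ _ _)); rewrite mulr_suml ler_sum// => i _.
by rewrite normrM ler_wpM2l// coord_le_nrm.
Qed.

Lemma dotp_le_nrm_sqr x : dotp x x <= nrm x ^+ 2.
Proof. by rewrite expr2; apply: le_trans (norm_dotp_le x x); exact: ler_norm. Qed.

Lemma nrm_sqr_le x : nrm x ^+ 2 <= n%:R * dotp x x.
Proof.
suff h : 2 * (nrm x ^+ 2) <= 2 * (n%:R * dotp x x) by rewrite ler_pM2l in h.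
rewrite expr2 {1}/nrm mulr_suml mulr_sumr.
apply: (@le_trans _ _ (\sum_(i < n) \sum_(j < n) (x 0 i ^+ 2 + x 0 j ^+ 2))).
  apply: ler_sum => i _; rewrite /nrm mulr_sumr mulr_sumr; apply: ler_sum => j _.
  rewrite -(real_normK (num_real (x 0 i))) -(real_normK (num_real (x 0 j))).
  rewrite -subr_ge0; apply: le_trans (sqr_ge0 (`|x 0 i| - `|x 0 j|)) _.
  by rewrite le_eqVlt; apply/orP; left; apply/eqP; ring.
rewrite dotp_sqr le_eqVlt; apply/orP; left; apply/eqP.
under eq_bigr => i _ do rewrite big_split /= sumr_const card_ord.
by rewrite big_split /= sumr_const card_ord sumrMnl mulr_natl mulr_natl mulr2n.
Qed.

Lemma measurable_dotpr x : measurable_fun setT (dotp x).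
Proof. rewrite (_ : dotp x = fun y => dotp x y)//; mfun. Qed.

Lemma measurable_nrm : measurable_fun setT (nrm : 'rV[R]_n -> R).
Proof. by rewrite /nrm; mfun. Qed.

End row_geometry.


(** * Affine changes of variable and the Gaussian integral on the line *)

Section scaling_and_pushforward.
Context d (T : measurableType d) (R : realType).

Lemma Rint_mscale (k : {nonneg R}) (m : {measure set T -> \bar R}) (f : T -> R) :
  rint m f -> \int[mscale k m]_x f x = k%:num * \int[m]_x f x.
Proof.
move=> fi; have mf : measurable_fun setT (EFin \o f) by exact: measurable_int fi.
rewrite /Rintegral integralE !ge0_integral_mscale//;
  [|exact: measurable_funeneg|exact: measurable_funepos].
have h1 := fineK (integrable_fin_num measurableT (integrable_funepos measurableT fi)).
have h2 := fineK (integrable_fin_num measurableT (integrable_funeneg measurableT fi)).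
rewrite [in RHS]integralE; move: h1 h2 => /=; rewrite /comp => <- <- /=.
by rewrite mulrBr.
Qed.

Lemma rint_mscale (k : {nonneg R}) (m : {measure set T -> \bar R}) (f : T -> R) :
  rint m f -> rint (mscale k m) f.
Proof.
move=> fi; have mf : measurable_fun setT (EFin \o f) by exact: measurable_int fi.
apply/integrableP; split => //.
rewrite ge0_integral_mscale//; last exact: measurableT_comp.
by have /integrableP[_ h] := fi; rewrite lte_mul_pinfty// lee_fin.
Qed.

Lemma rint_mscale_inv (k : {nonneg R}) (m : {measure set T -> \bar R}) (f : T -> R) :
  0 < k%:num -> rint (mscale k m) f -> rint m f.
Proof.
move=> k0 fi; have mf : measurable_fun setT (EFin \o f) by exact: measurable_int fi.
apply/integrableP; split => //.
have /integrableP[_] := fi; rewrite ge0_integral_mscale//; last exact: measurableT_comp.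
have : (0 <= \int[m]_x `|(EFin \o f) x|)%E by exact: integral_ge0.
case: (integral _ _ _) => [r _ _|_|//]; first exact: ltry.
by rewrite mulry gtr0_sg// mul1e.
Qed.

Context d2 (T2 : measurableType d2).
Definition pushm (m : {measure set T -> \bar R}) (phi : T -> T2)
    (mphi : measurable_fun setT phi) : {measure set T2 -> \bar R} :=
  measure_function_pushforward__canonical__measure_function_Measure m mphi.

Lemma pushmE m phi mphi A : @pushm m phi mphi A = m (phi @^-1` A).
Proof. by []. Qed.

End scaling_and_pushforward.

Section lebesgue_line.
Context {R : realType}.
Notation leb := (@lebesgue_measure R).

Lemma lebesgue_affine (a b : R) (a0 : 0 < a) A : measurable A ->
  leb A = mscale (NngNum (ltW a0)) leb ((fun x => a * x + b) @^-1` A).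
Proof.
move=> mA; have mphi : measurable_fun (setT : set (measurableTypeR R))
    (fun x : measurableTypeR R => a * x + b : measurableTypeR R).
  by mfun.
apply: (@lebesgue_measure_unique R (pushm (mscale (NngNum (ltW a0)) leb) mphi) _ A mA).
move=> _ [[u v] _ <-] /=; rewrite pushmE.
have -> : (fun x : R => a * x + b) @^-1` `]u, v]%classic =
    `](u - b) / a, (v - b) / a]%classic.
  apply/seteqP; split=> x /=; rewrite !in_itv /=;
    by rewrite ltr_pdivrMr// ler_pdivlMr// ltrBlDr lerBrDr (mulrC x).
  pose I := (`](u - b) / a, (v - b) / a]%classic : set R).
  rewrite -[RHS]/(a%:E * leb I)%E /I !lebesgue_measure_itv /= !lte_fin ltr_pM2r ?invr_gt0// ltrD2r.
  case: ifPn => _; last by rewrite mule0.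
  rewrite -!EFinB -EFinM; congr (_%:E).
  by field; rewrite gt_eqF.
exact: mphi.
Qed.

Lemma rint_affine (a b : R) (f : R -> R) : 0 < a -> measurable_fun setT f ->
  rint leb (fun x : R => f (a * x + b)) <-> rint leb f.
Proof.
move=> a0 mf; have mphi : measurable_fun (setT : set (measurableTypeR R))
    (fun x : measurableTypeR R => a * x + b : measurableTypeR R).
  by mfun.
have h := @rint_image _ _ (measurableTypeR R) (measurableTypeR R) R _ _ mphi leb
  (lebesgue_affine b a0) f mf.
split=> [fi|/h]; first by apply/h; exact: rint_mscale.
exact: rint_mscale_inv.
Qed.

Lemma Rint_affine (a b : R) (f : R -> R) : 0 < a -> rint leb f ->
  \int[leb]_x f x = a * \int[leb]_x f (a * x + b).
Proof.
move=> a0 fi; have mf : measurable_fun setT f by exact: rint_measurable fi.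
have mphi : measurable_fun (setT : set (measurableTypeR R))
    (fun x : measurableTypeR R => a * x + b : measurableTypeR R).
  by mfun.
rewrite (@Rint_image _ _ (measurableTypeR R) (measurableTypeR R) R _ _ mphi leb
  (lebesgue_affine b a0) f mf) Rint_mscale//.
exact/(rint_affine b a0 mf).
Qed.

Lemma rint_gauss_line : rint leb (fun x : R => expR (- (x ^+ 2 / 2))) /\
  \int[leb]_x expR (- (x ^+ 2 / 2)) = Num.sqrt (2 * pi).
Proof.
have s0 : 0 < Num.sqrt (2 : R) by rewrite sqrtr_gt0.
pose f (x : R) := expR (- (x ^+ 2 / 2)).
have mf : measurable_fun setT f by rewrite /f; mfun.
have gE : (fun x : R => f (Num.sqrt 2 * x + 0)) = gauss_fun.
  by apply/funext => x; rewrite /f /gauss_fun addr0 exprMn sqr_sqrtr// mulrC mulKf.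
have fi : rint leb f.
  by apply/(rint_affine 0 s0 mf); rewrite gE; exact: integrableT_gauss.
split=> //; rewrite (Rint_affine 0 s0 fi) gE sqrtrM//; congr (_ * _).
by rewrite -[RHS]/(fine (Num.sqrt pi)%:E) -integralT_gauss.
Qed.

Let e (x : R) := expR (- (x ^+ 2 / 2)).

Let e_gt0 x : 0 < e x. Proof. exact: expR_gt0. Qed.

Let ie : rint leb e. Proof. by have [] := rint_gauss_line. Qed.

Lemma rint_gauss_line_moment : rint leb (fun x : R => `|x| * expR (- (x ^+ 2 / 2))).
Proof.
have s0 : 0 < Num.sqrt (2 : R) by rewrite sqrtr_gt0.
have m4 : measurable_fun setT (fun x : R => expR (- (x ^+ 2 / 4))) by mfun.
have h : rint leb (fun x : R => expR (- (x ^+ 2 / 4))).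
  apply/(rint_affine 0 s0 m4); rewrite (_ : (fun _ => _) = e)//.
  apply/funext => x; rewrite /e addr0 exprMn sqr_sqrtr//; congr (expR (- _)).
  by field.
apply: (@rint_le _ (measurableTypeR R) R leb _ (fun x : R => expR (- (x ^+ 2 / 4)))) => //.
  by mfun.
move=> x; rewrite ger0_norm ?mulr_ge0 ?expR_ge0//.
have -> : - (x ^+ 2 / 2) = - (x ^+ 2 / 4) + - (x ^+ 2 / 4) by field.
rewrite expRD mulrA ler_piMl ?expR_ge0// expRN ler_pdivrMr ?expR_gt0// mul1r.
apply: le_trans (expR_ge1Dx _).
have := sqr_ge0 (`|x| / 2 - 1); rewrite -[x ^+ 2]real_normK ?num_real//; lra.
Qed.

Section rotating.
Variable c : R.

(** C solves C' = -u C: differentiating under the integral leaves -x e(x) sin(u x + c), and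
    integration by parts turns it into -u e(x) cos(u x + c). The free phase c covers cosine and sine
    together. *)
Let C (u : R) : R := \int[leb]_x (e x * cos (u * x + c)).

Let iC u : rint leb (fun x => e x * cos (u * x + c)).
Proof. by apply: rint_cos => //; mfun. Qed.

Let phi u (x : R) : R := e x * sin (u * x + c).
Let dphi u (x : R) : R := - x * e x * sin (u * x + c) + e x * (u * cos (u * x + c)).

Let de (x : R) : is_derive x 1 e (- x * e x).
Proof.
by apply: is_derive_eq; rewrite /e /GRing.scale /=; field.
Qed.

Let daff u (x : R) : is_derive x 1 (fun x => u * x + c) u.
Proof.
by apply: is_derive_eq; rewrite /GRing.scale /= mulr1 addr0.
Qed.

Let dphiE u (x : R) : is_derive x 1 (phi u) (dphi u x).
Proof.
exact: (is_derive_funM (de x) (is_derive_comp (is_derive_sin _) (daff u x))).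
Qed.

Let cdphi u : continuous (dphi u).
Proof.
move=> x; suff : derivable (dphi u) x 1 by move=> /derivable1_diffP /differentiable_continuous.
have h := is_derive_funD
  (is_derive_funM (is_derive_funM (is_derive_funZ (-1) (is_derive_id x 1)) (de x))
     (is_derive_comp (is_derive_sin _) (daff u x)))
  (is_derive_funM (de x)
     (is_derive_funZ u (is_derive_comp (is_derive_cos _) (daff u x)))).
rewrite (_ : dphi u = (fun t => -1 * t * e t * sin (u * t + c) +
  e t * (u * cos (u * t + c)))); first by case: h => h _; exact: h.
by apply/funext => t; rewrite /dphi /= mulN1r.
Qed.

Let idphi u : rint leb (dphi u).
Proof.
apply: (@rint_le _ (measurableTypeR R) R leb _ (fun x : R => `|x| * e x + `|u| * e x)).
- by rewrite /dphi; mfun.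
- by apply: rintD; [exact: rint_gauss_line_moment|exact: rintZ].
move=> x; apply: (le_trans (ler_normD _ _)); rewrite !normrM normrN.
rewrite (ger0_norm (ltW (e_gt0 x))) mulrCA lerD//.
  by rewrite ler_piMr ?sin_max// mulr_ge0// ltW.
by rewrite ler_wpM2l// ler_piMr ?cos_max// ltW.
Qed.

(** The fundamental theorem of calculus on growing symmetric intervals; the boundary values of
    [phi u] are dominated by e, which is O(1/n) at the endpoints. *)
Let Rint_dphi u : \int[leb]_x dphi u x = 0.
Proof.
pose f_ (n : nat) (x : R) := dphi u x * \1_(`[- n.+1%:R, n.+1%:R]%classic) x.
have cv : \int[leb]_x f_ n x @[n --> \oo] --> \int[leb]_x dphi u x.
  apply: (@Rint_dominated _ (measurableTypeR R) R leb _ _ (fun x : R => `|dphi u x|)).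
  - by move=> n; apply: measurable_funM; [exact: rint_measurable (idphi u)|].
  - exact: rint_measurable (idphi u).
  - move=> x; apply: cvg_near_cst.
    near=> n; rewrite /f_ indicE mem_set ?mulr1//= in_itv /= -ler_norml.
    apply: (@le_trans _ _ n%:R); last by rewrite ler_nat.
    by near: n; exact: nbhs_infty_ger.
  - exact/rint_norm.
  - move=> n x; rewrite /f_ normrM ler_piMr// indicE.
    by case: (_ \in _); rewrite ?normr1 ?normr0.
have E n : \int[leb]_x f_ n x = phi u n.+1%:R - phi u (- n.+1%:R).
  have n0 : - n.+1%:R < n.+1%:R :> R by rewrite gtrN.
  have cphi : continuous (phi u).
    move=> x; apply/differentiable_continuous/derivable1_diffP.
    by case: (dphiE u x).
  have := @continuous_FTC2 R (dphi u) (phi u) _ _ n0.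
  move=> /(_ (continuous_subspaceT (cdphi (u := u)))) h.
  rewrite /Rintegral -[RHS]/(fine (_%:E - _%:E)%E) -h.
  - congr fine; rewrite [RHS]integral_mkcond; apply: eq_integral => x _.
    by rewrite /f_ patchE indicE; case: ifP; rewrite ?mulr1 ?mulr0.
  - split.
    + by move=> x _; case: (dphiE u x).
    + exact/cvg_at_right_filter/cphi.
    + exact/cvg_at_left_filter/cphi.
  - move=> x _; rewrite derive1E; by case: (dphiE u x).
have cv0 : \int[leb]_x f_ n x @[n --> \oo] --> (0 : R).
  apply/norm_cvg0P; apply: (@squeeze_cvgr _ _ _ _ (fun=> 0) (fun n => 4 * harmonic n)).
  - near=> n; rewrite normr_ge0 /= E.
    have ephi y : `|phi u y| <= e y.
      by rewrite normrM (ger0_norm (ltW (e_gt0 y))) ler_piMr ?sin_max// ltW.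
    apply: (le_trans (ler_normB _ _)).
    have h y : e y <= 2 / (1 + y ^+ 2).
      rewrite /e expRN -[leRHS]invrK lef_pV2 ?posrE ?expR_gt0//; last first.
        by rewrite invr_gt0 divr_gt0// ltr_wpDr// sqr_ge0.
      rewrite invf_div; apply: le_trans (expR_ge1Dx _).
      by have := sqr_ge0 y; lra.
    have h' y : y = n.+1%:R \/ y = - n.+1%:R -> `|phi u y| <= 2 * harmonic n.
      move=> hy; apply: (le_trans (ephi y)); apply: (le_trans (h y)).
      rewrite ler_wpM2l// lef_pV2 ?posrE//; last by rewrite ltr_wpDr// sqr_ge0.
      have -> : y ^+ 2 = n.+1%:R ^+ 2 by case: hy => ->; rewrite ?sqrrN.
      by have := sqr_ge0 (n.+1%:R - 1 : R); have : 0 <= n.+1%:R :> R by []; nra.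
    apply: (le_trans (lerD (h' _ (or_introl erefl)) (h' _ (or_intror erefl)))).
    by rewrite /harmonic /= (_ : 4 = 2 + 2 :> R) ?mulrDl//; ring.
  - exact: cvg_cst.
  - by rewrite -[X in _ --> X](mulr0 4); apply: cvgM; [exact: cvg_cst|exact: cvg_harmonic].
exact: (cvg_unique _ cv cv0).
Unshelve. all: end_near. Qed.

Let dC (u : R) : is_derive u 1 C (- u * C u).
Proof.
pose f (v x : R) := e x * cos (v * x + c).
have df (v x : R) : is_derive v 1 (f ^~ x) (e x * (x * - sin (v * x + c))).
  apply: (is_derive_funZ _ _); apply: (is_derive_comp (is_derive_cos _)).
  by apply: is_derive_eq; rewrite /GRing.scale /= !mulr0 mulr1 add0r addr0.
have p1 v x : partial1of2 f v x = e x * (x * - sin (v * x + c)).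
  by rewrite /partial1of2 derive1E; case: (df v x).
have Iu : (`]u - 1, u + 1[%classic : set R) u by rewrite /= in_itv /= ltrBlDr ltrDl !ltr01.
have inf v : (`]u - 1, u + 1[%classic : set R) v ->
   leb.-integrable setT (EFin \o f v) by move=> _; exact: iC.
have derf v x : (`]u - 1, u + 1[%classic : set R) v -> (setT : set R) x ->
   derivable (f ^~ x) v 1 by move=> _ _; case: (df v x).
have ub v x : (`]u - 1, u + 1[%classic : set R) v -> (setT : set R) x ->
   `|partial1of2 f v x| <= `|x| * e x.
  move=> _ _; rewrite p1 !normrM normrN (ger0_norm (ltW (e_gt0 x))) mulrC -mulrA.
  by rewrite ler_wpM2l// ler_piMl ?sin_max// ltW.
have G0 x : 0 <= `|x| * e x by rewrite mulr_ge0// ltW.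
have h := @cvg_differentiation_under_integral R _ _ leb f setT measurableT u (u - 1) (u + 1)
  Iu inf derf (fun x => `|x| * e x) G0 rint_gauss_line_moment ub.
have E : \int[leb]_x partial1of2 f u x = - u * C u.
  have -> : \int[leb]_x partial1of2 f u x =
      \int[leb]_x (dphi u x - u * (e x * cos (u * x + c))).
    by apply: eq_Rint => x; rewrite p1 /dphi; ring.
  by rewrite RintB ?Rint_dphi ?RintZ ?sub0r ?mulNr//; exact: rintZ.
rewrite E in h.
apply: DeriveDef.
  apply/cvg_ex; exists (- u * C u).
  by under eq_fun do rewrite scaler1.
rewrite /derive; apply/cvg_lim => //.
by under eq_fun do rewrite scaler1.
Qed.

Lemma Rint_gauss_line_cos u :
  \int[leb]_x (expR (- (x ^+ 2 / 2)) * cos (u * x + c)) =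
  Num.sqrt (2 * pi) * cos c * expR (- (u ^+ 2 / 2)).
Proof.
(* The exponential is the integrating factor of C' = -v C, so this product is constant. *)
pose f (v : R) := C v * expR (v ^+ 2 / 2).
have df (v : R) : is_derive v 1 f 0.
  have h := is_derive_Xfact 1 v.
  have h' := is_derive_funM (dC v) (is_derive_comp (is_derive_expR _) h).
  by apply: (is_derive_eq h'); rewrite expr1 /= divr1; ring.
have fE : f u = f 0 by apply: is_derive_0_is_cst.
have f0 : f 0 = Num.sqrt (2 * pi) * cos c.
  rewrite /f expr0n /= mul0r expR0 mulr1 /C -(proj2 rint_gauss_line) -RintZr//.
  by apply: eq_Rint => x; rewrite mul0r add0r.
rewrite -f0 -fE /f -mulrA -expRD subrr expR0 mulr1.
by apply: eq_Rint.
Qed.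

End rotating.

Lemma osc_gauss_line u :
  osc leb (fun x : R => expR (- (x ^+ 2 / 2))) (fun x => u * x) =
  (Num.sqrt (2 * pi) * expR (- (u ^+ 2 / 2)))%:C.
Proof.
rewrite /osc; congr (_ +i* _).
  have := Rint_gauss_line_cos 0 u; rewrite cos0 mulr1 => <-.
  by apply: eq_Rint => x; rewrite addr0.
(* The sine is a cosine with phase -pi/2, and the factor cos(-pi/2) = 0 kills the imaginary part. *)
transitivity (\int[leb]_x (expR (- (x ^+ 2 / 2)) * cos (u * x + - (pi / 2)))).
  by apply: eq_Rint => x; rewrite cosD cosN sinN cos_pihalf sin_pihalf; ring.
by rewrite Rint_gauss_line_cos cosN cos_pihalf mulr0 mul0r.
Qed.

End lebesgue_line.

(** * Gaussian integrals on row vectors *)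

(** The uniform bound on the integrals gives integrability of the limit as well as the bound; in
    this form Fatou's lemma removes Gaussian dampings and truncations. *)
Lemma Rint_fatou d (T : measurableType d) (R : realType)
    (m : {measure set T -> \bar R}) (f_ : nat -> T -> R) (f : T -> R) (C : R) :
  (forall n x, 0 <= f_ n x) -> measurable_fun setT f ->
  (forall x, f_ n x @[n --> \oo] --> f x) -> (forall n, rint m (f_ n)) ->
  (forall n, \int[m]_x f_ n x <= C) -> rint m f /\ \int[m]_x f x <= C.
Proof.
move=> f0 mf cf fi fC.
have f0' x : 0 <= f x.
  rewrite -(cvg_lim _ (cf x))//; apply: limr_ge; first exact: cvgP (cf x).
  exact: nearW.
have le : (\int[m]_x (f x)%:E <= C%:E)%E.
  pose g n x := (f_ n x)%:E.
  have mg n : measurable_fun setT (g n).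
    by apply/measurable_EFinP; exact: rint_measurable (fi n).
  have := @fatou _ T R m setT measurableT g mg (fun n x _ => f0 n x).
  rewrite (_ : integral _ _ _ = \int[m]_x (f x)%:E)%E.
    move=> /le_trans; apply; rewrite limn_einf_lim; apply: lime_le.
      exact: is_cvg_einfs.
    apply: nearW => n; apply: (@le_trans _ _ (\int[m]_x g n x)%E).
      by apply: ereal_inf_lbound; exists n => /=.
    by rewrite -(Rint_EFin (fi n)) lee_fin.
  apply: eq_integral => x _.
  have cv : (f_ n x)%:E @[n --> \oo] --> (f x)%:E.
    by apply: cvg_EFin; [exact: nearW|exact: cf].
  rewrite is_cvg_limn_einfE; first exact/cvg_lim.
  by apply/cvg_ex; exists (f x)%:E.
have fi' : rint m f by apply: rint_of_finite => //; exact: le_lt_trans le (ltry _).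
by split=> //; rewrite -lee_fin Rint_EFin.
Qed.

Section lebesgue_row_integrals.
Context {R : realType}.
Notation lebr n := (@lebesgue_row R n).

Lemma lebesgue_row_affine n (a : R) (b : 'rV[R]_n) (a0 : 0 <= a ^+ n) A :
  0 < a -> measurable A ->
  lebr n A = mscale (NngNum a0) (lebr n) ((fun x => a *: x + b) @^-1` A).
Proof.
move=> a_gt0; elim: n b a0 A => [|n IH] b a0 A mA.
  rewrite /mscale /= expr0 mul1e (_ : _ @^-1` A = A)//.
  by apply/seteqP; split=> x /=; rewrite [_ + _](_ : _ = x)//; apply/rowP => -[].
have an0 : 0 <= a ^+ n by rewrite exprn_ge0// ltW.
pose b' : 'rV[R]_n := \row_j b 0 (lift ord0 j).
pose aff (z : measurableTypeR R * 'rV[R]_n) : measurableTypeR R * 'rV[R]_n :=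
  (a * z.1 + b 0 ord0, a *: z.2 + b').
have maff : measurable_fun setT aff.
  apply: measurable_pair; first by mfun.
  by mfun.
pose m' := pushm (mscale (NngNum a0) (lebesgue_measure \x lebr n)%E) maff.
have mA' : measurable (@consrow R n @^-1` A).
  by rewrite -[X in measurable X]setTI; exact: measurable_consrow.
have h := @product_measure_unique _ _ _ _ R lebesgue_measure (lebr n) m' _ _ mA'.
rewrite -[LHS]/((lebesgue_measure \x lebr n)%E (@consrow R n @^-1` A)) h.
  rewrite /m' pushmE -[RHS]/((a ^+ n.+1)%:E *
    (lebesgue_measure \x lebr n)%E (@consrow R n @^-1` ((fun x => a *: x + b)%R @^-1` A)))%E.
  congr (_ * (product_measure1 _ _ _))%E.
  suff E z : consrow (aff z) = a *: consrow z + b.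
    by apply/seteqP; split=> z /=; rewrite E.
  apply/rowP => j; rewrite !mxE; case: (unliftP ord0 j) => [k ->|->] /=.
    by rewrite !mxE.
  by [].
move=> B C mB mC; rewrite /m' pushmE.
have -> : aff @^-1` (B `*` C) = ((fun x => a * x + b 0 ord0) @^-1` B) `*`
   ((fun x => a *: x + b') @^-1` C) by [].
set B' := _ @^-1` B; set C' := _ @^-1` C.
transitivity ((a ^+ n.+1)%:E * (lebesgue_measure \x lebr n) (B' `*` C'))%E => //.
have mphi1 : measurable_fun (setT : set (measurableTypeR R))
    (fun x : measurableTypeR R => a * x + b 0 ord0 : measurableTypeR R) by mfun.
have mphi2 : measurable_fun setT (fun x : 'rV[R]_n => a *: x + b') by mfun.
have mB' : measurable B' by rewrite -[X in measurable X]setTI; exact: mphi1.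
have mC' : measurable C' by rewrite -[X in measurable X]setTI; exact: mphi2.
rewrite product_measure1E// /B' /C'.
have E1 := lebesgue_affine (b 0 ord0) a_gt0 mB.
have E2 := IH b' an0 C mC.
apply: etrans _ (esym (congr2 (fun x y => x * y)%E E1 E2)).
by rewrite /mscale /= muleACA -EFinM exprS.
Qed.

Lemma measurable_row_affine n (a : R) (b : 'rV[R]_n) :
  measurable_fun setT (fun x : 'rV[R]_n => a *: x + b).
Proof. by mfun. Qed.

Lemma rint_row_affine n (a : R) (b : 'rV[R]_n) (f : 'rV[R]_n -> R) :
  0 < a -> measurable_fun setT f ->
  rint (lebr n) (fun x => f (a *: x + b)) <-> rint (lebr n) f.
Proof.
move=> a0 mf; have an : 0 <= a ^+ n by rewrite exprn_ge0// ltW.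
have h := rint_image (measurable_row_affine a b)
  (fun A => lebesgue_row_affine b an a0 (A := A)) mf.
split=> [fi|/h]; first by apply/h; exact: rint_mscale.
by apply: rint_mscale_inv => /=; rewrite exprn_gt0.
Qed.

Lemma Rint_row_affine n (a : R) (b : 'rV[R]_n) (f : 'rV[R]_n -> R) :
  0 < a -> rint (lebr n) f ->
  \int[lebr n]_x f x = a ^+ n * \int[lebr n]_x f (a *: x + b).
Proof.
move=> a0 fi; have mf : measurable_fun setT f by exact: rint_measurable fi.
have an : 0 <= a ^+ n by rewrite exprn_ge0// ltW.
rewrite (Rint_image (measurable_row_affine a b)
  (fun A => lebesgue_row_affine b an a0 (A := A)) mf) Rint_mscale//.
exact/(rint_row_affine b a0 mf).
Qed.

Lemma rint_row_shift n (b : 'rV[R]_n) (f : 'rV[R]_n -> R) :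
  rint (lebr n) f -> rint (lebr n) (fun x => f (x + b)).
Proof.
move=> fi; apply: (@eq_rint _ _ _ _ (fun x : 'rV[R]_n => f (1 *: x + b))).
  by move=> x; rewrite scale1r.
by apply/rint_row_affine => //; exact: rint_measurable fi.
Qed.

Lemma Rint_row_shift n (b : 'rV[R]_n) (f : 'rV[R]_n -> R) : rint (lebr n) f ->
  \int[lebr n]_x f (x + b) = \int[lebr n]_x f x.
Proof.
move=> fi; rewrite (Rint_row_affine b ltr01 fi) expr1n mul1r.
by apply: eq_Rint => x; rewrite scale1r.
Qed.

(** Unnormalized, with s the reciprocal of the standard deviation: the Fourier transform then
    exchanges s and its inverse, and scaling the argument multiplies s. *)
Definition gau n (s : R) (x : 'rV[R]_n) : R := expR (- (s ^+ 2 * dotp x x / 2)).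

Lemma gau_gt0 n s (x : 'rV[R]_n) : 0 < gau s x.
Proof. exact: expR_gt0. Qed.

Lemma gau_le1 n s (x : 'rV[R]_n) : gau s x <= 1.
Proof.
rewrite -expR0 ler_expR oppr_le0 mulr_ge0// mulr_ge0 ?sqr_ge0//.
exact: dotp_ge0.
Qed.

Lemma gauZ n s c (x : 'rV[R]_n) : gau s (c *: x) = gau (s * c) x.
Proof. by rewrite /gau dotpZl dotpZr; congr (expR (- _)); ring. Qed.

Lemma gau0 n s : gau s (0 : 'rV[R]_n) = 1.
Proof. by rewrite /gau dotp0r mulr0 mul0r oppr0 expR0. Qed.

Lemma gauN n s (x : 'rV[R]_n) : gau s (- x) = gau s x.
Proof. by rewrite /gau dotpNl dotpNr opprK. Qed.

Lemma measurable_gau n s : measurable_fun setT (@gau n s).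
Proof. by rewrite /gau; mfun. Qed.

Lemma dotp_consrow n (xi : 'rV[R]_n.+1) z :
  dotp xi (consrow z) = xi 0 ord0 * z.1 + dotp (\row_j xi 0 (lift ord0 j)) z.2.
Proof.
rewrite /dotp big_ord_recl mxE unlift_none /=; congr (_ + _).
by apply: eq_bigr => i _; rewrite !mxE liftK.
Qed.

Lemma dotp_consrow2 n (z : measurableTypeR R * 'rV[R]_n) :
  dotp (consrow z) (consrow z) = z.1 ^+ 2 + dotp z.2 z.2.
Proof.
rewrite dotp_consrow mxE unlift_none /= expr2; congr (_ + dotp _ _).
by apply/rowP => j; rewrite !mxE liftK.
Qed.

(** The Gaussian factors over the first coordinate and the rest, and so does its transform. In
    dimension 0 the measure is the unit mass at the only vector. *)
Lemma osc_gau1 n (xi : 'rV[R]_n) : rint (lebr n) (@gau n 1) /\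
  osc (lebr n) (@gau n 1) (dotp xi) = (Num.sqrt (2 * pi) ^+ n * gau 1 xi)%:C.
Proof.
elim: n xi => [|n IH] xi.
  have Ee (f : 'rV[R]_0 -> \bar R) : (\int[lebr 0]_x f x = f 0%R)%E.
    rewrite (_ : f = cst (f 0)); last first.
      by apply/funext => x /=; congr f; apply/rowP => -[].
    by rewrite integral_cst//= diracT mule1.
  have E (f : 'rV[R]_0 -> R) : \int[lebr 0]_x f x = f 0 by rewrite /Rintegral Ee.
  split.
    apply/integrableP; split; first by apply/measurable_EFinP; exact: measurable_gau.
    by rewrite Ee ltry.
  rewrite /osc !E gau0 dotp0r cos0 sin0 mulr1 mulr0 expr0 mul1r.
  by rewrite /gau /dotp big_ord0 mulr0 mul0r oppr0 expR0.
have [gi IHo] := IH (\row_j xi 0 (lift ord0 j)).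
have [g1 _] := @rint_gauss_line R.
have gE z : gau 1 (@consrow R n z) = expR (- (z.1 ^+ 2 / 2)) * gau 1 z.2.
  rewrite /gau dotp_consrow2 -expRD expr1n !mul1r mulrDl opprD//.
have mE : forall A, measurable A -> lebr n.+1 A =
  (lebesgue_measure \x lebr n)%E (@consrow R n @^-1` A) by [].
have gp := rint_prod g1 gi.
split.
  apply/(rint_image (@measurable_consrow R n) mE); first exact: measurable_gau.
  by apply: eq_rint gp => z; rewrite gE.
rewrite (osc_image (@measurable_consrow R n) mE); last 2 first.
- exact: measurable_gau.
- exact: measurable_dotpr.
have -> : (fun x => gau 1 (@consrow R n x)) =
    (fun z => expR (- (z.1 ^+ 2 / 2)) * gau 1 z.2) by apply/funext => z; rewrite gE.
rewrite (_ : (fun x => dotp xi (consrow x)) = (fun z =>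
   (fun x => xi 0 ord0 * x) z.1 + dotp (\row_j xi 0 (lift ord0 j)) z.2)); last first.
  by apply/funext => z; rewrite dotp_consrow.
have m1 : measurable_fun (setT : set (measurableTypeR R))
  (fun x : measurableTypeR R => xi 0 ord0 * x) by mfun.
apply: etrans (osc_prod g1 gi m1 (measurable_dotpr _)) _.
rewrite osc_gauss_line IHo -rmorphM; congr (_%:C).
have -> : gau 1 xi = expR (- (xi 0 ord0 ^+ 2 / 2)) * gau 1 (\row_j xi 0 (lift ord0 j)).
  rewrite -[in LHS](_ : consrow (xi 0 ord0, \row_j xi 0 (lift ord0 j)) = xi) ?gE//.
  apply/rowP => j; rewrite mxE; case: (unliftP ord0 j) => [k ->|->] /=.
    by rewrite mxE.
  by [].
by rewrite [_ ^+ n.+1]exprS mulrACA.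
Qed.

Lemma rint_gau n s : 0 < s -> rint (lebr n) (@gau n s).
Proof.
move=> s0; have s' : 0 < s^-1 by rewrite invr_gt0.
apply/(rint_row_affine 0 s' (@measurable_gau n s)).
apply: eq_rint (proj1 (@osc_gau1 n 0)) => x.
by rewrite addr0 gauZ mulfV// gt_eqF.
Qed.

Lemma osc_gau n s (xi : 'rV[R]_n) : 0 < s ->
  osc (lebr n) (@gau n s) (dotp xi) = ((Num.sqrt (2 * pi) / s) ^+ n * gau s^-1 xi)%:C.
Proof.
move=> s0; have s' : 0 < s^-1 by rewrite invr_gt0.
have gi := @rint_gau n s s0; have md := measurable_dotpr xi.
have E (x : 'rV[R]_n) : gau s (s^-1 *: x + 0) = gau 1 x.
  by rewrite addr0 gauZ mulfV// gt_eqF.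
have [_] := osc_gau1 (s^-1 *: xi); rewrite /osc => -[E1 E2].
rewrite (Rint_row_affine 0 s' (rint_cos gi md)) (Rint_row_affine 0 s' (rint_sin gi md)).
have dE x : dotp xi (s^-1 *: x + 0) = dotp (s^-1 *: xi) x.
  by rewrite addr0 dotpZr dotpZl.
have EA : \int[lebr n]_x (gau s (s^-1 *: x + 0) * cos (dotp xi (s^-1 *: x + 0))) =
    Num.sqrt (2 * pi) ^+ n * gau 1 (s^-1 *: xi).
  by rewrite -E1; apply: eq_Rint => x; rewrite E dE.
have EB : \int[lebr n]_x (gau s (s^-1 *: x + 0) * sin (dotp xi (s^-1 *: x + 0))) = 0.
  by rewrite -E2; apply: eq_Rint => x; rewrite E dE.
rewrite EA EB mulr0 gauZ mul1r; congr (_ +i* _).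
by rewrite exprMn; ring.
Qed.

Lemma Rint_gau n s : 0 < s ->
  \int[lebr n]_x gau s x = (Num.sqrt (2 * pi) / s) ^+ n.
Proof.
move=> s0; have := osc_gau (0 : 'rV[R]_n) s0; rewrite gau0 mulr1 /osc => -[<- _].
by apply: eq_Rint => x; rewrite dotp0l cos0 mulr1.
Qed.

Lemma cvg_gau_small n (x : 'rV[R]_n) : gau (harmonic k) x @[k --> \oo] --> (1 : R).
Proof.
rewrite -(gau0 n 1) /gau dotp0r mulr0 mul0r.
have h : - (harmonic k ^+ 2 * dotp x x / 2) @[k --> \oo] --> (- 0 : R).
  apply: cvgN; rewrite -[X in _ --> X](mul0r (2^-1)).
  apply: cvgM; last exact: cvg_cst.
  rewrite -[X in _ --> X](mul0r (dotp x x)).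
  apply: cvgM; last exact: cvg_cst.
  rewrite -[X in _ --> X](mulr0 0).
  by apply: (@cvgM _ _ _ _ harmonic harmonic); exact: cvg_harmonic.
by apply: (continuous_cvg _ _ h); exact: continuous_expR.
Qed.

End lebesgue_row_integrals.
Notation lebr n := (lebesgue_row n).

(** * Fourier transforms of densities *)

Section product_sigma_finite.
Context d1 d2 (T1 : measurableType d1) (T2 : measurableType d2) (R : realType).
Variables (m1 : {sigma_finite_measure set T1 -> \bar R})
  (m2 : {sigma_finite_measure set T2 -> \bar R}).

Let product_sigma_finite : sigma_finite setT (m1 \x m2)%E.
Proof.
have /sigma_finiteP[F [TF ndF Foo]] := sigma_finiteT m1.
have /sigma_finiteP[G [TG ndG Goo]] := sigma_finiteT m2.
exists (fun k => F k `*` G k).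
  apply/seteqP; split=> // -[x y] _.
  have [i _ Fx] : (\bigcup_i F i) x by rewrite -TF.
  have [j _ Gy] : (\bigcup_i G i) y by rewrite -TG.
  exists (maxn i j) => //; split; [move: x Fx|move: y Gy].
    exact/subsetPset/ndF/leq_maxl.
  exact/subsetPset/ndG/leq_maxr.
move=> k; have [mF Fk] := Foo k; have [mG Gk] := Goo k; split.
  exact: measurableX.
by rewrite product_measure1E// lte_mul_pinfty// ge0_fin_numE.
Qed.

(** The product bundled with its sigma-finiteness, so that it can itself be a factor in Fubini's
    theorem, as needed for integrals over three variables. *)
Definition product_sf : {sigma_finite_measure set (T1 * T2)%type -> \bar R} :=
  HB.pack (m1 \x m2)%E
    (@Measure_isSigmaFinite.Build _ _ _ (m1 \x m2)%E product_sigma_finite).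
End product_sigma_finite.

(** Adding 1 to the cosine makes the integrand nonnegative, where Tonelli gives measurability of the
    partial integral; the integral of w is then subtracted. *)
Lemma measurable_osc_cos d1 d2 (T1 : measurableType d1) (T2 : measurableType d2)
    (R : realType) (m : {sigma_finite_measure set T2 -> \bar R}) (w : T2 -> R)
    (th : T1 * T2 -> R) :
  rint m w -> (forall x, 0 <= w x) -> measurable_fun setT th ->
  measurable_fun setT (fun y => \int[m]_x (w x * cos (th (y, x)))).
Proof.
move=> wi w0 mth; pose F (z : T1 * T2) := w z.2 * (1 + cos (th z)).
have mF : measurable_fun setT F by rewrite /F; mfun.
have F0 z : 0 <= F z.
  by rewrite mulr_ge0// addrC -lerBlDr sub0r cos_geN1.
rewrite (_ : (fun _ => _) = fun y => \int[m]_x F (y, x) - \int[m]_x w x).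
  by apply: measurable_funB => //; exact: measurable_Rint2.
apply/funext => y; rewrite /F /=.
have mc : measurable_fun setT (fun x => th (y, x)).
  by apply: measurable_compT => //; exact: measurable_pair.
have ci := rint_cos wi mc.
under [X in _ = X - _]eq_Rint => x do rewrite mulrDr mulr1.
by rewrite RintD// addrAC subrr add0r.
Qed.

Lemma measurable_normc_osc d1 d2 (T1 : measurableType d1) (T2 : measurableType d2)
    (R : realType) (m : {sigma_finite_measure set T2 -> \bar R}) (w : T2 -> R)
    (th : T1 * T2 -> R) :
  rint m w -> (forall x, 0 <= w x) -> measurable_fun setT th ->
  measurable_fun setT (fun y => normc (osc m w (fun x => th (y, x)))).
Proof.
move=> wi w0 mth; rewrite /osc /=.
have ms : measurable_fun setT (fun y => \int[m]_x (w x * sin (th (y, x)))).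
  have h := @measurable_osc_cos _ _ T1 T2 R m w (fun z => th z - pi / 2) wi w0.
  rewrite (_ : (fun _ => _) = (fun y => \int[m]_x (w x * cos (th (y, x) - pi / 2)))).
    by apply: h; mfun.
  apply/funext => y; apply: eq_Rint => x.
  by rewrite cosB cos_pihalf sin_pihalf mulr0 add0r mulr1.
have mc := @measurable_osc_cos _ _ T1 T2 R m w th wi w0 mth.
apply: measurable_comp_sqrt; apply: measurable_funD.
  by apply: (measurable_funX (f := fun y => \int[m]_x (w x * cos (th (y, x))))).
by apply: (measurable_funX (f := fun y => \int[m]_x (w x * sin (th (y, x))))).
Qed.

Section fourier_transform.
Context {R : realType} {n : nat}.
Notation leb := (@lebesgue_row R n).
Implicit Types (f h : 'rV[R]_n -> R) (xi : 'rV[R]_n).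

Definition ft f xi : R[i] := osc leb f (dotp xi).

Lemma measurable_dotp2 :
  measurable_fun setT (fun z : 'rV[R]_n * 'rV[R]_n => dotp z.1 z.2).
Proof. by mfun. Qed.

Lemma measurable_normc_ft f : rint leb f -> (forall x, 0 <= f x) ->
  measurable_fun setT (fun xi => normc (ft f xi)).
Proof. by move=> fi f0; exact: (measurable_normc_osc fi f0 measurable_dotp2). Qed.

Lemma normc_ft_sqr f xi : rint leb f -> normc (ft f xi) ^+ 2 =
  \int[(leb \x leb)%E]_z (f z.1 * f z.2 * cos (dotp xi (z.1 - z.2))).
Proof.
move=> fi; rewrite normc_sqr /ft /osc /= !expr2.
have mt := measurable_dotpr xi.
have ci := rint_cos fi mt; have si := rint_sin fi mt.
rewrite -(Rint_prod ci ci) -(Rint_prod si si) -RintD.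
- by apply: eq_Rint => z; rewrite dotpBr cosB; ring.
- exact: (rint_prod ci ci).
- exact: (rint_prod si si).
Qed.

Lemma Rint_gau_cos s (y : 'rV[R]_n) : 0 < s ->
  \int[leb]_x (gau s x * cos (dotp x y)) =
  (Num.sqrt (2 * pi) / s) ^+ n * gau s^-1 y.
Proof.
move=> s0; have := osc_gau y s0; rewrite /osc => -[<- _].
by apply: eq_Rint => x; rewrite dotpC.
Qed.

Lemma sqrt2pi_gt0 : 0 < Num.sqrt (2 * pi) :> R.
Proof. by rewrite sqrtr_gt0 mulr_gt0// pi_gt0. Qed.

(** Expanding the square and integrating in xi first leaves f(x) f(y) against a Gaussian kernel in x
    - y of total mass (2 pi)^n. Bounding one factor by M and integrating the kernel gives a bound
    free of s, so that the damping can be removed. *)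
Lemma plancherel_gau_le f M s : 0 < s -> (forall x, 0 <= f x <= M) ->
  rint leb f ->
  rint leb (fun xi => normc (ft f xi) ^+ 2 * gau s xi) /\
  \int[leb]_xi (normc (ft f xi) ^+ 2 * gau s xi) <=
    (2 * pi) ^+ n * (M * \int[leb]_x f x).
Proof.
move=> s0 fM fi; have f0 x : 0 <= f x by have /andP[] := fM x.
have s'0 : 0 < s^-1 by rewrite invr_gt0.
have gi := @rint_gau R n s s0; have gi' := @rint_gau R n _ s'0.
pose F xi (z : 'rV[R]_n * 'rV[R]_n) :=
  gau s xi * (f z.1 * f z.2) * cos (dotp xi (z.1 - z.2)).
have ffi := rint_prod fi fi.
pose m2 := product_sf leb leb.
have ffi2 : rint m2 (fun z => f z.1 * f z.2) := ffi.
have Fi : rint (leb \x m2)%E (fun z => F z.1 z.2).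
  apply: (rintM_bounded (c := 1)); first exact: (rint_prod gi ffi2).
    by mfun.
  by move=> z; exact: cos_max.
have E1 xi : normc (ft f xi) ^+ 2 * gau s xi = \int[(leb \x leb)%E]_z F xi z.
  rewrite normc_ft_sqr// mulrC -RintZ; first by apply: eq_Rint => z; rewrite /F mulrA.
  apply: (rintM_bounded (c := 1)) => //; first by mfun.
  by move=> z; exact: cos_max.
set c := (Num.sqrt (2 * pi) / s) ^+ n.
have c0 : 0 <= c by rewrite exprn_ge0// divr_ge0 ?ltW// sqrt2pi_gt0.
have E2 z : \int[leb]_xi F xi z = c * (f z.1 * f z.2 * gau s^-1 (z.1 - z.2)).
  rewrite mulrCA -Rint_gau_cos// -RintZ.
    by apply: eq_Rint => x; rewrite /F; ring.
  apply: rint_cos => //.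
  rewrite (_ : (fun _ => _) = (fun x : 'rV[R]_n => dotp x (z.1 - z.2)))//; mfun.
have i1 : rint leb (fun xi => normc (ft f xi) ^+ 2 * gau s xi).
  apply: (rint_le (fun xi => (\int[leb]_x `|f x|) ^+ 2 * gau s xi)).
  - apply: measurable_funM; last exact: measurable_gau.
    by apply: (measurable_funX (f := fun xi => normc (ft f xi))); exact: measurable_normc_ft.
  - exact: rintZ.
  move=> xi; rewrite ger0_norm ?mulr_ge0 ?exprn_ge0 ?normc_ge0 ?(ltW (gau_gt0 s xi))//.
  rewrite ler_wpM2r ?(ltW (gau_gt0 s xi))// ler_pXn2r ?nnegrE ?normc_ge0 ?Rint_ge0//.
  exact: normc_osc_le fi (measurable_dotpr xi).
split=> //.
have -> : \int[leb]_xi (normc (ft f xi) ^+ 2 * gau s xi) =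
    \int[(leb \x leb)%E]_z (c * (f z.1 * f z.2 * gau s^-1 (z.1 - z.2))).
  rewrite (eq_Rint _ E1); apply: etrans (Rint_fubini Fi) _.
  by apply: eq_Rint => z; exact: E2.
have i2 : rint (leb \x leb)%E (fun z => f z.1 * f z.2 * gau s^-1 (z.1 - z.2)).
  apply: (rintM_bounded (c := 1)) => //.
    by have mg := @measurable_gau R n s^-1; mfun.
  by move=> z; rewrite ger0_norm ?gau_le1// ltW// gau_gt0.
rewrite RintZ// (Rint_fubini1 i2) /=.
have shift x : rint leb (fun y => gau s^-1 (x - y)) /\
    \int[leb]_y gau s^-1 (x - y) = (Num.sqrt (2 * pi) * s) ^+ n.
  have E y : gau s^-1 (x - y) = gau s^-1 (y + - x) by rewrite -gauN opprB.
  split; first by apply: eq_rint (rint_row_shift (- x) gi') => y; rewrite E.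
  by rewrite (eq_Rint _ E) (Rint_row_shift (- x) gi') Rint_gau// invrK.
have i3 x : rint leb (fun y => f x * f y * gau s^-1 (x - y)).
  apply: (rint_le (fun y : 'rV[R]_n => f x * M * gau s^-1 (x - y))).
  - by have mg := @measurable_gau R n s^-1; mfun.
  - exact/rintZ/(proj1 (shift x)).
  move=> y; rewrite ger0_norm ?mulr_ge0 ?(ltW (gau_gt0 _ _))//.
  by rewrite ler_wpM2r ?(ltW (gau_gt0 _ _))// ler_wpM2l//; have /andP[] := fM y.
have le x : \int[leb]_y (f x * f y * gau s^-1 (x - y)) <=
    f x * (M * (Num.sqrt (2 * pi) * s) ^+ n).
  rewrite mulrA -(proj2 (shift x)) -RintZ; last exact: (proj1 (shift x)).
  apply: le_Rint => //; first exact/rintZ/(proj1 (shift x)).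
  move=> y; rewrite ler_wpM2r ?(ltW (gau_gt0 _ _))// ler_wpM2l//.
  by have /andP[] := fM y.
have mI : measurable_fun setT
    (fun x => \int[leb]_y (f x * f y * gau s^-1 (x - y))).
  apply: (@measurable_Rint2 _ _ _ _ R leb
    (fun z : 'rV[R]_n * 'rV[R]_n => f z.1 * f z.2 * gau s^-1 (z.1 - z.2))).
    by have mg := @measurable_gau R n s^-1; mfun.
  by move=> z; rewrite !mulr_ge0 ?(ltW (gau_gt0 _ _)).
apply: (@le_trans _ _ (c * \int[leb]_x (f x * (M * (Num.sqrt (2 * pi) * s) ^+ n)))).
  rewrite ler_wpM2l//; apply: le_Rint => //.
    apply: (rint_le (fun x => (M * (Num.sqrt (2 * pi) * s) ^+ n) * f x)) => //.
      exact: rintZ.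
    move=> x; rewrite ger0_norm; first by rewrite mulrC.
    by apply: Rint_ge0 => y; rewrite !mulr_ge0 ?(ltW (gau_gt0 _ _)).
  by apply: eq_rint (rintZ (M * (Num.sqrt (2 * pi) * s) ^+ n) fi) => x; rewrite mulrC.
rewrite RintZr// [X in _ <= X]mulrC le_eqVlt; apply/orP; left; apply/eqP.
have <- : c * (Num.sqrt (2 * pi) * s) ^+ n = (2 * pi) ^+ n.
  rewrite /c -exprMn; congr (_ ^+ _); rewrite -[2 * pi]sqr_sqrtr ?mulr_ge0 ?pi_ge0//.
  by rewrite sqrtr_sqr ger0_norm ?sqrtr_ge0//; field; rewrite gt_eqF.
by set Y := (_ * s) ^+ n; ring.
Qed.

Lemma harmonic_gt0' k : 0 < harmonic k :> R.
Proof. by rewrite /harmonic /= invr_gt0 ltr0n. Qed.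

Lemma plancherel_le f M : (forall x, 0 <= f x <= M) -> rint leb f ->
  rint leb (fun xi => normc (ft f xi) ^+ 2) /\
  \int[leb]_xi normc (ft f xi) ^+ 2 <= (2 * pi) ^+ n * (M * \int[leb]_x f x).
Proof.
move=> fM fi; have f0 x : 0 <= f x by have /andP[] := fM x.
apply: (Rint_fatou (f_ := fun k xi => normc (ft f xi) ^+ 2 * gau (harmonic k) xi)).
- by move=> k xi; rewrite mulr_ge0 ?exprn_ge0 ?normc_ge0// ltW// gau_gt0.
- by apply: (measurable_funX (f := fun xi => normc (ft f xi))); exact: measurable_normc_ft.
- move=> xi; rewrite -[X in _ --> X]mulr1; apply: cvgM; first exact: cvg_cst.
  exact: cvg_gau_small.
- by move=> k; have [] := plancherel_gau_le (harmonic_gt0' k) fM fi.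
- by move=> k; have [] := plancherel_gau_le (harmonic_gt0' k) fM fi.
Qed.

Section power.
Variables (h : 'rV[R]_n -> R) (alpha A t : R) (p : nat).
Hypotheses (alpha_gt1 : 1 < alpha) (A_gt0 : 0 < A) (t_gt0 : 0 < t).
Hypothesis tE : t `^ (alpha - 1) = 2.
Hypothesis p_ge2 : 2 * t <= 2 ^+ p.
Hypotheses (h0 : forall x, 0 <= h x) (hi : rint leb h).
Hypothesis hA : \int[leb]_x h x <= A.
Hypothesis hai : rint leb (fun x => h x `^ alpha).
Hypothesis haA : \int[leb]_x (h x `^ alpha) <= A.

(** Since t^(alpha-1) = 2, a value h > t^j satisfies h <= h^alpha / 2^j; the part cut off at height
    t^j therefore has integral at most [tau j]. *)
Let a j x := Num.min (h x) (t ^+ j).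
Let tau j := A / 2 ^+ j.

Let mh : measurable_fun setT h. Proof. exact: rint_measurable hi. Qed.

Let tj_gt0 j : 0 < t ^+ j. Proof. exact: exprn_gt0. Qed.

Let a_bound j x : 0 <= a j x <= t ^+ j.
Proof. by rewrite /a le_min h0 ltW//= ge_min lexx orbT. Qed.

Let a_le j x : a j x <= h x.
Proof. by rewrite /a ge_min lexx. Qed.

Let ai j : rint leb (a j).
Proof.
apply: (rint_le h) => //; first exact: measurable_minr.
by move=> x; have /andP[a0 _] := a_bound j x; rewrite ger0_norm ?a_le.
Qed.

Let tail_le j x : h x - a j x <= (h x `^ alpha) / 2 ^+ j.
Proof.
rewrite /a; case: (leP (h x) (t ^+ j)) => hx.
  by rewrite subrr divr_ge0// powR_ge0.
apply: (@le_trans _ _ (h x)); first by rewrite lerBlDr lerDl ltW.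
have hx0 : 0 < h x by exact: lt_trans hx.
have -> : h x `^ alpha = h x * h x `^ (alpha - 1).
  rewrite -[X in X * _]powRr1 ?(ltW hx0)// -powRD; last by rewrite (gt_eqF hx0) implybT.
  by congr (_ `^ _); ring.
rewrite ler_pdivlMr// ler_pM2l// -tE -powR_mulrn ?powR_ge0// -powRrM mulrC powRrM.
rewrite powR_mulrn ?(ltW t_gt0)//.
by apply: ge0_ler_powR; rewrite ?nnegrE ?subr_ge0 ?(ltW alpha_gt1) ?(ltW hx) ?(ltW (tj_gt0 j)) ?(ltW hx0).
Qed.

Let ft_le j xi : normc (ft h xi) <= normc (ft (a j) xi) + tau j.
Proof.
have bi : rint leb (fun x => h x - a j x) by exact: rintB.
have -> : ft h xi = ft (a j) xi + ft (fun x => h x - a j x) xi.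
  rewrite /ft -oscD//; last exact: measurable_dotpr.
  by apply: eq_osc => // x; rewrite addrC subrK.
apply: (le_trans (normcD_le _ _)); rewrite lerD2l.
apply: (le_trans (normc_osc_le bi (measurable_dotpr xi))).
apply: (@le_trans _ _ (\int[leb]_x ((2 ^+ j)^-1 * h x `^ alpha))).
  apply: le_Rint; [exact: rint_norm|exact: rintZ|move=> x].
  by rewrite ger0_norm ?subr_ge0// [leRHS]mulrC.
by rewrite RintZ// /tau mulrC ler_wpM2r// invr_ge0 exprn_ge0.
Qed.

Let ft_leA xi : normc (ft h xi) <= A.
Proof.
apply: (le_trans (normc_osc_le hi (measurable_dotpr xi))); apply: le_trans hA.
by under eq_Rint => x do rewrite ger0_norm//.
Qed.

Let c j := 4 ^+ p.+2 * tau j ^+ p.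

Let tau_gt0 j : 0 < tau j. Proof. by rewrite divr_gt0// exprn_gt0. Qed.

Let S N xi := \sum_(j < N) c j * normc (ft (a j) xi) ^+ 2.

(** The least j with 2 tau_j <= H also gives H <= 4 tau_j, and removing the tail leaves tau_j <= |ft
    a_j|. Of the p+2 factors of H, p are traded for tau_j and two for |ft a_j|, which Plancherel can
    integrate. For j = 0 the upper bound is H <= A. *)
Let power_le xi : 0 < normc (ft h xi) ->
  exists j, normc (ft h xi) ^+ p.+2 <= c j * normc (ft (a j) xi) ^+ 2.
Proof.
move=> H0; set H := normc (ft h xi) in H0 *.
have ex : exists j, 2 * tau j <= H.
  exists (Num.bound (2 * A / H)); rewrite /tau mulrA ler_pdivrMr ?exprn_gt0//.
  rewrite -ler_pdivrMl// [_^-1 * _]mulrC.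
  have h1 : 2 * A / H < (Num.bound (2 * A / H))%:R.
    by apply: archi_boundP; rewrite divr_ge0 ?mulr_ge0// ltW.
  apply: (le_trans (ltW h1)); rewrite -natrX ler_nat ltnW//; exact: ltn_expl.
have [j jP jmin] := ex_minnP ex.
exists j.
have Hle : H <= 4 * tau j.
  case: j jP jmin => [|j] jP jmin.
    by apply: (le_trans (ft_leA xi)); rewrite /tau expr0 divr1 ler_peMl ?ltW// ltr1n.
  have : ~~ (2 * tau j <= H) by apply/negP => /jmin; rewrite ltnn.
  rewrite -ltNge => /ltW/le_trans -> //.
  rewrite /tau exprS; have h2 : (2 : R) ^+ j != 0 by rewrite expf_neq0.
  by rewrite le_eqVlt; apply/orP; left; apply/eqP; field.
have le1 : tau j <= normc (ft (a j) xi).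
  have := ft_le j xi; rewrite -/H; move: jP; lra.
apply: (@le_trans _ _ ((4 * tau j) ^+ p.+2)).
  by rewrite ler_pXn2r ?nnegrE ?(ltW H0)// mulr_ge0// ltW.
rewrite exprMn /c -mulrA ler_wpM2l ?exprn_ge0// -addn2 exprD ler_wpM2l//.
  by rewrite exprn_ge0// ltW.
by rewrite ler_pXn2r ?nnegrE ?normc_ge0// ltW.
Qed.

Let J := 2 * (4 ^+ p.+2 * A ^+ p.+1 * (2 * pi) ^+ n).

(** By Plancherel level j contributes a constant times t^j / 2^(jp), which is at most 2^-j because 2
    t <= 2^p; the factor 2 in [J] is the sum of the geometric series. *)
Let S_le N : rint leb (S N) /\ \int[leb]_xi S N xi <= J.
Proof.
have i1 j : rint leb (fun xi => c j * normc (ft (a j) xi) ^+ 2).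
  by apply: rintZ; have [] := plancherel_le (a_bound j) (ai j).
have P0 : 0 <= 4 ^+ p.+2 * A ^+ p.+1 * (2 * pi) ^+ n.
  apply: mulr_ge0; first by apply: mulr_ge0; apply: exprn_ge0 => //; exact: ltW.
  by rewrite exprn_ge0// mulr_ge0// pi_ge0.
split; first exact: rint_sum.
rewrite /S Rint_sum//.
apply: (@le_trans _ _ (\sum_(j < N) (J / 2) / 2 ^+ j)).
  apply: ler_sum => j _; rewrite RintZ; last by have [] := plancherel_le (a_bound j) (ai j).
  have cj0 : 0 <= c j by rewrite mulr_ge0// exprn_ge0// ltW.
  have [_ le] := plancherel_le (a_bound j) (ai j).
  apply: (le_trans (ler_wpM2l cj0 le)).
  have aA : \int[leb]_x a j x <= A by apply: le_trans hA; exact: le_Rint.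
  apply: (@le_trans _ _ (c j * ((2 * pi) ^+ n * (t ^+ j * A)))).
    by rewrite ler_wpM2l// ler_wpM2l ?exprn_ge0 ?mulr_ge0 ?pi_ge0// ler_wpM2l// ltW.
  rewrite /c /J /tau.
  have -> : 2 * (4 ^+ p.+2 * A ^+ p.+1 * (2 * pi) ^+ n) / 2 / 2 ^+ j =
    (4 ^+ p.+2 * A ^+ p.+1 * (2 * pi) ^+ n) * (2 ^+ j)^-1.
    set Y := 4 ^+ p.+2 * A ^+ p.+1 * (2 * pi) ^+ n; by rewrite [2 * Y]mulrC mulfK.
  have -> : 4 ^+ p.+2 * (A / 2 ^+ j) ^+ p * ((2 * pi) ^+ n * (t ^+ j * A)) =
    (4 ^+ p.+2 * A ^+ p.+1 * (2 * pi) ^+ n) * (t ^+ j / (2 ^+ j) ^+ p).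
    by rewrite expr_div_n [A ^+ p.+1]exprS; ring.
  rewrite ler_wpM2l//.
  rewrite ler_pdivrMr ?exprn_gt0// mulrC ler_pdivlMr ?exprn_gt0//.
  rewrite -exprMn -[X in _ <= X]exprM mulnC exprM.
  by apply: lerXn2r; rewrite ?nnegrE ?exprn_ge0 ?mulr_ge0 ?(ltW t_gt0)// mulrC.
rewrite -mulr_sumr.
suff : \sum_(j < N) (2 ^+ j)^-1 <= (2 : R) - (2 ^+ N)^-1 * 2.
  move=> le; have J0 : 0 <= J / 2 by rewrite divr_ge0// mulr_ge0.
  apply: (le_trans (ler_wpM2l J0 le)).
  by rewrite -[leRHS](@divfK _ 2)// ler_wpM2l// lerBlDr lerDl mulr_ge0.
elim: N => [|N IH]; first by rewrite big_ord0 expr0 invr1 mul1r subrr.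
rewrite big_ord_recr /=; apply: (le_trans (lerD IH (lexx _))).
rewrite exprS invfM; have := exprn_gt0 N (ltr0n R 2 : 0 < 2).
rewrite -invr_gt0; set y := _^-1 => y0.
rewrite le_eqVlt; apply/orP; left; apply/eqP; by field.
Qed.

(* Truncating h at height [t ^ j] splits off a part of small integral, and the
   remainder is controlled by Plancherel; the levels j are summed. *)
Lemma ft_power_int :
  rint leb (fun xi => normc (ft h xi) ^+ p.+2) /\
  \int[leb]_xi normc (ft h xi) ^+ p.+2 <=
    2 * (4 ^+ p.+2 * A ^+ p.+1 * (2 * pi) ^+ n).
Proof.
rewrite -/J.
have mH : measurable_fun setT (fun xi => normc (ft h xi) ^+ p.+2).
  by apply: (measurable_funX (f := fun xi => normc (ft h xi))); exact: measurable_normc_ft.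
have S0 N xi : 0 <= S N xi.
  apply: sumr_ge0 => j _; rewrite mulr_ge0 ?exprn_ge0 ?normc_ge0//.
  by rewrite mulr_ge0// exprn_ge0// ltW.
(* The minimum with a partial sum becomes equal to the power as soon as N passes the level given by
   [power_le], while each partial sum has integral at most [J]. *)
pose f_ N xi := Num.min (normc (ft h xi) ^+ p.+2) (S N xi).
have f0 N xi : 0 <= f_ N xi by rewrite /f_ le_min S0 exprn_ge0// normc_ge0.
have fi N : rint leb (f_ N).
  apply: (rint_le (S N)); [|by have [] := S_le N|].
    by apply: measurable_minr => //; exact: rint_measurable (proj1 (S_le N)).
  by move=> xi; rewrite ger0_norm// /f_ ge_min lexx orbT.
apply: (Rint_fatou (f_ := f_)) => //.
- move=> xi; apply: cvg_near_cst.
  have [H0|H0] := eqVneq (normc (ft h xi)) 0.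
    by apply: nearW => N; rewrite /f_ H0 expr0n /= min_l//.
  have [j jP] : exists j, normc (ft h xi) ^+ p.+2 <= c j * normc (ft (a j) xi) ^+ 2.
    by apply: power_le; rewrite lt_neqAle eq_sym H0 normc_ge0.
  near=> N; rewrite /f_ min_l//; apply: (le_trans jP).
  have jN : (j < N)%N by near: N; exact: nbhs_infty_gt.
  rewrite /S (bigD1 (Ordinal jN))//= lerDl sumr_ge0// => i _.
  by rewrite mulr_ge0 ?exprn_ge0 ?normc_ge0// mulr_ge0// exprn_ge0// ltW.
- move=> N; apply: le_trans (proj2 (S_le N)); apply: le_Rint => //.
    by have [] := S_le N.
  by move=> xi; rewrite /f_ ge_min lexx orbT.
Unshelve. all: end_near. Qed.

End power.

End fourier_transform.

(** * Boxes, and a uniform gap for transforms away from the origin *)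

Section boxes.
Context {R : realType} {n : nat}.
Notation leb := (@lebesgue_row R n).

Lemma measurable_product_set (A : 'I_n -> set R) :
  (forall i, measurable (A i)) -> measurable [set x : 'rV[R]_n | forall i, A i (x 0 i)].
Proof.
move=> mA; rewrite (_ : [set x | _] = \big[setI/setT]_(i < n)
    ((fun x : 'rV[R]_n => x 0 i) @^-1` A i)).
  apply: bigsetI_measurable => i _.
  by rewrite -[X in measurable X]setTI; exact: (measurable_coord i measurableT (mA _)).
rewrite -bigcap_seq; apply/seteqP; split=> x /= Ax i; first by move=> _; exact: Ax.
by apply: Ax; rewrite /= mem_index_enum.
Qed.

Definition open_box (c : 'rV[R]_n) r : set 'rV[R]_n :=
  [set x | forall i, `]c 0 i - r, c 0 i + r[%classic (x 0 i)].

Lemma measurable_open_box c r : measurable (open_box c r).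
Proof.
apply: (measurable_product_set (A := fun i => `]c 0 i - r, c 0 i + r[%classic)) => i.
exact: measurable_itv.
Qed.

Lemma open_box_volume c r : 0 < r -> leb (open_box c r) = ((2 * r) ^+ n)%:E.
Proof.
move=> r0; rewrite /open_box (lebesgue_row_box (A := fun i => `]c 0 i - r, c 0 i + r[%classic))//.
rewrite (eq_bigr (fun=> (2 * r)%:E)) => [|i _].
  by rewrite prodEFin prodr_const card_ord.
rewrite lebesgue_measure_itv /= lte_fin ltrBlDr -addrA ltrDl addr_gt0//.
by rewrite -EFinB; congr (_%:E); ring.
Qed.

Lemma Rint_indic_open_box c r : 0 < r ->
  rint leb \1_(open_box c r) /\ \int[leb]_x \1_(open_box c r) x = (2 * r) ^+ n.
Proof.
move=> r0; have mb := measurable_open_box c r.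
have E : (\int[leb]_x (\1_(open_box c r) x)%:E = ((2 * r) ^+ n)%:E)%E.
  by rewrite integral_indic// setIT; exact: open_box_volume.
by split; [apply: rint_of_finite => //; rewrite E ltry|rewrite /Rintegral E].
Qed.

Lemma open_box_nrm c r x : 0 <= r -> open_box c r x -> nrm (x - c) <= n%:R * r.
Proof.
move=> r0 bx; rewrite /nrm.
apply: (@le_trans _ _ (\sum_(i < n) r)); last by rewrite sumr_const card_ord mulr_natl.
apply: ler_sum => i _; have := bx i; rewrite /= in_itv /= !mxE => /andP[h1 h2].
by rewrite ler_norml; apply/andP; split; lra.
Qed.

Lemma nrm_large_coord (eta : 'rV[R]_n) e : 0 < e -> n%:R * e < nrm eta ->
  exists i, e <= `|eta 0 i|.
Proof.
move=> e0 h; apply: contrapT => /forallNP hn.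
suff : nrm eta <= n%:R * e by rewrite leNgt h.
apply: (@le_trans _ _ (\sum_(i < n) e)); last by rewrite sumr_const card_ord mulr_natl.
by apply: ler_sum => i _; apply: ltW; rewrite ltNge; apply/negP/hn.
Qed.

End boxes.

Section fourier_gap.
Context {R : realType} {n : nat}.
Notation leb := (@lebesgue_row R n).
Implicit Types (h : 'rV[R]_n -> R) (xi eta c : 'rV[R]_n).

(** Translating h multiplies its transform by a phase, so the modulus is Lipschitz with constant the
    first moment about any center c, wherever that center lies. *)
Lemma ft_lipschitz h c K xi zeta : (forall x, 0 <= h x) -> rint leb h ->
  rint leb (fun x => nrm (x - c) * h x) ->
  \int[leb]_x (nrm (x - c) * h x) <= K ->
  normc (ft h xi) - K * nrm zeta <= normc (ft h (xi + zeta)).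
Proof.
move=> h0 hi hn hK; have md := @measurable_dotpr R n.
have -> : normc (ft h (xi + zeta)) =
    normc (osc leb h (fun x => dotp (xi + zeta) x + - dotp zeta c)).
  by rewrite (osc_phase _ hi (md _)) normcM normc_expi mulr1.
set th := fun x => _; have mth : measurable_fun setT th by rewrite /th; mfun.
have i1 : rint leb (fun x => `|h x| * `|dotp xi x - th x|).
  apply: (rint_le (fun x : 'rV[R]_n => nrm zeta * (nrm (x - c) * h x))).
  - by have mh := rint_measurable hi; have mx := md xi; mfun.
  - exact: rintZ.
  move=> x; rewrite /th ger0_norm ?mulr_ge0// (ger0_norm (h0 x)) mulrA [leRHS]mulrC.
  rewrite ler_wpM2l// (_ : _ - _ = dotp zeta (c - x)); last first.
    by rewrite dotpDl dotpBr; ring.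
  by apply: (le_trans (norm_dotp_le _ _)); rewrite -[nrm (c - x)]nrmN opprB.
have := osc_sub_le hi (md xi) mth i1.
have le2 : \int[leb]_x (`|h x| * `|dotp xi x - th x|) <= K * nrm zeta.
  apply: (@le_trans _ _ (\int[leb]_x (nrm zeta * (nrm (x - c) * h x)))).
    apply: le_Rint => //; first exact: rintZ.
    move=> x; rewrite /th (ger0_norm (h0 x)) mulrA [leRHS]mulrC.
    rewrite ler_wpM2l// (_ : _ - _ = dotp zeta (c - x)); last first.
      by rewrite dotpDl dotpBr; ring.
    by apply: (le_trans (norm_dotp_le _ _)); rewrite -[nrm (c - x)]nrmN opprB.
  by rewrite RintZ// mulrC ler_wpM2r// nrm_ge0.
move=> /le_trans /(_ le2) le3.
rewrite lerBlDr -[X in normc X <= _](subrK (osc leb h th)).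
by apply: (le_trans (normcD_le _ _)); rewrite addrC lerD2l.
Qed.

(* If the transform were almost maximal at eta, it would be large at every
   multiple [k eta] (see [osc_multiple]), hence, by the Lipschitz bound, on
   many disjoint boxes, contradicting the bound on the integral of its power. *)
Lemma ft_gap (J K delta : R) (p : nat) : 0 <= J -> 0 <= K -> 0 < delta ->
  exists2 eps : R, 0 < eps & forall h c,
    (forall x, 0 <= h x) -> rint leb h -> \int[leb]_x h x <= 1 ->
    rint leb (fun x => nrm (x - c) * h x) ->
    \int[leb]_x (nrm (x - c) * h x) <= K ->
    rint leb (fun xi => normc (ft h xi) ^+ p) ->
    \int[leb]_xi normc (ft h xi) ^+ p <= J ->
    forall eta, delta <= nrm eta -> normc (ft h eta) <= 1 - eps.
Proof.
move=> J0 K0 d0.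
(* Some coordinate of eta is at least e, so r <= e/2 makes the boxes around distinct multiples of
   eta disjoint. The other bound on r gives K n r <= 1/4: a transform of modulus 3/4 at the center
   of a box stays above 1/2 on it. Using n + 1 keeps the quotients meaningful in dimension 0. *)
pose e := delta / (n.+1%:R); have e0 : 0 < e by rewrite divr_gt0.
pose r := Num.min (e / 2) (1 / (4 * (K + 1) * n.+1%:R)).
have K1 : 0 < 4 * (K + 1) * n.+1%:R by rewrite !mulr_gt0// ltr_wpDl.
have r0 : 0 < r by rewrite /r lt_min !divr_gt0.
have re : 2 * r <= e.
  have h : r <= e / 2 by rewrite /r ge_min lexx.
  by move: h; lra.
have rK : K * (n%:R * r) <= 1 / 4.
  have : r <= 1 / (4 * (K + 1) * n.+1%:R) by rewrite /r ge_min lexx orbT.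
  rewrite ler_pdivlMr// => le; rewrite ler_pdivlMr//; apply: le_trans le.
  have -> : K * (n%:R * r) * 4 = r * (4 * K * n%:R) by ring.
  rewrite ler_wpM2l ?(ltW r0)// ler_pM//.
  - by rewrite mulr_ge0.
  - by rewrite ler_wpM2l// lerDl.
  - by rewrite ler_nat.
(* The least contribution of one box, on which the transform is at least 1/2, to the integral of the
   power p; N is chosen so that N boxes exceed J. *)
pose vol := (2 * r) ^+ n * (2 ^+ p)^-1.
have vol0 : 0 < vol by rewrite mulr_gt0 ?exprn_gt0 ?invr_gt0 ?exprn_gt0 ?mulr_gt0.
pose N := (Num.bound (J / vol)).+1.
have NJ : J < N%:R * vol.
  rewrite -ltr_pdivrMr//; apply: lt_le_trans (archi_boundP _) _.
    by rewrite divr_ge0// ltW.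
  by rewrite ler_nat.
(* If the modulus exceeds 1 - eps at eta, then so does the total mass, and the modulus at k eta
   falls below that mass by at most N^2 eps. Hence it is at least 1 - (N^2 + 1) eps, which is above
   3/4. *)
pose eps : R := (4 * (N%:R ^+ 2 + 2))^-1.
have N2 : 0 < 4 * (N%:R ^+ 2 + 2) :> R by rewrite mulr_gt0// ltr_wpDl// sqr_ge0.
exists eps; first by rewrite invr_gt0.
move=> h c h0 hi h1 hn hK hp hJ eta eta_ge; rewrite leNgt; apply/negP => big.
have vE : \int[leb]_x h x = \int[leb]_x `|h x|.
  by apply: eq_Rint => x; rewrite ger0_norm.
have leH xi : normc (ft h xi) <= \int[leb]_x h x.
  by rewrite vE; exact: normc_osc_le hi (measurable_dotpr xi).
have epsE : (N%:R ^+ 2 + 2) * eps = 1 / 4.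
  by rewrite /eps invfM mulrCA mulfV ?mulr1 ?mul1r// gt_eqF// ltr_wpDl// sqr_ge0.
have large k : (k <= N)%N -> 3 / 4 <= normc (ft h (k%:R *: eta)).
  move=> kN; have := osc_multiple k hi h0 (measurable_dotpr eta).
  rewrite (@eq_osc _ _ _ leb h h (fun x => dotp eta x *+ k) (dotp (k%:R *: eta)))//; last first.
    by move=> x; rewrite dotpZl mulr_natl.
  rewrite -/(ft h _) -/(ft h eta).
  set v := \int[leb]_x h x in h1 leH *.
  have h2 : v - normc (ft h eta) <= eps by move: big h1; lra.
  have k2 : k%:R ^+ 2 <= N%:R ^+ 2 :> R by rewrite -!natrX ler_nat leq_exp2r.
  have ge0 : 0 <= v - normc (ft h eta) by rewrite subr_ge0.
  have h3 := ler_pM (sqr_ge0 (k%:R : R)) ge0 k2 h2.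
  have e0' : 0 <= eps by rewrite invr_ge0 ltW.
  have := leH eta; move: big h3 epsE; lra.
have onbox k xi : (k <= N)%N -> open_box (k%:R *: eta) r xi -> 1 / 2 <= normc (ft h xi).
  move=> kN bx.
  have := @ft_lipschitz h c K (k%:R *: eta) (xi - k%:R *: eta) h0 hi hn hK.
  rewrite [_ + (xi - _)]addrC subrK; have := large k kN.
  have := ler_wpM2l K0 (open_box_nrm (ltW r0) bx); move: rK; lra.
have [i ei] : exists i, e <= `|eta 0 i|.
  apply: nrm_large_coord => //; apply: lt_le_trans eta_ge.
  by rewrite /e mulrCA gtr_pMr// ltr_pdivrMr// mul1r ltr_nat.
have disj k l xi : k != l -> open_box (k%:R *: eta) r xi ->
    open_box (l%:R *: eta) r xi -> False.
  move=> kl /(_ i) + /(_ i); rewrite /= !in_itv /= !mxE => /andP[a1 a2] /andP[b1 b2].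
  have : `|k%:R * eta 0 i - l%:R * eta 0 i| < 2 * r.
    by rewrite ltr_norml; apply/andP; split; lra.
  rewrite -mulrBl normrM ltNge => /negP; apply; apply: (le_trans re).
  apply: (le_trans ei); rewrite ler_peMl// .
  wlog lk : k l kl a1 a2 b1 b2 / (l < k)%N.
    move=> hw; have [lk|kl'|/eqP] := ltngtP l k; first exact: hw.
      by rewrite distrC; apply: hw => //; rewrite eq_sym.
    by rewrite eq_sym (negbTE kl).
  by rewrite -natrB 1?ltnW// ger0_norm// ler1n subn_gt0.
pose F xi : R := \sum_(k < N) (2 ^+ p)^-1 * \1_(open_box ((k%:R : R) *: eta) r) xi.
have FI (k : 'I_N) : rint leb (fun xi => (2 ^+ p)^-1 * \1_(open_box ((k%:R : R) *: eta) r) xi).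
  by apply: rintZ; have [] := Rint_indic_open_box (k%:R *: eta) r0.
have Fle xi : F xi <= normc (ft h xi) ^+ p.
  have [[k bk]|hk] := pselect (exists k : 'I_N, open_box (k%:R *: eta) r xi).
    rewrite /F (bigD1 k)//= big1 => [|l lk].
      rewrite addr0 indicE mem_set// mulr1 -exprVn lerXn2r ?nnegrE ?normc_ge0//.
      by have := onbox k xi (ltnW (ltn_ord k)) bk; rewrite mul1r.
    rewrite indicE memNset ?mulr0// => bl.
    by apply: (disj _ _ _ _ bl bk); exact: lk.
  rewrite /F big1 ?exprn_ge0 ?normc_ge0// => k _.
  by rewrite indicE memNset ?mulr0// => bk; apply: hk; exists k.
have : \int[leb]_xi F xi <= J.
  by apply: le_trans hJ; apply: le_Rint => //; exact: rint_sum.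
rewrite /F Rint_sum// leNgt => /negP; apply.
rewrite (eq_bigr (fun=> vol)) => [|k _].
  by rewrite sumr_const card_ord -mulr_natl.
have [i1 i2] := Rint_indic_open_box (k%:R *: eta) r0.
by rewrite RintZ// i2 mulrC.
Qed.

End fourier_gap.

(** * Functions in L^alpha multiplied by a translated Gaussian *)

Section tilted_gaussian.
Context {R : realType} {n : nat}.
Notation leb := (@lebesgue_row R n).
Variables (g : 'rV[R]_n -> R) (alpha sigma : R).
Hypotheses (alpha_gt1 : 1 < alpha) (sigma_gt0 : 0 < sigma).
Hypotheses (mg : measurable_fun setT g) (g0 : forall x, 0 <= g x).
Hypothesis gai : rint leb (fun x => g x `^ alpha).

Definition tilt c x := g x * gau sigma (x - c).

Let C := 1 + 4 * n%:R / sigma ^+ 2.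
Let tau : R := sigma / Num.sqrt 2.
Let Ig := \int[leb]_x (g x `^ alpha).

Let C_ge1 : 1 <= C.
Proof. by rewrite lerDl; apply: divr_ge0; [exact: mulr_ge0|exact: sqr_ge0]. Qed.

Let C0 : 0 <= C. Proof. exact: le_trans C_ge1. Qed.

Let tau_gt0 : 0 < tau. Proof. by rewrite divr_gt0// sqrtr_gt0. Qed.

Let Ig_ge0 : 0 <= Ig. Proof. by apply: Rint_ge0 => x; exact: powR_ge0. Qed.

Let ms : measurable_fun setT (@gau R n sigma). Proof. exact: measurable_gau. Qed.
Let mt : measurable_fun setT (@gau R n tau). Proof. exact: measurable_gau. Qed.
Let mn : measurable_fun setT (@nrm R n). Proof. exact: measurable_nrm. Qed.

Let gau_ge0 s (x : 'rV[R]_n) : 0 <= gau s x. Proof. exact/ltW/gau_gt0. Qed.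

(** With [tau] = sigma / sqrt 2 the Gaussian is the square of [gau tau]; one factor absorbs nrm x
    and the other remains. The constant [C] is what bounds 1 + n |x|^2 by C (1 + tau^2 |x|^2 /
    2). *)
Lemma gau_nrm_le (x : 'rV[R]_n) : nrm x * gau sigma x <= C * gau tau x.
Proof.
have -> : gau sigma x = gau tau x * gau tau x.
  rewrite /gau -expRD -opprD; congr (expR (- _)).
  by rewrite /tau expr_div_n sqr_sqrtr//; field.
rewrite mulrA ler_wpM2r// {1}/gau expRN ler_pdivrMr ?expR_gt0//.
apply: (@le_trans _ _ (C * (1 + tau ^+ 2 * dotp x x / 2))); last first.
  by rewrite ler_wpM2l// expR_ge1Dx.
have h1 : nrm x <= 1 + nrm x ^+ 2.
  by have := sqr_ge0 (nrm x - 1); have := sqr_ge0 (nrm x); nra.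
apply: (le_trans h1); have h2 := nrm_sqr_le x.
apply: (@le_trans _ _ (1 + n%:R * dotp x x)); first by rewrite lerD2l.
have s2 : 0 < sigma ^+ 2 by rewrite exprn_gt0.
have -> : C * (1 + tau ^+ 2 * dotp x x / 2) =
    1 + n%:R * dotp x x + (4 * n%:R / sigma ^+ 2 + sigma ^+ 2 * dotp x x / 4).
  rewrite /C /tau expr_div_n sqr_sqrtr//; field; rewrite gt_eqF//.
rewrite lerDl; apply: addr_ge0.
  by apply: divr_ge0; [exact: mulr_ge0|exact: sqr_ge0].
apply: divr_ge0 => //; by apply: mulr_ge0; [exact: sqr_ge0|exact: dotp_ge0].
Qed.

Lemma gau_decay (x : 'rV[R]_n) : gau sigma x <= (C + 1) / (1 + nrm x).
Proof.
rewrite ler_pdivlMr ?ltr_wpDr ?nrm_ge0// mulrDr mulr1 addrC lerD//; last exact: gau_le1.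
rewrite mulrC; apply: (le_trans (gau_nrm_le x)).
by rewrite ler_piMr// gau_le1.
Qed.

(** Below l the first term suffices; above l the factor (u/l)^(alpha-1) is at least 1. With l = 1
    this gives plain bounds, with l small it makes the linear term negligible in [tilt_decay]. *)
Lemma le_add_powR (u l : R) : 0 <= u -> 0 < l -> u <= l + l `^ (1 - alpha) * u `^ alpha.
Proof.
move=> u0 l0; case: (leP u l) => ul.
  by apply: (le_trans ul); rewrite lerDl mulr_ge0// powR_ge0.
have u_gt0 : 0 < u by exact: lt_trans ul.
apply: (@le_trans _ _ (l `^ (1 - alpha) * u `^ alpha)); last by rewrite lerDr ltW.
have -> : u `^ alpha = u * u `^ (alpha - 1).
  rewrite -[X in X * _]powRr1 ?(ltW u_gt0)// -powRD; last by rewrite (gt_eqF u_gt0) implybT.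
  by congr (_ `^ _); ring.
rewrite mulrCA ler_peMr// -opprB powRN mulrC ler_pdivlMr ?powR_gt0// mul1r.
by apply: ge0_ler_powR; rewrite ?nnegrE ?subr_ge0 ?(ltW alpha_gt1) ?(ltW l0) ?(ltW ul).
Qed.

Let g_le x : g x <= 1 + g x `^ alpha.
Proof. by have := le_add_powR (g0 x) ltr01; rewrite powR1 mul1r. Qed.

Let gs_shift s c : 0 < s -> rint leb (fun x => gau s (x - c)) /\
  \int[leb]_x gau s (x - c) = \int[leb]_x gau s x.
Proof.
move=> s0; have gi := @rint_gau R n s s0.
by split; [exact: (rint_row_shift (- c) gi)|exact: (Rint_row_shift (- c) gi)].
Qed.

Lemma tilt_ge0 c x : 0 <= tilt c x.
Proof. by rewrite mulr_ge0. Qed.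

Lemma measurable_tilt c : measurable_fun setT (tilt c).
Proof. by rewrite /tilt; mfun. Qed.

(** One bound, valid for every center, for both the integral of the product and that of its power
    alpha, as the truncation argument asks; the last summand makes it positive. *)
Let mass := \int[leb]_x gau sigma x + Ig + 1.

Lemma rint_tilt c : rint leb (tilt c) /\ \int[leb]_x tilt c x <= mass.
Proof.
have [i1 e1] := gs_shift c sigma_gt0.
have le x : tilt c x <= gau sigma (x - c) + g x `^ alpha.
  apply: (le_trans (ler_wpM2r (gau_ge0 _ _) (g_le x))).
  by rewrite mulrDl mul1r lerD2l ler_piMr ?powR_ge0 ?gau_le1.
have i : rint leb (tilt c).
  apply: (rint_le (fun x : 'rV[R]_n => gau sigma (x - c) + g x `^ alpha)).
  - exact: measurable_tilt.
  - exact: rintD.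
  - by move=> x; rewrite ger0_norm ?tilt_ge0.
split=> //; apply: (le_trans (le_Rint i (rintD i1 gai) le)).
by rewrite RintD// e1 /mass lerDl.
Qed.

Lemma rint_tilt_powR c : rint leb (fun x => tilt c x `^ alpha) /\
  \int[leb]_x (tilt c x `^ alpha) <= mass.
Proof.
have mt' := measurable_tilt c.
have le x : tilt c x `^ alpha <= g x `^ alpha.
  apply: ge0_ler_powR; rewrite ?nnegrE ?tilt_ge0// ?(le_trans _ (ltW alpha_gt1))//.
  by rewrite /tilt ler_piMr// gau_le1.
have i : rint leb (fun x => tilt c x `^ alpha).
  apply: (rint_le (fun x : 'rV[R]_n => g x `^ alpha)) => //; first by mfun.
  by move=> x; rewrite ger0_norm ?powR_ge0.
split=> //; apply: (le_trans (le_Rint i gai le)).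
by rewrite -/Ig /mass addrAC lerDr addr_ge0// Rint_ge0.
Qed.

Lemma tilt_moment : exists2 K : R, 0 <= K & forall c,
  rint leb (fun x => nrm (x - c) * tilt c x) /\
  \int[leb]_x (nrm (x - c) * tilt c x) <= K.
Proof.
exists (C * \int[leb]_x gau tau x + C * Ig).
  by rewrite addr_ge0 ?mulr_ge0// Rint_ge0.
move=> c; have [i1 e1] := gs_shift c tau_gt0.
have le x : nrm (x - c) * tilt c x <= C * gau tau (x - c) + C * g x `^ alpha.
  rewrite /tilt mulrCA.
  apply: (le_trans (ler_wpM2r _ (g_le x))); first by rewrite mulr_ge0// nrm_ge0.
  have hn := gau_nrm_le (x - c).
  rewrite mulrDl mul1r lerD// mulrC ler_wpM2r ?powR_ge0//.
  by apply: (le_trans hn); rewrite ler_piMr// gau_le1.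
have i : rint leb (fun x => nrm (x - c) * tilt c x).
  apply: (rint_le (fun x : 'rV[R]_n => C * gau tau (x - c) + C * g x `^ alpha)).
  - by have mt' := measurable_tilt c; mfun.
  - by apply: rintD; exact: rintZ.
  - by move=> x; rewrite ger0_norm// mulr_ge0 ?nrm_ge0 ?tilt_ge0.
split=> //; apply: (le_trans (le_Rint i (rintD (rintZ C i1) (rintZ C gai)) le)).
by rewrite (RintD (rintZ C i1) (rintZ C gai)) (RintZ C i1) (RintZ C gai) e1.
Qed.

Lemma tilt_fourier_power : exists p (J : R), 0 <= J /\ forall c,
  rint leb (fun xi => normc (ft (tilt c) xi) ^+ p) /\
  \int[leb]_xi normc (ft (tilt c) xi) ^+ p <= J.
Proof.
have a0 : 0 < alpha - 1 by rewrite subr_gt0.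
pose t : R := 2 `^ (alpha - 1)^-1.
have t0 : 0 < t by exact: powR_gt0.
have tE : t `^ (alpha - 1) = 2 by rewrite /t -powRrM mulVf ?gt_eqF// powRr1.
have mass0 : 0 < mass by rewrite ltr_wpDl// addr_ge0// Rint_ge0.
pose p := Num.bound (2 * t).
have pt : 2 * t <= 2 ^+ p.
  have h : 2 * t < p%:R by apply: archi_boundP; rewrite mulr_ge0// ltW.
  by apply: (le_trans (ltW h)); rewrite -natrX ler_nat ltnW// ltn_expl.
exists p.+2, (2 * (4 ^+ p.+2 * mass ^+ p.+1 * (2 * pi) ^+ n)); split.
  have m0 := ltW mass0; apply: mulr_ge0 => //; apply: mulr_ge0.
    by apply: mulr_ge0; apply: exprn_ge0.
  by rewrite exprn_ge0// mulr_ge0// pi_ge0.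
move=> c; have [i1 l1] := rint_tilt c; have [i2 l2] := rint_tilt_powR c.
exact: (ft_power_int alpha_gt1 mass0 t0 tE pt (tilt_ge0 c) i1 l1 i2 l2).
Qed.

(** Far from the origin g^alpha has little mass, and on a bounded set a Gaussian with distant center
    is small. The level l makes the part of g not controlled by g^alpha contribute at most e/2. *)
Lemma tilt_decay e : 0 < e ->
  exists rho : R, forall c, rho <= nrm c -> \int[leb]_x tilt c x <= e.
Proof.
move=> e0; pose G0 := \int[leb]_x gau sigma x.
have G00 : 0 <= G0 by apply: Rint_ge0.
pose l := e / (2 * (G0 + 1)).
have l0 : 0 < l by rewrite divr_gt0// mulr_gt0// ltr_wpDl.
pose L := l `^ (1 - alpha); have L0 : 0 < L by exact: powR_gt0.
pose far k (x : 'rV[R]_n) : R := if k%:R < nrm x then 1 else 0.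
have mfar k : measurable_fun setT (far k).
  by apply: measurable_fun_ifT => //; apply: measurable_fun_ltr.
have far01 k x : 0 <= far k x <= 1 by rewrite /far; case: ifP => _; rewrite ?lexx ler01.
(* Outside radius k the Gaussian is bounded by 1; inside, once nrm c >= 2k, the point is at distance
   at least k from c, and [gau_decay] gives (C+1)/(k+1). [T_ k] is the resulting bound on the
   integral of g^alpha times the Gaussian. *)
pose T_ k := \int[leb]_x (g x `^ alpha * far k x + g x `^ alpha * ((C + 1) * harmonic k)).
have cvT : T_ k @[k --> \oo] --> \int[leb]_x (0 : R).
  apply: (Rint_dominated (g := fun x => (C + 2) * g x `^ alpha)) => //.
  - by move=> k; have mk := mfar k; mfun.
  - move=> x; rewrite -[X in _ --> X]addr0; apply: cvgD.
      apply: cvg_near_cst; near=> k; rewrite /far ifF ?mulr0//.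
      apply/negbTE; rewrite -leNgt; near: k; apply: nbhs_infty_ger.
    rewrite -[X in _ --> X](mulr0 (g x `^ alpha)); apply: cvgM; first exact: cvg_cst.
    rewrite -[X in _ --> X](mulr0 (C + 1)); apply: cvgM; first exact: cvg_cst.
    exact: cvg_harmonic.
  - exact: rintZ.
  move=> k x; have ga := powR_ge0 (g x) alpha.
  have /andP[f0 f1] := far01 k x; have hk := ltW (@harmonic_gt0' R k).
  have hk1 : harmonic k <= 1 :> R by rewrite /harmonic /= invf_le1 ?ler1n ?ltr0n.
  have C1 : 0 <= C + 1 by rewrite addr_ge0.
  have C1h : 0 <= (C + 1) * harmonic k by exact: mulr_ge0.
  rewrite ger0_norm; last by rewrite addr_ge0// mulr_ge0.
  rewrite -mulrDr mulrC ler_wpM2r//.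
  rewrite (_ : C + 2 = 1 + (C + 1)); last by ring.
  by rewrite lerD// ler_piMr.
rewrite Rint0 in cvT.
have eL : 0 < e / (2 * L) by rewrite divr_gt0// mulr_gt0.
have /cvgrPdist_lt/(_ _ eL)[k _ hk] := cvT.
have Tk : T_ k <= e / (2 * L).
  have := hk k (leqnn k); rewrite sub0r normrN => h.
  by apply: ltW; apply: le_lt_trans h; exact: ler_norm.
exists (2 * k%:R) => c ck; have [i1 e1] := gs_shift c sigma_gt0.
have pt x : tilt c x <= l * gau sigma (x - c) +
    L * (g x `^ alpha * far k x + g x `^ alpha * ((C + 1) * harmonic k)).
  have ga := powR_ge0 (g x) alpha.
  apply: (le_trans (ler_wpM2r (gau_ge0 _ _) (le_add_powR (g0 x) l0))).
  rewrite mulrDl lerD2l -mulrA -/L ler_wpM2l ?(ltW L0)//.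
  rewrite -mulrDr ler_wpM2l// /far; case: ifPn => [_|].
    apply: (@le_trans _ _ 1); first exact: gau_le1.
    rewrite lerDl; apply: mulr_ge0; first exact: addr_ge0.
    exact/ltW/harmonic_gt0'.
  rewrite -leNgt => xk; rewrite add0r; apply: (le_trans (gau_decay _)).
  apply: ler_wpM2l; first exact: addr_ge0.
  rewrite /harmonic /= lef_pV2 ?posrE ?ltr0n//; last first.
    by rewrite ltr_wpDr// nrm_ge0.
  rewrite -natr1 addrC lerD2l.
  have := nrmD (c - x) x; rewrite subrK -[nrm (c - x)]nrmN opprB => h.
  by move: h ck xk; lra.
have i2 : rint leb (fun x => g x `^ alpha * far k x + g x `^ alpha * ((C + 1) * harmonic k)).
  apply: rintD.
    apply: (rintM_bounded (c := 1)) => // x.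
    by have /andP[f0 f1] := far01 k x; rewrite ger0_norm.
  by apply: eq_rint (rintZ ((C + 1) * harmonic k) gai) => x; rewrite mulrC.
have [i3 _] := rint_tilt c.
apply: (le_trans (le_Rint i3 (rintD (rintZ l i1) (rintZ L i2)) pt)).
rewrite RintD; [|exact: rintZ|exact: rintZ].
rewrite !RintZ// e1 -/G0 -/(T_ k).
have h1 : l * G0 <= e / 2.
  rewrite /l mulrAC ler_pdivrMr ?mulr_gt0 ?ltr_wpDl//.
  have -> : e / 2 * (2 * (G0 + 1)) = e * (G0 + 1) by field.
  by rewrite ler_wpM2l ?(ltW e0)// lerDl.
have h2 : L * T_ k <= e / 2.
  apply: (le_trans (ler_wpM2l (ltW L0) Tk)).
  by rewrite le_eqVlt; apply/orP; left; apply/eqP; field; rewrite gt_eqF.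
by move: h1 h2; lra.
Unshelve. all: end_near. Qed.

End tilted_gaussian.

(** * Closed boxes, their tent functions, and uniqueness of measures *)

Section closed_boxes.
Context {R : realType} {n : nat}.
Notation leb := (@lebesgue_row R n).
Implicit Types (a b x y : 'rV[R]_n).

(** The topology of row vectors is that of the sup norm; a sup-norm ball of radius r/(n+1) lies in
    the l^1 ball of radius r. *)
Lemma continuous_of_nrm (f : 'rV[R]_n -> R) :
  (forall x (e : R), 0 < e -> exists2 r : R, 0 < r &
     forall y, nrm (x - y) <= r -> `|f x - f y| <= e) -> continuous f.
Proof.
move=> h x; have FF : Filter (nbhs x) := nbhs_filter x.
apply/(@cvgrPdist_le R R _ (nbhs x) FF) => e e0; have [r r0 hr] := h x e e0.
apply/nbhs_ballP; exists (r / n.+1%:R) => /=; first by rewrite divr_gt0.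
move=> y [_ xy]; apply: hr.
apply: (@le_trans _ _ (\sum_(i < n) r / n.+1%:R)).
  apply: ler_sum => i _; have := xy 0 i; rewrite !mxE /ball /= => /ltW.
  exact.
rewrite sumr_const card_ord -[(_ / _) *+ n]mulr_natl mulrCA ler_piMr ?(ltW r0)//.
by rewrite ler_pdivrMr// mul1r ler_nat.
Qed.

Definition cbox a b : set 'rV[R]_n := [set x | forall i, a 0 i <= x 0 i <= b 0 i].

Let cboxes : set (set 'rV[R]_n) := [set A | exists a b, A = cbox a b].

Lemma measurable_cbox a b : measurable (cbox a b).
Proof.
apply: (measurable_product_set (A := fun i => `[a 0 i, b 0 i]%classic)) => i.
exact: measurable_itv.
Qed.

Lemma cbox_bounded x k : nrm x <= k%:R -> cbox (const_mx (- k%:R)) (const_mx k%:R) x.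
Proof.
move=> xk i; rewrite !mxE -ler_norml; apply: le_trans xk; exact: coord_le_nrm.
Qed.

Lemma bigcup_cbox : \bigcup_k cbox (const_mx (- k%:R)) (const_mx k%:R) = setT.
Proof.
apply/seteqP; split=> // x _; exists (Num.bound (nrm x)) => //.
by apply: cbox_bounded; apply/ltW/archi_boundP; exact: nrm_ge0.
Qed.

(** A half-space c <= x_i is a countable union of closed boxes, so the boxes generate the product
    sigma-algebra. *)
Let coord_cboxes i : measurable_fun (setT : set (g_sigma_algebraType cboxes))
  (fun x : g_sigma_algebraType cboxes => (x : 'rV[R]_n) 0 i).
Proof.
apply: (measurability _ (RGenCInfty.measurableE R)) => _ [_ [c ->] <-].
rewrite setTI.
pose a k : 'rV[R]_n := \row_j if j == i then c else - k%:R.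
rewrite (_ : _ @^-1` _ = \bigcup_k cbox (a k) (const_mx k%:R)).
  apply: bigcup_measurable => k _; apply: sub_sigma_algebra.
  by exists (a k), (const_mx k%:R).
apply/seteqP; split=> [x /= |x [k _ hx] /=]; rewrite in_itv /= andbT.
  move=> cx; exists (Num.bound (nrm x)) => // j.
  have xk : nrm x <= (Num.bound (nrm x))%:R.
    by apply/ltW/archi_boundP; exact: nrm_ge0.
  move: (cbox_bounded xk j); rewrite !mxE.
  by case: eqP => [-> /andP[_ ->]|_ //]; rewrite cx.
by have := hx i; rewrite !mxE eqxx => /andP[].
Qed.

Lemma measure_cbox_unique (m1 m2 : {measure set 'rV[R]_n -> \bar R}) :
  (forall a b, m1 (cbox a b) = m2 (cbox a b)) ->
  (forall a b, (m1 (cbox a b) < +oo)%E) ->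
  forall A, measurable A -> m1 A = m2 A.
Proof.
move=> m12 fin; apply: (measure_unique cboxes
  (fun k => cbox (const_mx (- k%:R)) (const_mx k%:R))).
- apply/seteqP; split; last first.
    apply: smallest_sub; first exact: sigma_algebra_measurable.
    by move=> _ [a [b ->]]; exact: measurable_cbox.
  apply: smallest_sub; first exact: smallest_sigma_algebra.
  move=> A; rewrite -bigcup_seq /= => -[i _ [Y mY <-]].
  exact: (coord_cboxes i measurableT mY).
- move=> _ _ [a [b ->]] [a' [b' ->]].
  exists (\row_i Num.max (a 0 i) (a' 0 i)), (\row_i Num.min (b 0 i) (b' 0 i)).
  apply/seteqP; split=> x /=.
    move=> [h1 h2] i; have /andP[p1 p2] := h1 i; have /andP[p3 p4] := h2 i.
    by rewrite !mxE ge_max le_min p1 p2 p3 p4.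
  move=> h; split=> i; have := h i; rewrite !mxE ge_max le_min;
    by move=> /andP[/andP[h1 h2] /andP[h3 h4]]; rewrite ?h1 ?h2 ?h3 ?h4.
- by move=> k; exists (const_mx (- k%:R)), (const_mx k%:R).
- exact: bigcup_cbox.
- by move=> A [a [b ->]].
- by move=> k.
Qed.

Section density_measure.
Variable (p : 'rV[R]_n -> R).
Hypotheses (mp : measurable_fun setT p) (p0 : forall x, 0 <= p x).

Let nu (A : set 'rV[R]_n) : \bar R := (\int[leb]_(x in A) (p x)%:E)%E.

Let nu0 : nu set0 = 0%E. Proof. by rewrite /nu integral_set0. Qed.

Let nu_ge0 A : (0 <= nu A)%E.
Proof. by apply: integral_ge0 => x _; rewrite lee_fin. Qed.

Let nu_add : semi_sigma_additive nu.
Proof.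
apply: semi_sigma_additive_nng_induced; first exact/measurable_EFinP.
by move=> x; rewrite lee_fin.
Qed.

Definition density_measure : {measure set 'rV[R]_n -> \bar R} :=
  HB.pack nu (isMeasure.Build _ _ _ nu nu0 nu_ge0 nu_add).

Lemma density_measureE A : density_measure A = (\int[leb]_(x in A) (p x)%:E)%E.
Proof. by []. Qed.

End density_measure.

(** The l^1 distance to the box. It is Lipschitz, hence so are the tents built on it, which is the
    regularity that [fourier_inverse_test] asks of a test function. *)
Definition box_dist a b x : R :=
  \sum_i Num.max 0 (Num.max (a 0 i - x 0 i) (x 0 i - b 0 i)).

Lemma box_dist_ge0 a b x : 0 <= box_dist a b x.
Proof. by apply: sumr_ge0 => i _; rewrite le_max lexx. Qed.

Lemma box_dist_coord a b x i :
  a 0 i - box_dist a b x <= x 0 i <= b 0 i + box_dist a b x.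
Proof.
have h : Num.max 0 (Num.max (a 0 i - x 0 i) (x 0 i - b 0 i)) <= box_dist a b x.
  rewrite /box_dist (bigD1 i)//= lerDl sumr_ge0// => j _.
  by rewrite le_max lexx.
move: h; rewrite !ge_max => /andP[_ /andP[h1 h2]]; apply/andP; split; lra.
Qed.

Lemma box_dist_eq0 a b x : (box_dist a b x = 0) <-> cbox a b x.
Proof.
split=> [h i|h].
  by have := box_dist_coord a b x i; rewrite h subr0 addr0.
apply: big1 => i _; have /andP[h1 h2] := h i.
by apply: max_l; rewrite ge_max !subr_le0 h1 h2.
Qed.

Lemma box_dist_lip a b x y : box_dist a b x <= box_dist a b y + nrm (x - y).
Proof.
rewrite /box_dist /nrm -big_split; apply: ler_sum => i _ /=; rewrite !mxE.
set u := x 0 i; set v := y 0 i.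
have := ler_norm (u - v); have := ler_norm (v - u); rewrite distrC.
move=> h1 h2; rewrite !ge_max; apply/and3P; split.
- by rewrite addr_ge0// le_max lexx.
- apply: (@le_trans _ _ ((a 0 i - v) + `|u - v|)); first by lra.
  by rewrite lerD2r !le_max lexx !orbT.
- apply: (@le_trans _ _ ((v - b 0 i) + `|u - v|)); first by lra.
  by rewrite lerD2r !le_max lexx !orbT.
Qed.

Definition tent (j : nat) a b x : R := Num.max 0 (1 - j.+1%:R * box_dist a b x).

Lemma tent01 j a b x : 0 <= tent j a b x <= 1.
Proof.
rewrite /tent le_max lexx ge_max ler01 /= gerBl mulr_ge0// box_dist_ge0//.
Qed.

Lemma tent_lip j a b x y :
  `|tent j a b x - tent j a b y| <= j.+1%:R * nrm (x - y).
Proof.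
have h u v : tent j a b u <= tent j a b v + j.+1%:R * nrm (u - v).
  rewrite /tent ge_max; apply/andP; split.
    by rewrite addr_ge0 ?mulr_ge0 ?nrm_ge0// le_max lexx.
  apply: (@le_trans _ _ ((1 - j.+1%:R * box_dist a b v) + j.+1%:R * nrm (u - v))).
    have := ler_wpM2l (ler0n R j.+1) (box_dist_lip a b v u).
    by rewrite -[nrm (v - u)]nrmN opprB mulrDr; lra.
  by rewrite lerD2r le_max lexx orbT.
have := h x y; have := h y x; rewrite -[nrm (y - x)]nrmN opprB ler_norml.
by move=> h1 h2; apply/andP; split; lra.
Qed.

Lemma measurable_tent j a b : measurable_fun setT (tent j a b).
Proof. by rewrite /tent /box_dist; mfun. Qed.

Lemma cvg_tent a b x : tent j a b x @[j --> \oo] --> (\1_(cbox a b) x : R).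
Proof.
apply: cvg_near_cst; have [bx|nbx] := pselect (cbox a b x).
  apply: nearW => j; rewrite /tent indicE mem_set// (proj2 (box_dist_eq0 a b x) bx).
  by rewrite mulr0 subr0; apply: max_r.
have d0 : 0 < box_dist a b x.
  by rewrite lt_neqAle box_dist_ge0 andbT eq_sym; apply/eqP => /box_dist_eq0.
near=> j; rewrite /tent indicE memNset//; apply: max_l.
rewrite subr_le0 -ler_pdivrMr//; apply: (@le_trans _ _ j%:R); last by rewrite ler_nat.
by near: j; exact: nbhs_infty_ger.
Unshelve. all: end_near. Qed.

(** Every tent vanishes at distance 1 from the box, so one bounded open box dominates the whole
    sequence. *)
Lemma tent_supp j a b x :
  tent j a b x <= \1_(open_box 0 (2 + nrm a + nrm b)) x.
Proof.
rewrite indicE; have [ho|ho] := pselect (open_box 0 (2 + nrm a + nrm b) x).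
  by rewrite mem_set//; have /andP[] := tent01 j a b x.
rewrite memNset//= /tent ge_max lexx /= subr_le0.
rewrite leNgt; apply/negP => h; apply: ho => i.
have d1 : box_dist a b x < 1.
  apply: le_lt_trans h; rewrite ler_peMl ?box_dist_ge0//.
  by rewrite ler1n.
have /andP[h1 h2] := box_dist_coord a b x i.
have := coord_le_nrm a i; have := coord_le_nrm b i; rewrite !ler_norml.
move=> /andP[b1 b2] /andP[a1 a2]; have := nrm_ge0 a; have := nrm_ge0 b.
by rewrite /= in_itv /= !mxE => a0 b0; apply/andP; split; lra.
Qed.

Lemma rint_tent j a b : rint leb (tent j a b).
Proof.
have r0 : 0 < 2 + nrm a + nrm b by rewrite -addrA ltr_wpDr ?addr_ge0 ?nrm_ge0.
have [i1 _] := Rint_indic_open_box (0 : 'rV[R]_n) r0.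
apply: rint_le i1 _; first exact: measurable_tent.
move=> x; have /andP[t0 _] := tent01 j a b x; rewrite ger0_norm//; exact: tent_supp.
Qed.

End closed_boxes.

(** * Fourier inversion *)

Section fourier_inversion.
Context {R : realType} {n : nat}.
Notation leb := (@lebesgue_row R n).
Variable mu : probability 'rV[R]_n R.
Implicit Types (t x y xi : 'rV[R]_n) (s : R).

Definition laplace_fourier t xi : R[i] :=
  osc mu (fun y => expR (dotp t y)) (dotp xi).

Hypothesis Hexp : forall t, rint mu (fun y => expR (dotp t y)).
Hypothesis Hft : forall t, rint leb (fun xi => normc (laplace_fourier t xi)).

Let K t xi x := complex.Re (laplace_fourier t xi * expi (- dotp xi x)).

(** The inversion integral on the line of real part t, without the factor exp(-<t,x>): it recovers
    the density of the measure tilted by exp <t,y>. *)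
Definition fourier_inverse t x :=
  ((2 * pi) ^+ n)^-1 * \int[leb]_xi complex.Re (laplace_fourier t xi * expi (- dotp xi x)).

Let pin_gt0 : 0 < ((2 * pi) ^+ n)^-1 :> R.
Proof. by rewrite invr_gt0 exprn_gt0// mulr_gt0// pi_gt0. Qed.

Let KE t xi x : K t xi x =
  \int[mu]_y (expR (dotp t y) * cos (dotp xi y - dotp xi x)).
Proof. by rewrite /K Re_osc_phase//; exact: measurable_dotpr. Qed.

Let K_le t xi x : `|K t xi x| <= normc (laplace_fourier t xi).
Proof. by apply: (le_trans (Re_le_normc _)); rewrite normcM normc_expi mulr1. Qed.

Let K_lip t xi x x' :
  `|K t xi x - K t xi x'| <= normc (laplace_fourier t xi) * `|dotp xi (x - x')|.
Proof.
rewrite /K -[_ - _](raddfB (@complex.Re R)) -mulrBr.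
apply: (le_trans (Re_le_normc _)); rewrite normcM ler_wpM2l ?normc_ge0//.
apply: (le_trans (expi_sub_le _ _)).
by rewrite dotpBr -normrN opprD !opprK.
Qed.

Let K_lip2 t xi x x' :
  `|K t xi x - K t xi x'| <= normc (laplace_fourier t xi) * 2.
Proof.
apply: (le_trans (ler_normB _ _)); rewrite mulr_natr mulr2n.
by apply: lerD; exact: K_le.
Qed.

Let mK t : measurable_fun setT (fun z : 'rV[R]_n * 'rV[R]_n => K t z.1 z.2).
Proof.
rewrite (_ : (fun _ => _) = (fun z : 'rV[R]_n * 'rV[R]_n =>
    \int[mu]_y (expR (dotp t y) * cos (dotp z.1 y - dotp z.1 z.2)))); last first.
  by apply/funext => z; exact: KE.
apply: (@measurable_osc_cos _ _ _ _ R mu _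
  (fun w : ('rV[R]_n * 'rV[R]_n) * 'rV[R]_n => dotp w.1.1 w.2 - dotp w.1.1 w.1.2) (Hexp t)).
  by move=> y; exact: expR_ge0.
by mfun.
Qed.

Let mKx t x : measurable_fun setT (fun xi => K t xi x).
Proof.
apply: (measurable_compT (h := fun z : 'rV[R]_n * 'rV[R]_n => K t z.1 z.2)
  (u := fun xi => (xi, x))) => //; by mfun.
Qed.

Let iK t x : rint leb (fun xi => K t xi x).
Proof. exact: (rint_le _ (mKx t x) (Hft t) (fun xi => K_le t xi x)). Qed.

Lemma measurable_fourier_inverse t : measurable_fun setT (fourier_inverse t).
Proof.
rewrite /fourier_inverse; apply: measurable_funM; first by mfun.
have mN := rint_measurable (Hft t).
(* Adding the modulus of the transform makes the integrand nonnegative, as Tonelli's measurability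
   statement requires; its integral is subtracted again. *)
pose F (z : 'rV[R]_n * 'rV[R]_n) := K t z.2 z.1 + normc (laplace_fourier t z.2).
have mF : measurable_fun setT F.
  apply: measurable_funD.
    apply: (measurable_compT (h := fun z : 'rV[R]_n * 'rV[R]_n => K t z.1 z.2)
      (u := fun z : 'rV[R]_n * 'rV[R]_n => (z.2, z.1))) => //; by mfun.
  exact: (measurable_compT mN (measurable_comp_snd (@measurable_id _ _ _))).
rewrite (_ : (fun _ => _) = fun x => \int[leb]_xi F (x, xi) -
   \int[leb]_xi normc (laplace_fourier t xi)).
  apply: measurable_funB => //; apply: measurable_Rint2 => // z.
  by have := K_le t z.2 z.1; rewrite ler_norml /F => /andP[h _]; rewrite -lerBlDr sub0r.
apply/funext => x; apply/esym; apply: (canLR (addrK _)).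
exact: (RintD (iK t x) (Hft t)).
Qed.

(** [w k] bounds the oscillation at scale [harmonic k]. The minimum with 2 keeps the integrand
    dominated, since |xi| times the transform need not be integrable. *)
Lemma fourier_inverse_continuous t : continuous (fourier_inverse t).
Proof.
apply: continuous_of_nrm => x e e0.
pose N xi := normc (laplace_fourier t xi).
pose w k := \int[leb]_xi (N xi * Num.min 2 (nrm xi * harmonic k)).
have N0 xi : 0 <= N xi by exact: normc_ge0.
have hk0 k : 0 < harmonic k :> R by exact: harmonic_gt0'.
have m0 k xi : 0 <= Num.min 2 (nrm xi * harmonic k) :> R.
  by rewrite le_min ler0n mulr_ge0 ?nrm_ge0 ?(ltW (hk0 k)).
have mm k : measurable_fun setT (fun xi : 'rV[R]_n => Num.min (2 : R) (nrm xi * harmonic k)).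
  apply: measurable_minr; first by mfun.
  by apply: measurable_funM; [exact: measurable_nrm|mfun].
have mN : measurable_fun setT N by exact: rint_measurable (Hft t).
have iw k : rint leb (fun xi => N xi * Num.min 2 (nrm xi * harmonic k)).
  apply: (rintM_bounded (c := 2)) => //; first exact: Hft.
  by move=> xi; rewrite ger0_norm// ge_min lexx.
have cw : w k @[k --> \oo] --> \int[leb]_xi (0 : R).
  apply: (Rint_dominated (g := fun xi => 2 * N xi)).
  - by move=> k; exact: rint_measurable (iw k).
  - by mfun.
  - move=> xi; rewrite -[X in _ --> X](mulr0 (N xi)); apply: cvgM; first exact: cvg_cst.
    apply: (@squeeze_cvgr _ _ _ _ (fun=> 0) (fun k => nrm xi * harmonic k)).
    + by apply: nearW => k; rewrite m0 ge_min lexx orbT.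
    + exact: cvg_cst.
    + rewrite -[X in _ --> X](mulr0 (nrm xi)); apply: cvgM; first exact: cvg_cst.
      exact: cvg_harmonic.
  - exact/rintZ/Hft.
  - move=> k xi; rewrite ger0_norm ?mulr_ge0// mulrC ler_wpM2r//.
    by rewrite ge_min lexx.
rewrite Rint0 in cw.
have e0' : 0 < e / ((2 * pi) ^+ n)^-1 by rewrite divr_gt0.
have /cvgrPdist_lt/(_ _ e0')[k _ hk] := cw.
have wk : ((2 * pi) ^+ n)^-1 * w k <= e.
  rewrite mulrC -ler_pdivlMr//; apply/ltW; apply: le_lt_trans (hk k (leqnn k)).
  by rewrite sub0r normrN; exact: ler_norm.
exists (harmonic k) => // y xy.
rewrite /fourier_inverse -mulrBr normrM (ger0_norm (ltW pin_gt0)).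
apply: le_trans wk; rewrite ler_wpM2l ?(ltW pin_gt0)//.
rewrite -RintB//; [|exact: iK|exact: iK].
have ib : rint leb (fun xi => K t xi x - K t xi y) by apply: rintB; exact: iK.
apply: (le_trans (Rint_norm ib)); apply: le_Rint => //; first exact: rint_norm.
move=> xi; case: (leP 2 (nrm xi * harmonic k)) => _; first exact: K_lip2.
apply: (le_trans (K_lip t xi x y)); apply: ler_wpM2l; first exact: normc_ge0.
by apply: (le_trans (norm_dotp_le _ _)); rewrite ler_wpM2l ?nrm_ge0.
Qed.

(* The law tilted by [exp <t,y>] and convolved with the centered normal law of
   standard deviation s. *)
Let cs s : R := ((Num.sqrt (2 * pi) * s) ^+ n)^-1.
Let q s t x := \int[mu]_y (expR (dotp t y) * (cs s * gau s^-1 (y - x))).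

Let cs_gt0 s : 0 < s -> 0 < cs s.
Proof. by move=> s0; rewrite invr_gt0 exprn_gt0// mulr_gt0// sqrt2pi_gt0. Qed.

Let q_ge0 s t x : 0 < s -> 0 <= q s t x.
Proof.
move=> s0; apply: Rint_ge0 => y; rewrite mulr_ge0 ?expR_ge0//.
by rewrite mulr_ge0 ?(ltW (cs_gt0 s0))// ltW// gau_gt0.
Qed.

(** A Gaussian is itself an integral of cosines against a Gaussian, so by Fubini smoothing by s
    damps the transform by [gau s]. *)
Let qE s t x : 0 < s ->
  q s t x = ((2 * pi) ^+ n)^-1 * \int[leb]_xi (K t xi x * gau s xi).
Proof.
move=> s0; pose F (z : 'rV[R]_n * 'rV[R]_n) :=
  gau s z.1 * expR (dotp t z.2) * cos (dotp z.1 z.2 - dotp z.1 x).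
have gi := @rint_gau R n s s0.
have Fi : rint (leb \x mu)%E F.
  apply: (rintM_bounded (c := 1)); first exact: (rint_prod gi (Hexp t)).
    by mfun.
  by move=> z; exact: cos_max.
have -> : \int[leb]_xi (K t xi x * gau s xi) = \int[leb]_xi \int[mu]_y F (xi, y).
  apply: eq_Rint => xi; rewrite mulrC KE -RintZ.
    by apply: eq_Rint => y; rewrite /F /= mulrA.
  by apply: rint_cos (Hexp t) _; have md := measurable_dotpr xi; mfun.
rewrite (Rint_fubini Fi) -RintZ; last first.
  apply: (rint_le (fun y => (\int[leb]_xi gau s xi) * expR (dotp t y))).
  - rewrite (_ : (fun _ => _) = fun y : 'rV[R]_n => expR (dotp t y) *
      ((Num.sqrt (2 * pi) / s) ^+ n * gau s^-1 (y - x))).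
      by have mg := @measurable_gau R n s^-1; mfun.
    apply/funext => y; rewrite -Rint_gau_cos// -RintZ.
      by apply: eq_Rint => xi; rewrite /F /= dotpBr; ring.
    by apply: rint_cos => //; mfun.
  - exact/rintZ/Hexp.
  move=> y; have i1 : rint leb (fun xi => F (xi, y)).
    rewrite /F /=; apply: rint_cos; last by mfun.
    by apply: eq_rint (rintZ (expR (dotp t y)) gi) => xi; rewrite mulrC.
  apply: (le_trans (Rint_norm i1)); rewrite -RintZr//; apply: le_Rint.
  - exact: rint_norm.
  - by apply: eq_rint (rintZ (expR (dotp t y)) gi) => xi; rewrite mulrC.
  move=> xi; rewrite /F /= normrM ger0_norm ?mulr_ge0 ?expR_ge0//.
  by rewrite ler_piMr ?cos_max// mulr_ge0 ?expR_ge0// ltW// gau_gt0.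
apply: eq_Rint => y.
have -> : \int[leb]_xi F (xi, y) =
    expR (dotp t y) * ((Num.sqrt (2 * pi) / s) ^+ n * gau s^-1 (y - x)).
  rewrite -Rint_gau_cos// -RintZ.
    by apply: eq_Rint => xi; rewrite /F /= dotpBr; ring.
  by apply: rint_cos => //; mfun.
rewrite [RHS]mulrCA; congr (_ * _); rewrite [RHS]mulrA; congr (_ * _).
rewrite /cs -!exprVn -exprMn; congr (_ ^+ _).
have w0 := @sqrt2pi_gt0 R; set w := Num.sqrt (2 * pi) in w0 *.
have -> : 2 * pi = w ^+ 2 by rewrite /w sqr_sqrtr// mulr_ge0// pi_ge0.
by field; rewrite !gt_eqF.
Qed.

(** Completing the square: tilting a Gaussian of variance s^2 moves its center by s^2 t. *)
Let q_tilt s t x : 0 < s ->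
  q s t x = expR (dotp t x + s ^+ 2 * dotp t t / 2) * q s 0 (x + s ^+ 2 *: t).
Proof.
move=> s0; have mg := @measurable_gau R n s^-1.
rewrite /q -RintZ; last first.
  apply: (rintM_bounded (c := cs s)); first exact: Hexp.
    by mfun.
  move=> y; rewrite ger0_norm ?mulr_ge0 ?(ltW (cs_gt0 s0)) ?(ltW (gau_gt0 _ _))//.
  by rewrite ler_piMr ?(ltW (cs_gt0 s0))// gau_le1.
apply: eq_Rint => y; rewrite dotp0l expR0 mul1r mulrCA [RHS]mulrCA; congr (_ * _).
rewrite /gau -!expRD; congr expR.
rewrite (_ : y - (x + _) = (y - x) - s ^+ 2 *: t); last by rewrite opprD addrA.
rewrite [dotp (y - x - _) _]dotp_sqrB !dotpZr dotpZl [dotp (y - x) t]dotpBl.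
rewrite (dotpC y t) (dotpC x t).
by field; rewrite gt_eqF.
Qed.

(** The evaluation point may move with k because [q_tilt] shifts it. Convergence is asked only after
    pairing with each xi, which is all that dominated convergence uses. *)
Let cvg_q t x (x_ : nat -> 'rV[R]_n) :
  (forall xi, dotp xi (x_ k - x) @[k --> \oo] --> (0 : R)) ->
  q (harmonic k) t (x_ k) @[k --> \oo] --> fourier_inverse t x.
Proof.
move=> cx; under eq_fun => k do rewrite qE ?harmonic_gt0'//.
apply: cvgM; first exact: cvg_cst.
have mg s := @measurable_gau R n s.
apply: (Rint_dominated (g := fun xi => normc (laplace_fourier t xi))).
- by move=> k; apply: measurable_funM => //; exact: mKx.
- exact: mKx.
- move=> xi; rewrite -[X in _ --> X]mulr1; apply: cvgM; last exact: cvg_gau_small.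
  rewrite (_ : (fun k => K t xi (x_ k)) =
    (fun k => (K t xi (x_ k) - K t xi x) + K t xi x)); last first.
    by apply/funext => k; rewrite subrK.
  rewrite -[X in _ --> X]add0r; apply: cvgD; last exact: cvg_cst.
  apply/norm_cvg0P; apply: (@squeeze_cvgr _ _ _ _ (fun=> 0)
    (fun k => normc (laplace_fourier t xi) * `|dotp xi (x_ k - x)|)).
  + by apply: nearW => k; rewrite normr_ge0 K_lip.
  + exact: cvg_cst.
  + rewrite -[X in _ --> X](mulr0 (normc (laplace_fourier t xi))).
    apply: cvgM; first exact: cvg_cst.
    by apply/norm_cvg0P.
- exact: Hft.
move=> k xi; rewrite normrM (ger0_norm (ltW (gau_gt0 _ _))).
by rewrite -[leRHS]mulr1 ler_pM ?gau_le1// ltW// gau_gt0.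
Qed.

Let cvg_q_cst t x : q (harmonic k) t x @[k --> \oo] --> fourier_inverse t x.
Proof. by apply: cvg_q => xi; rewrite subrr dotp0r; exact: cvg_cst. Qed.

Lemma fourier_inverse_ge0 t x : 0 <= fourier_inverse t x.
Proof.
rewrite -(cvg_lim _ (@cvg_q_cst t x))//; apply: limr_ge; first exact: cvgP (@cvg_q_cst t x).
by apply: nearW => k; apply: q_ge0; exact: harmonic_gt0'.
Qed.

Let cvg_harmonic_sqr (c : R) : harmonic k ^+ 2 * c @[k --> \oo] --> (0 : R).
Proof.
rewrite -[X in _ --> X](mul0r c); apply: cvgM; last exact: cvg_cst.
rewrite -[X in _ --> X](mulr0 0).
by apply: (@cvgM _ _ _ _ harmonic harmonic); exact: cvg_harmonic.
Qed.

(* The smoothed tilted law is an explicit multiple of a shift of the smoothed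
   law, and the shift disappears in the limit. *)
Lemma fourier_inverse_tilt t x :
  fourier_inverse t x = expR (dotp t x) * fourier_inverse 0 x.
Proof.
have c1 := @cvg_q_cst t x.
have c2 : q (harmonic k) t x @[k --> \oo] --> expR (dotp t x) * fourier_inverse 0 x.
  under eq_fun => k do rewrite q_tilt ?harmonic_gt0'//.
  apply: cvgM.
    apply: (continuous_cvg _ (@continuous_expR R _)).
    rewrite -[X in _ --> X]addr0; apply: cvgD; first exact: cvg_cst.
    by under eq_fun => k do rewrite -mulrA; exact: cvg_harmonic_sqr.
  apply: cvg_q => xi; under eq_fun => k do rewrite addrAC subrr add0r dotpZr.
  exact: cvg_harmonic_sqr.
exact: (cvg_unique _ c1 c2).
Qed.

Let B := ((2 * pi) ^+ n)^-1 * \int[leb]_xi normc (laplace_fourier 0 xi).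

Let q_le s x : 0 < s -> q s 0 x <= B.
Proof.
move=> s0; rewrite qE// ler_wpM2l ?(ltW pin_gt0)//.
have le xi : `|K 0 xi x * gau s xi| <= normc (laplace_fourier 0 xi).
  rewrite normrM (ger0_norm (ltW (gau_gt0 _ _))).
  by rewrite -[leRHS]mulr1 ler_pM ?gau_le1// ltW// gau_gt0.
have i : rint leb (fun xi => K 0 xi x * gau s xi).
  apply: (rint_le _ _ (Hft 0) le).
  by apply: measurable_funM; [exact: mKx|exact: measurable_gau].
apply: le_Rint => // xi; apply: le_trans (le xi); exact: ler_norm.
Qed.

Lemma fourier_inverse_bounded x : fourier_inverse 0 x <= B.
Proof.
rewrite -(cvg_lim _ (@cvg_q_cst 0 x))//; apply: limr_le; first exact: cvgP (@cvg_q_cst 0 x).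
by apply: nearW => k; apply: q_le; exact: harmonic_gt0'.
Qed.

Let mq s : 0 < s -> measurable_fun setT (q s 0).
Proof.
move=> s0; rewrite /q; apply: (@measurable_Rint2 _ _ _ _ R mu
  (fun z : 'rV[R]_n * 'rV[R]_n =>
     expR (dotp 0 z.2) * (cs s * gau s^-1 (z.2 - z.1)))).
  by have mg := @measurable_gau R n s^-1; mfun.
move=> z; rewrite mulr_ge0 ?expR_ge0// mulr_ge0 ?(ltW (gau_gt0 _ _))//.
exact/ltW/cs_gt0.
Qed.

Let p := fourier_inverse 0.

Let mp : measurable_fun setT p. Proof. exact: measurable_fourier_inverse. Qed.

Let p_norm x : `|p x| <= B.
Proof. by rewrite ger0_norm ?fourier_inverse_bounded// fourier_inverse_ge0. Qed.

Section test_function.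
Variables (u : 'rV[R]_n -> R) (L : R).
Hypotheses (u01 : forall x, 0 <= u x <= 1) (ui : rint leb u).
Hypothesis u_lip : forall x y, `|u x - u y| <= L * nrm (x - y).

Let u0 x : 0 <= u x. Proof. by have /andP[] := u01 x. Qed.
Let u1 x : u x <= 1. Proof. by have /andP[] := u01 x. Qed.
Let mu' : measurable_fun setT u. Proof. exact: rint_measurable ui. Qed.
Let c1 : R := (Num.sqrt (2 * pi) ^+ n)^-1.
Let c1_gt0 : 0 < c1. Proof. by rewrite invr_gt0 exprn_gt0// sqrt2pi_gt0. Qed.
(** The integrand of the expectation of u(y + s z) with z standard normal and independent of y; in
    this form s may tend to 0, and be 0. *)
Let F s (z : 'rV[R]_n * 'rV[R]_n) := u (s *: z.2 + z.1) * (c1 * gau 1 z.2).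
Let Gi : rint (mu \x leb)%E (fun z => 1 * (c1 * gau 1 z.2)).
Proof. exact: (rint_prod (rint_cst mu 1) (rintZ c1 (@rint_gau R n 1 ltr01))). Qed.

Let Fi s : rint (mu \x leb)%E (F s).
Proof.
apply: (rint_le _ _ Gi).
  by have mg := @measurable_gau R n 1; rewrite /F; mfun.
move=> z; rewrite mul1r /F; have g0 := ltW (gau_gt0 1 z.2).
have cg : 0 <= c1 * gau 1 z.2 by rewrite mulr_ge0// ltW.
by rewrite ger0_norm; [exact: ler_piMl|exact: mulr_ge0].
Qed.

Let smoothed s : 0 < s ->
  \int[leb]_x (u x * q s 0 x) = \int[(mu \x leb)%E]_z F s z.
Proof.
move=> s0; have s'0 : 0 < s^-1 by rewrite invr_gt0.
have mg := @measurable_gau R n s^-1.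
pose H (z : 'rV[R]_n * 'rV[R]_n) := u z.1 * (cs s * gau s^-1 (z.2 - z.1)).
have Hi : rint (leb \x mu)%E H.
  apply: (rint_le (fun z => (cs s * u z.1) * 1)); first by rewrite /H; mfun.
    exact: (rint_prod (rintZ (cs s) ui) (rint_cst mu 1)).
  move=> z; rewrite /H mulr1 mulrCA ger0_norm.
    by rewrite ler_wpM2l ?(ltW (cs_gt0 s0))// ler_piMr// gau_le1.
  by rewrite !mulr_ge0 ?(ltW (cs_gt0 s0)) ?(ltW (gau_gt0 _ _)).
have -> : \int[leb]_x (u x * q s 0 x) = \int[leb]_x \int[mu]_y H (x, y).
  apply: eq_Rint => x; rewrite -RintZ.
    by apply: eq_Rint => y; rewrite /H dotp0l expR0 mul1r.
  apply: (@rint_bounded _ _ _ mu _ (cs s)); first by mfun.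
  move=> y; rewrite dotp0l expR0 mul1r ger0_norm.
    by rewrite ler_piMr ?gau_le1// ltW// cs_gt0.
  by rewrite mulr_ge0 ?(ltW (cs_gt0 s0)) ?(ltW (gau_gt0 _ _)).
rewrite (Rint_fubini Hi) (Rint_fubini1 (Fi s)); apply: eq_Rint => y.
have iy : rint leb (fun x => H (x, y)).
  apply: (rint_le (fun x => cs s * u x)); first by rewrite /H /=; mfun.
    exact: rintZ.
  move=> x; rewrite /H mulrCA ger0_norm.
    by rewrite ler_wpM2l ?(ltW (cs_gt0 s0))// ler_piMr// gau_le1.
  by rewrite !mulr_ge0 ?(ltW (cs_gt0 s0)) ?(ltW (gau_gt0 _ _)).
rewrite (Rint_row_affine y s0 iy) -RintZ.
  apply: eq_Rint => z; rewrite /H /F /= mulrCA; congr (_ * _).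
  rewrite opprD addrCA subrr addr0 gauN gauZ mulVf ?gt_eqF// mulrA; congr (_ * _).
  by rewrite /cs /c1 -!exprVn -exprMn; congr (_ ^+ _); rewrite invfM mulrCA mulfV ?mulr1 ?gt_eqF.
exact: (proj2 (rint_row_affine y s0 (rint_measurable iy)) iy).
Qed.

(** Both sides are the limit of the integrals of u against the smoothed law: one by bounded
    convergence of the smoothed densities, the other by the substitution x = y + s z and the
    Lipschitz bound on u. *)
Lemma fourier_inverse_test : \int[leb]_x (u x * p x) = \int[mu]_x u x.
Proof.
have h1 : \int[leb]_x (u x * q (harmonic k) 0 x) @[k --> \oo] --> \int[leb]_x (u x * p x).
  apply: (Rint_dominated (g := fun x => B * u x)).
  - by move=> k; apply: measurable_funM => //; apply: mq; exact: harmonic_gt0'.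
  - by mfun.
  - by move=> x; apply: cvgM; [exact: cvg_cst|exact: cvg_q_cst].
  - exact: rintZ.
  - move=> k x; have k0 := @harmonic_gt0' R k.
    rewrite ger0_norm ?mulr_ge0 ?q_ge0// mulrC ler_wpM2r//; exact: q_le.
have h2 : \int[leb]_x (u x * q (harmonic k) 0 x) @[k --> \oo] -->
    \int[(mu \x leb)%E]_z F 0 z.
  under eq_fun => k do rewrite smoothed ?harmonic_gt0'//.
  apply: (Rint_dominated (g := fun z => 1 * (c1 * gau 1 z.2))).
  - by move=> k; exact: rint_measurable (Fi _).
  - exact: rint_measurable (Fi _).
  - move=> z; apply: cvgM; last exact: cvg_cst.
    rewrite scale0r add0r.
    rewrite (_ : (fun k => u (harmonic k *: z.2 + z.1)) =
      (fun k => (u (harmonic k *: z.2 + z.1) - u z.1) + u z.1)); last first.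
      by apply/funext => k; rewrite subrK.
    rewrite -[X in _ --> X]add0r; apply: cvgD; last exact: cvg_cst.
    apply/norm_cvg0P; apply: (@squeeze_cvgr _ _ _ _ (fun=> 0)
      (fun k => (L * nrm z.2) * harmonic k)).
    + apply: nearW => k; rewrite normr_ge0; apply: (le_trans (u_lip _ _)).
      rewrite addrK nrmZ ger0_norm ?(ltW (@harmonic_gt0' R k))//.
      by rewrite le_eqVlt; apply/orP; left; apply/eqP; ring.
    + exact: cvg_cst.
    + rewrite -[X in _ --> X](mulr0 (L * nrm z.2)); apply: cvgM; first exact: cvg_cst.
      exact: cvg_harmonic.
  - exact: Gi.
  - move=> k z; rewrite mul1r /F; have g0 := ltW (gau_gt0 1 z.2).
    have cg : 0 <= c1 * gau 1 z.2 by rewrite mulr_ge0// ltW.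
    by rewrite ger0_norm; [exact: ler_piMl|exact: mulr_ge0].
rewrite (cvg_unique _ h1 h2)// (Rint_fubini1 (Fi 0)); apply: eq_Rint => y.
have gi := @rint_gau R n 1 ltr01.
have -> : \int[leb]_z F 0 (y, z) = \int[leb]_z (u y * (c1 * gau 1 z)).
  by apply: eq_Rint => z; rewrite /F /= scale0r add0r.
rewrite RintZ; last exact: rintZ.
rewrite RintZ// Rint_gau// divr1 mulVf ?mulr1// gt_eqF// exprn_gt0//.
exact: sqrt2pi_gt0.
Qed.

End test_function.

(** Two measures agreeing on closed boxes are equal. The indicator of a box is a limit of tents,
    dominated under Lebesgue measure by the indicator of a bounded open box and under [mu] by the
    constant 1. *)
Lemma fourier_inverse_density A : measurable A ->
  mu A = (\int[leb]_(x in A) (fourier_inverse 0 x)%:E)%E.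
Proof.
move=> mA; rewrite -(density_measureE mp (fourier_inverse_ge0 0)).
apply: measure_cbox_unique mA => a b; last first.
  by apply: le_lt_trans (probability_le1 mu (measurable_cbox a b)) _; rewrite ltry.
have mb := measurable_cbox a b.
have r0 : 0 < 2 + nrm a + nrm b by rewrite -addrA ltr_wpDr ?addr_ge0 ?nrm_ge0.
have [bi _] := Rint_indic_open_box (0 : 'rV[R]_n) r0.
have h1 : \int[leb]_x (tent j a b x * p x) @[j --> \oo] -->
    \int[leb]_x (\1_(cbox a b) x * p x).
  apply: (Rint_dominated (g := fun x => B * \1_(open_box 0 (2 + nrm a + nrm b)) x)).
  - by move=> j; apply: measurable_funM => //; exact: measurable_tent.
  - by apply: measurable_funM.
  - by move=> x; apply: cvgM; [exact: cvg_tent|exact: cvg_cst].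
  - exact: rintZ.
  - move=> j x; have /andP[t0 t1] := tent01 j a b x.
    rewrite normrM (ger0_norm t0) mulrC; apply: ler_pM => //; exact: tent_supp.
have h2 : \int[leb]_x (tent j a b x * p x) @[j --> \oo] -->
    \int[mu]_x (\1_(cbox a b) x).
  under eq_fun => j do rewrite (fourier_inverse_test (tent01 j a b) (rint_tent j a b)
    (tent_lip j a b)).
  apply: (Rint_dominated (g := fun=> 1)).
  - by move=> j; exact: measurable_tent.
  - by [].
  - by move=> x; exact: cvg_tent.
  - exact: rint_cst.
  - by move=> j x; have /andP[t0 t1] := tent01 j a b x; rewrite ger0_norm.
have E := cvg_unique _ h1 h2.
have i1 : rint leb (fun x => \1_(cbox a b) x * p x).
  apply: (rint_le (fun x => B * \1_(open_box 0 (2 + nrm a + nrm b)) x)).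
  - by apply: measurable_funM.
  - exact: rintZ.
  move=> x; rewrite normrM mulrC; apply: ler_pM => //.
  rewrite ger0_norm// [leLHS]indicE; have [bx|nbx] := pselect (cbox a b x).
    rewrite mem_set//; apply: le_trans (tent_supp 0 a b x).
    by rewrite /tent (proj2 (box_dist_eq0 a b x) bx) mulr0 subr0 le_max lexx orbT.
  by rewrite memNset.
have i2 : rint mu (\1_(cbox a b) : 'rV[R]_n -> R).
  by apply: (@rint_bounded _ _ _ mu _ 1) => // x; rewrite ger0_norm// indicE; case: (_ \in _).
rewrite density_measureE integral_mkcond.
rewrite (_ : integral _ _ _ = (\int[leb]_x (\1_(cbox a b) x * p x)%:E)%E); last first.
  apply: eq_integral => x _; rewrite patchE indicE.
  by case: ifPn => _; rewrite ?mul1r ?mul0r.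
rewrite -(Rint_EFin i1) E//.
have -> : (\int[mu]_x \1_(cbox a b) x)%:E = (\int[mu]_x (\1_(cbox a b) x)%:E)%E by exact: (Rint_EFin i2).
by rewrite integral_indic// setIT.
Qed.

End fourier_inversion.

(** * Sums of independent vectors *)

Section sums_of_iid.
Context dsp (T : measurableType dsp) (R : realType) (P : probability T R) (n : nat).
Variable X : nat -> {RV P >-> 'rV[R]_n}.
Hypothesis X_iid : iid X.

Definition partial_sum (k : nat) (w : T) : 'rV[R]_n := \sum_(1 <= i < k.+1) X i w.

Lemma measurable_partial_sum k : measurable_fun setT (partial_sum k).
Proof.
apply/measurable_fun_rowP => j.
rewrite (_ : (fun _ => _) = fun w => \sum_(1 <= i < k.+1) X i w 0 j); last first.
  by apply/funext => w; rewrite summxE.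
by apply: measurable_sum => i; exact: (measurableT_comp (measurable_coord j)).
Qed.

HB.instance Definition _ k := @isMeasurableFun.Build _ _ _ _
  (partial_sum k) (measurable_partial_sum k).

Let S k : {RV P >-> 'rV[R]_n} := partial_sum k.

Let SS k w : S k.+1 w = S k w + X k.+1 w.
Proof. by rewrite /S /= /partial_sum big_nat_recr. Qed.

Let law k := distribution P (S k).
Let lawX k := distribution P (X k).

Let joint k w := (S k w, X k.+1 w).

Let add (z : 'rV[R]_n * 'rV[R]_n) : 'rV[R]_n := z.1 + z.2.

Let madd : measurable_fun setT add.
Proof. by rewrite /add; mfun. Qed.

Let mjoint k : measurable_fun setT (joint k).
Proof. by apply: measurable_pair. Qed.

Let mpre d1 d2 (T1 : measurableType d1) (T2 : measurableType d2) (f : T1 -> T2) A :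
  measurable_fun setT f -> measurable A -> measurable (f @^-1` A).
Proof. by move=> mf mA; rewrite -[X in measurable X]setTI; exact: mf. Qed.

(* [P (_ `&` E) / P E] is a measure that obeys the product rule on rectangles. *)
Let joint_law k E D : measurable E -> measurable D ->
  (forall B C, measurable B -> measurable C ->
     P (S k @^-1` B `&` X k.+1 @^-1` C `&` E) = (law k B * lawX k.+1 C * P E)%E) ->
  P (joint k @^-1` D `&` E) = ((law k \x lawX k.+1) D * P E)%E.
Proof.
move=> mE mD h.
have mDE : measurable (joint k @^-1` D) by exact: mpre.
have PEf : P E \is a fin_num by exact: fin_num_measure.
have [PE0|PE0] := eqVneq (P E) 0%E.
  rewrite PE0 mule0; apply: le_anti; rewrite measure_ge0 andbT -PE0.
  by apply: le_measure; rewrite ?inE//; exact: measurableI.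
have [e ePE] : exists e : R, P E = e%:E by exists (fine (P E)); rewrite fineK.
have e0 : 0 < e.
  by rewrite -lte_fin -ePE lt_neqAle eq_sym PE0 measure_ge0.
have e1 : 0 <= e^-1 by rewrite invr_ge0 ltW.
pose m' := pushm (mscale (NngNum e1) (mrestr P mE)) (mjoint k).
have m'E A : m' A = (e^-1%:E * P (joint k @^-1` A `&` E))%E by [].
rewrite (@product_measure_unique _ _ _ _ R (law k) (lawX k.+1) m' _ _ mD).
  rewrite m'E ePE muleAC -EFinM mulVf ?mul1e// gt_eqF//.
move=> B C mB mC; rewrite m'E.
have -> : joint k @^-1` (B `*` C) = S k @^-1` B `&` X k.+1 @^-1` C by [].
rewrite h// ePE [(_ * e%:E)%E]muleC muleA -EFinM mulVf ?mul1e// gt_eqF//.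
Qed.

(** The event on later vectors stays arbitrary during the induction. Adding index k+1 to J and using
    the induction hypothesis gives the product rule on rectangles for the pair (S_k, X_(k+1));
    [joint_law] extends it to the event that their sum lies in B. *)
Let sum_indep k (J : {fset nat}) (A : nat -> set 'rV[R]_n) B :
  (forall j, j \in J -> (k < j)%N) -> (forall j, j \in J -> measurable (A j)) ->
  measurable B ->
  P (S k @^-1` B `&` \bigcap_(j in [set` J]) (X j @^-1` A j)) =
  (law k B * P (\bigcap_(j in [set` J]) (X j @^-1` A j)))%E.
Proof.
have mbig (I : {fset nat}) (A' : nat -> set 'rV[R]_n) :
    (forall j, j \in I -> measurable (A' j)) ->
    measurable (\bigcap_(j in [set` I]) (X j @^-1` A' j)).
  move=> mA'; apply: fin_bigcap_measurable => // j jI.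
  by apply: mpre => //; exact: mA'.
elim: k J A B => [|k IH] J A B Jk mA mB.
  have E w : S 0 w = 0 by rewrite /S /= /partial_sum big_geq.
  have [B0|B0] := pselect (B 0).
    have -> : law 0 B = P setT.
      rewrite /law /distribution /pushforward; congr (P _).
      by apply/seteqP; split=> w //= _; rewrite -/(S 0 w) E.
    rewrite probability_setT mul1e; congr (P _).
    by apply/seteqP; split=> w /=; [case|move=> h; split=> //; rewrite -/(S 0 w) E].
  have -> : law 0 B = P set0.
    rewrite /law /distribution /pushforward; congr (P _).
    by apply/seteqP; split=> w //=; rewrite -/(S 0 w) E.
  rewrite measure0 mul0e -(measure0 P); congr (P _).
  by apply/seteqP; split=> w //= -[]; rewrite -/(S 0 w) E.
set E := \bigcap_(j in _) _.
have mE : measurable E by exact: mbig.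
have hrect (I : {fset nat}) (A' : nat -> set 'rV[R]_n) :
    (forall j, j \in I -> (k.+1 < j)%N) -> (forall j, j \in I -> measurable (A' j)) ->
    forall B' C, measurable B' -> measurable C ->
    P (S k @^-1` B' `&` X k.+1 @^-1` C `&` \bigcap_(j in [set` I]) (X j @^-1` A' j)) =
    (law k B' * lawX k.+1 C * P (\bigcap_(j in [set` I]) (X j @^-1` A' j)))%E.
  move=> Ik mA' B' C mB' mC.
  pose A2 j := if j == k.+1 then C else A' j.
  have kI : k.+1 \notin I by apply/negP => /Ik; rewrite ltnn.
  have mA2 j : j \in (k.+1 |` I)%fset -> measurable (A2 j).
    by rewrite /A2 in_fset1U; case: eqP => //= _; exact: mA'.
  have A2I j : j \in I -> A2 j = A' j.
    by rewrite /A2; case: eqP => // ->; rewrite (negbTE kI).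
  have EC : \bigcap_(j in [set` (k.+1 |` I)%fset]) (X j @^-1` A2 j) =
      X k.+1 @^-1` C `&` \bigcap_(j in [set` I]) (X j @^-1` A' j).
    apply/seteqP; split=> w.
      move=> h; split.
        by have := h k.+1; rewrite /= /A2 eqxx; apply; rewrite /= in_fset1U eqxx.
      by move=> j jI; have := h j; rewrite /= A2I//; apply; rewrite /= in_fset1U jI orbT.
    move=> [h1 h2] j /=; rewrite in_fset1U; case: eqP => [->|_ /=]; first by rewrite /A2 eqxx.
    by move=> jI; rewrite A2I//; exact: h2.
  rewrite -setIA -EC IH//; last first.
    by move=> j; rewrite in_fset1U => /orP[/eqP ->//|/Ik]; exact: ltn_trans.
  rewrite (proj1 X_iid)// big_fsetU1//= [A2 k.+1]/A2 eqxx -muleA; congr (_ * _)%E.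
  rewrite (proj1 X_iid)//; congr (_ * _)%E.
  by rewrite big_seq [RHS]big_seq; apply: eq_bigr => j jI; rewrite A2I.
have mB' : measurable (add @^-1` B) by exact: mpre.
have SE : S k.+1 @^-1` B = joint k @^-1` (add @^-1` B).
  by apply/seteqP; split=> w /=; rewrite -/(S k.+1 w) SS.
rewrite SE (joint_law mE mB')//; last exact: hrect.
congr (_ * _)%E.
have h0 := @joint_law k setT _ measurableT mB'.
rewrite setIT probability_setT mule1 in h0.
rewrite -h0.
  by rewrite -SE.
move=> B' C mB2 mC.
have := hrect fset0 A (fun _ => ltac:(by [])) (fun _ => ltac:(by [])) B' C mB2 mC.
by rewrite set_fset0 bigcap_set0 probability_setT.
Qed.

Let law_succ k D : measurable D ->
  law k.+1 D = (law k \x lawX k.+1)%E (add @^-1` D).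
Proof.
move=> mD; have mB' : measurable (add @^-1` D) by exact: mpre.
have SE : S k.+1 @^-1` D = joint k @^-1` (add @^-1` D).
  by apply/seteqP; split=> w /=; rewrite -/(S k.+1 w) SS.
have := @joint_law k setT _ measurableT mB'; rewrite setIT probability_setT mule1 => <-.
  by rewrite -SE.
move=> B C mB mC; rewrite setIT mule1.
have := @sum_indep k [fset k.+1]%fset (fun=> C) B.
have -> : \bigcap_(j in [set` [fset k.+1]%fset]) (X j @^-1` C) = X k.+1 @^-1` C.
  by rewrite set_fset1 bigcap_set1.
by apply=> // j; rewrite in_fset1 => /eqP ->.
Qed.

Hypothesis Hexp : forall t, rint (lawX 0) (fun y => expR (dotp t y)).

Let mexp (t : 'rV[R]_n) : measurable_fun setT (fun y => expR (dotp t y)).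
Proof. by mfun. Qed.

Let lawX0 k A : measurable A -> lawX k A = lawX 0 (id @^-1` A).
Proof. by move=> mA; exact: (proj2 X_iid). Qed.

Let HexpX k t : rint (lawX k) (fun y => expR (dotp t y)).
Proof. exact/(rint_image (@measurable_id _ _ _) (lawX0 k) (mexp t)). Qed.

Let laplaceX k t xi : laplace_fourier (lawX k) t xi = laplace_fourier (lawX 0) t xi.
Proof.
exact: (osc_image (@measurable_id _ _ _) (lawX0 k) (mexp t) (measurable_dotpr xi)).
Qed.

Let law_sum k t : rint (law k) (fun y => expR (dotp t y)) /\
  forall xi, laplace_fourier (law k) t xi = laplace_fourier (lawX 0) t xi ^+ k.
Proof.
elim: k => [|k [IHi IH]].
  have lE A : measurable A -> law 0 A = P ((fun=> 0) @^-1` A).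
    move=> _; rewrite /law /distribution /pushforward; congr (P _).
    have E w : S 0 w = 0 by rewrite /S /= /partial_sum big_geq.
    by apply/seteqP; split=> w /=; rewrite -/(S 0 w) E.
  have m0 : measurable_fun setT (fun _ : T => 0 : 'rV[R]_n) by exact: measurable_cst.
  split.
    apply/(rint_image m0 lE (mexp t)); exact: rint_cst.
  move=> xi; rewrite /laplace_fourier (osc_image m0 lE (mexp t) (measurable_dotpr xi)).
  under [X in osc _ _ X]funext => w do rewrite dotp0r.
  by rewrite osc0 Rint_cst dotp0r expR0.
have ip := rint_prod IHi (HexpX k.+1 t).
have E : (fun z => expR (dotp t (add z))) = (fun z => expR (dotp t z.1) * expR (dotp t z.2)).
  by apply/funext => z; rewrite dotpDr expRD.
split.
  by apply/(rint_image madd (law_succ k) (mexp t)); rewrite E.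
move=> xi; rewrite exprSr -IH -(laplaceX k.+1).
rewrite {1}/laplace_fourier (osc_image madd (law_succ k) (mexp t) (measurable_dotpr xi)) E.
rewrite -(osc_prod IHi (HexpX k.+1 t) (measurable_dotpr xi) (measurable_dotpr xi)).
by congr osc; apply/funext => z; rewrite dotpDr.
Qed.

Let Z k := distribution P (normalized_sum X k).

Let mZ k : measurable_fun setT (fun y : 'rV[R]_n => (Num.sqrt k%:R)^-1 *: y).
Proof. by mfun. Qed.

Lemma rint_normalized_sum_expR k t : rint (Z k) (fun y => expR (dotp t y)).
Proof.
have E A : measurable A -> Z k A = law k ((fun y => (Num.sqrt k%:R)^-1 *: y) @^-1` A) by [].
apply/(rint_image (mZ k) E (mexp t)).
by apply: eq_rint (proj1 (law_sum k ((Num.sqrt k%:R)^-1 *: t))) => x; rewrite dotpZl dotpZr.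
Qed.

Lemma laplace_normalized_sum k t xi : laplace_fourier (Z k) t xi =
  laplace_fourier (lawX 0) ((Num.sqrt k%:R)^-1 *: t) ((Num.sqrt k%:R)^-1 *: xi) ^+ k.
Proof.
have E A : measurable A -> Z k A = law k ((fun y => (Num.sqrt k%:R)^-1 *: y) @^-1` A) by [].
rewrite -(proj2 (law_sum k _)) {1}/laplace_fourier.
rewrite (osc_image (mZ k) E (mexp t) (measurable_dotpr xi)).
by apply: eq_osc => x; rewrite dotpZl dotpZr.
Qed.

End sums_of_iid.

(** * Integration against a measure with a density *)

Section density_integrals.
Context d (T : measurableType d) (R : realType).
Variables (m nu : {measure set T -> \bar R}) (p : T -> R).
Hypotheses (mp : measurable_fun setT p) (p0 : forall x, 0 <= p x).
Hypothesis nuE : forall A, measurable A -> nu A = (\int[m]_(x in A) (p x)%:E)%E.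

Import HBNNSimple.

(** Both sides are additive over the finitely many values of h, and on one level set the claim is
    [nuE]. *)
Let simple_density (h : {nnsfun T >-> R}) :
  (\int[m]_x ((h x)%:E * (p x)%:E) = \int[nu]_x (h x)%:E)%E.
Proof.
have indich r : measurable_fun setT (fun x => (r * \1_(h @^-1` [set r]) x)%:E).
  by apply/measurable_EFinP; exact: measurable_funM.
have mpE : measurable_fun setT (fun x => (p x)%:E) by exact/measurable_EFinP.
have -> : (\int[nu]_x (h x)%:E =
    \int[nu]_x (\sum_(y \in range h) (y * \1_(h @^-1` [set y]) x)%:E))%E.
  by apply: eq_integral => t _; rewrite /= fimfunE -fsumEFin.
rewrite ge0_integral_fsum//; last by move=> y x _; exact: nnfun_muleindic_ge0.
transitivity (\int[m]_x (\sum_(y \in range h)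
    (y * \1_(h @^-1` [set y]) x)%:E * (p x)%:E))%E.
  under [RHS]eq_integral => x _.
    rewrite -ge0_mule_fsuml => [|y]; last exact: nnfun_muleindic_ge0.
    rewrite fsumEFin // -(fimfunE _ x); over.
  by [].
rewrite ge0_integral_fsum//; last 2 first.
  - by move=> y; exact: emeasurable_funM.
  - move=> y x _; apply: mule_ge0; first exact: nnfun_muleindic_ge0.
    by rewrite lee_fin.
apply: eq_fsbigr => r rhn.
under [RHS]eq_integral do rewrite EFinM.
rewrite integralZl_indic_nnsfun//.
under eq_integral do rewrite EFinM -muleA.
rewrite ge0_integralZl//.
- under eq_integral do rewrite muleC.
  rewrite (eq_integral ((fun x => (p x)%:E) \_ (h @^-1` [set r]))); last first.
    by move=> x _; rewrite epatch_indic.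
  by rewrite -integral_mkcondr setTI -nuE// integral_indic// setIT.
- by apply: emeasurable_funM => //; exact/measurable_EFinP.
- by move=> t _; rewrite mule_ge0 ?lee_fin.
- by move: rhn; rewrite inE => -[t _ <-]; rewrite lee_fin.
Qed.

Let emcvg (f : T -> \bar R) : measurable_fun setT f -> (forall x, 0 <= f x)%E ->
  (\int[nu]_x f x = \int[m]_x (f x * (p x)%:E))%E.
Proof.
move=> mf f0; pose h := nnsfun_approx measurableT mf.
have fh x : (EFin \o h n) x @[n --> \oo] --> f x by exact: cvg_nnsfun_approx.
have nd x : nondecreasing_seq (fun n => (h n x)%:E).
  by move=> a b ab; rewrite lee_fin; exact/lefP/nd_nnsfun_approx.
have h1 : (\int[nu]_x f x = lim (\int[nu]_x (EFin \o h n) x @[n --> \oo]))%E.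
  under eq_integral => x _ do rewrite -(cvg_lim _ (fh x))//.
  apply: monotone_convergence => //.
  - by move=> n; apply/measurable_EFinP/measurable_funP.
  - by move=> n x _ /=; rewrite lee_fin.
  - by move=> x _; exact: nd.
have h2 : (\int[m]_x (f x * (p x)%:E) =
    lim (\int[m]_x ((h n x)%:E * (p x)%:E) @[n --> \oo]))%E.
  have fg x : ((h n x)%:E * (p x)%:E)%E @[n --> \oo] --> (f x * (p x)%:E)%E.
    by apply: cvgeZr => //; exact: fh.
  under eq_integral => x _ do rewrite -(cvg_lim _ (fg x))//.
  apply: monotone_convergence => //.
  - by move=> n; apply: emeasurable_funM; apply/measurable_EFinP.
  - by move=> n x _ /=; rewrite mule_ge0 ?lee_fin.
  - by move=> x _ a b ab/=; rewrite lee_wpmul2r ?lee_fin//; exact: nd.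
by rewrite h1 h2; under [in RHS]eq_fun do rewrite simple_density.
Qed.

Let absE (f : T -> R) : measurable_fun setT f ->
  (\int[nu]_x `|(f x)%:E| = \int[m]_x `|(f x * p x)%:E|)%E.
Proof.
move=> mf; rewrite emcvg; last 2 first.
- by apply/measurable_EFinP; mfun.
- by [].
by apply: eq_integral => x _ /=; rewrite normrM (ger0_norm (p0 x)).
Qed.

Lemma rint_density (f : T -> R) : measurable_fun setT f ->
  rint nu f <-> rint m (fun x => f x * p x).
Proof.
move=> mf; have E := absE mf; rewrite /rint.
split=> /integrableP[_ h]; apply/integrableP; split.
- by apply/measurable_EFinP; mfun.
- exact: etrans (congr1 (fun z => z < +oo)%E (esym E)) h.
- exact/measurable_EFinP.
- exact: etrans (congr1 (fun z => z < +oo)%E E) h.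
Qed.

Lemma Rint_density (f : T -> R) : measurable_fun setT f ->
  \int[nu]_x f x = \int[m]_x (f x * p x).
Proof.
move=> mf; rewrite /Rintegral; congr fine.
have mf' : measurable_fun setT (fun y => (f y)%:E) by exact/measurable_EFinP.
rewrite integralE [RHS]integralE.
rewrite (emcvg (measurable_funepos mf') (funepos_ge0 _)).
rewrite (emcvg (measurable_funeneg mf') (funeneg_ge0 _)); congr (_ - _)%E.
  apply: eq_integral => x _; rewrite !funeposE -EFin_max -EFinM -EFin_max.
  by rewrite maxr_pMl// mul0r.
apply: eq_integral => x _; rewrite !funenegE -!EFinN -!EFin_max -EFinM.
by rewrite maxr_pMl// mul0r mulNr.
Qed.

End density_integrals.

(** * Exponential moments and continuity of the moment generating function *)

Section exponential_moments.
Context {R : realType} {n : nat}.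
Variable mu : probability 'rV[R]_n R.
Implicit Types (t x : 'rV[R]_n) (s : R).
Hypothesis Hexp : forall t, rint mu (fun y => expR (dotp t y)).

(* Some coordinate satisfies [nrm x <= n |x_i|]; the leading 1 is for n = 0. *)
Lemma expR_nrm_le x s : 0 <= s -> expR (s * nrm x) <= 1 +
  \sum_(i < n) (expR (dotp ((s * n%:R) *: delta_mx 0 i) x) +
                expR (dotp ((- (s * n%:R)) *: delta_mx 0 i) x)).
Proof.
move=> s0.
have dE c i : dotp (c *: delta_mx 0 i) x = c * x 0 i.
  rewrite dotpZl; congr (_ * _); rewrite /dotp (bigD1 i)//= mxE !eqxx mul1r.
  by rewrite big1 ?addr0// => j ji; rewrite mxE eqxx (negbTE ji) mul0r.
have pos i : 0 <= expR (dotp ((s * n%:R) *: delta_mx 0 i) x) +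
                expR (dotp ((- (s * n%:R)) *: delta_mx 0 i) x).
  by rewrite addr_ge0 ?expR_ge0.
have [[i hi]|hn] := pselect (exists i, nrm x <= n%:R * `|x 0 i|).
  rewrite (bigD1 i)//= addrCA; apply: ler_wpDr.
    by rewrite addr_ge0// sumr_ge0.
  rewrite !dE mulNr; apply: (@le_trans _ _ (expR (s * n%:R * `|x 0 i|))).
    by rewrite ler_expR -mulrA ler_wpM2l.
  case: (ger0P (x 0 i)) => _; first by rewrite lerDl expR_ge0.
  by rewrite mulrN lerDr expR_ge0.
suff -> : nrm x = 0 by rewrite mulr0 expR0 lerDl sumr_ge0.
apply/eqP; rewrite eq_le nrm_ge0 andbT leNgt; apply/negP => x0.
have n0 : (0 < n)%N.
  rewrite lt0n; apply/negP => /eqP n0; move: x0; rewrite /nrm big1 ?ltxx// => i _.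
  by have := ltn_ord i; rewrite [X in (_ < X)%N]n0.
have n0' : 0 < n%:R :> R by rewrite ltr0n.
suff : nrm x < nrm x by rewrite ltxx.
rewrite {1}/nrm; apply: (@lt_le_trans _ _ (\sum_(i < n) (nrm x / n%:R))).
  apply: ltr_sum => [|i _].
    by apply/hasP; exists (Ordinal n0) => //; rewrite mem_index_enum.
  rewrite ltr_pdivlMr// mulrC ltNge; apply/negP => h; apply: hn; by exists i.
by rewrite sumr_const card_ord -[leLHS]mulr_natr divfK// gt_eqF.
Qed.

Lemma rint_expR_nrm s : rint mu (fun x => expR (s * nrm x)).
Proof.
have mn := @measurable_nrm R n.
have h : rint mu (fun x => 1 +
  \sum_(i < n) (expR (dotp ((`|s| * n%:R) *: delta_mx 0 i) x) +
                expR (dotp ((- (`|s| * n%:R)) *: delta_mx 0 i) x))).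
  apply: rintD; first exact: rint_cst.
  by apply: rint_sum => i; apply: rintD; exact: Hexp.
apply: rint_le h _; first by mfun.
move=> x; rewrite ger0_norm ?expR_ge0//; apply: le_trans (expR_nrm_le x (normr_ge0 s)).
by rewrite ler_expR ler_wpM2r ?nrm_ge0// ler_norm.
Qed.

Lemma expR_sub1_le s : `|expR s - 1| <= `|s| * expR `|s|.
Proof.
case: (ger0P s) => s0.
  rewrite ger0_norm ?subr_ge0 -?expR0 ?ler_expR// lerBlDr -lerBlDl.
  have h : 1 - s <= expR (- s) by have := expR_ge1Dx (- s); lra.
  rewrite expR0 [s * _]mulrC -[X in X - _]mulr1 -mulrBr.
  by rewrite -[leRHS](expRxMexpNx_1 s) ler_wpM2l ?expR_ge0.
have h := expR_ge1Dx s; rewrite ler0_norm ?subr_le0 -?expR0 ?ler_expR ?(ltW s0)//.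
rewrite opprB expR0; apply: (@le_trans _ _ (- s)); first lra.
by rewrite ler_peMr ?oppr_ge0 ?(ltW s0)// -expR0 ler_expR oppr_ge0 ltW.
Qed.

Lemma Rint_expR_continuous : continuous (fun t => \int[mu]_x expR (dotp t x)).
Proof.
apply: continuous_of_nrm => t e e0.
(* In the constant nrm t + 2 one unit accounts for a neighbour u at distance at most 1 and the other
   absorbs the factor nrm x of the Lipschitz bound. *)
pose K := \int[mu]_x expR ((nrm t + 2) * nrm x).
have K0 : 0 <= K by apply: Rint_ge0 => x; exact: expR_ge0.
exists (Num.min 1 (e / (K + 1))); first by rewrite lt_min ltr01 divr_gt0// ltr_wpDl.
move=> u; rewrite le_min => /andP[tu1 tu2].
have i1 : rint mu (fun x => expR (dotp t x) - expR (dotp u x)) by apply: rintB.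
rewrite -RintB//; apply: (le_trans (Rint_norm i1)).
have le x : `|expR (dotp t x) - expR (dotp u x)| <=
    nrm (t - u) * expR ((nrm t + 2) * nrm x).
  have key (a b : R) : `|expR a - expR b| <= `|a - b| * expR (`|a| + `|a - b|).
    have -> : expR a - expR b = - (expR a * (expR (b - a) - 1)).
      by rewrite mulrBr -expRD mulr1 opprB; congr (_ - expR _); ring.
    rewrite normrN normrM gtr0_norm ?expR_gt0// [in leRHS]expRD mulrCA.
    have := expR_sub1_le (b - a); rewrite (distrC b a) => h2.
    by apply: ler_pM => //; rewrite ler_expR ler_norm.
  apply: (le_trans (key _ _)); rewrite -dotpBl.
  have d1 := norm_dotp_le (t - u) x; have d2 := norm_dotp_le t x.
  have x0 := nrm_ge0 x; have t0 := nrm_ge0 t.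
  have d3 : nrm (t - u) * nrm x <= nrm x by rewrite ler_piMl.
  apply: (@le_trans _ _ ((nrm (t - u) * nrm x) * expR ((nrm t + 1) * nrm x))).
    apply: ler_pM => //.
    by rewrite ler_expR mulrDl mul1r; apply: lerD => //; exact: le_trans d3.
  rewrite -mulrA ler_wpM2l ?nrm_ge0//.
  rewrite (_ : (nrm t + 2) * nrm x = nrm x + (nrm t + 1) * nrm x); last by ring.
  rewrite expRD ler_wpM2r ?expR_ge0//; apply: le_trans (expR_ge1Dx _).
  by rewrite lerDr.
apply: (@le_trans _ _ (\int[mu]_x (nrm (t - u) * expR ((nrm t + 2) * nrm x)))).
  apply: le_Rint => //; first exact: rint_norm.
  exact/rintZ/rint_expR_nrm.
rewrite RintZ; last exact: rint_expR_nrm.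
rewrite -/K; apply: (@le_trans _ _ (e / (K + 1) * K)); first by rewrite ler_wpM2r.
rewrite mulrAC ler_pdivrMr ?ltr_wpDl// ler_wpM2l ?(ltW e0)//.
by rewrite lerDl.
Qed.

End exponential_moments.

(** * Decay of the Laplace-Fourier transform *)

Section laplace_decay.
Context {R : realType} {n : nat}.
Notation leb := (@lebesgue_row R n).
Variables (alpha : R) (mu nu : probability 'rV[R]_n R) (p : 'rV[R]_n -> R) (N : nat).
Implicit Types (s t x xi eta : 'rV[R]_n).

Let beta := conj_exponent alpha.

Hypotheses (alpha_gt1 : 1 < alpha) (N_gt0 : (0 < N)%N).
Hypothesis Hexp : forall t, rint mu (fun y => expR (dotp t y)).
Hypothesis Hnu : forall t, rint nu (fun y => expR (dotp t y)).
Hypothesis nu_power : forall t xi, laplace_fourier nu t xi =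
  laplace_fourier mu ((Num.sqrt N%:R)^-1 *: t) ((Num.sqrt N%:R)^-1 *: xi) ^+ N.
Hypotheses (mp : measurable_fun setT p) (p0 : forall x, 0 <= p x).
Hypothesis p_density : forall A, measurable A -> nu A = (\int[leb]_(x in A) (p x)%:E)%E.
Hypothesis p_renyi :
  rint leb (fun x => (p x / gauss_density x) `^ alpha * gauss_density x).
Hypothesis mgf_lt : forall t, t != 0 ->
  \int[mu]_y expR (dotp t y) < expR (beta * dotp t t / 2).

Let beta_gt0 : 0 < beta.
Proof. by rewrite divr_gt0 ?subr_gt0// (lt_trans ltr01). Qed.

Definition laplace_ratio s eta : R :=
  normc (laplace_fourier mu s eta) * gau (Num.sqrt beta) s.

Let W := laplace_ratio.
Let c : R := Num.sqrt N%:R.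
Let sigma : R := (Num.sqrt beta)^-1.
Let g x := p x * expR (dotp x x / (2 * beta)).

Let c_gt0 : 0 < c. Proof. by rewrite sqrtr_gt0 ltr0n. Qed.

Let c_ge1 : 1 <= c.
Proof. by rewrite -sqrtr1 ler_wsqrtr// ler1n. Qed.

Let sigma_gt0 : 0 < sigma. Proof. by rewrite invr_gt0 sqrtr_gt0. Qed.

Let sqrt_beta2 : Num.sqrt beta ^+ 2 = beta. Proof. by rewrite sqr_sqrtr// ltW. Qed.

Let mg : measurable_fun setT g. Proof. by rewrite /g; mfun. Qed.

Let g0 x : 0 <= g x. Proof. by rewrite mulr_ge0 ?expR_ge0. Qed.

(** Since alpha / beta = alpha - 1, the power g^alpha is the integrand of the divergence up to the
    normalizing constant of the normal density; this is where the conjugate exponent comes from. *)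
Let g_powR : rint leb (fun x => g x `^ alpha).
Proof.
pose K : R := (2 * pi) `^ (- (n%:R / 2)).
have K0 : 0 < K by rewrite powR_gt0// mulr_gt0// pi_gt0.
have a0 : 0 < alpha - 1 by rewrite subr_gt0.
pose C := (K^-1 `^ alpha * K)^-1.
have KK : 0 < K^-1 `^ alpha * K by rewrite mulr_gt0// powR_gt0// invr_gt0.
apply: eq_rint (rintZ C p_renyi) => x.
rewrite /gauss_density -/K enorm_sqr /g.
have -> : p x / (K * expR (- (dotp x x / 2))) = p x * (K^-1 * expR (dotp x x / 2)).
  by rewrite invfM -expRN opprK.
have iK : 0 <= K^-1 by rewrite invr_ge0 ltW.
rewrite !powRM ?mulr_ge0 ?expR_ge0//.
have pe (y : R) : expR y `^ alpha = expR (alpha * y) by rewrite mulrC expRM.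
rewrite !pe.
have -> : expR (alpha * (dotp x x / (2 * beta))) =
    expR (alpha * (dotp x x / 2)) * expR (- (dotp x x / 2)).
  rewrite -expRD; congr expR; rewrite /beta /conj_exponent; field.
  by rewrite !gt_eqF// (lt_trans ltr01).
have A0 : 0 < K^-1 `^ alpha by rewrite powR_gt0// invr_gt0.
rewrite /C; move: (K^-1 `^ alpha) A0 => A A0.
by field; rewrite !gt_eqF.
Qed.

(* Tilting the density of nu by [exp <t,x>] and weighting by [exp (- beta |t|^2 / 2)]
   is multiplying g, which lies in L^alpha, by a Gaussian centered at [beta t]. *)
Let tiltE t x : tilt g sigma (beta *: t) x =
  gau (Num.sqrt beta) t * (expR (dotp t x) * p x).
Proof.
rewrite /tilt /g mulrC mulrCA [RHS]mulrA [RHS]mulrC; congr (_ * _).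
rewrite /gau -!expRD; congr expR.
rewrite /sigma exprVn sqrt_beta2 dotp_sqrB !dotpZr dotpZl (dotpC x t).
by field; rewrite gt_eqF.
Qed.

(** The transform of [nu] is the power N of that of [mu] at arguments divided by c, and c^2 = N
    turns the Gaussian weight into the same power. *)
Let ft_tilt t xi : normc (ft (tilt g sigma (beta *: t)) xi) =
  W (c^-1 *: t) (c^-1 *: xi) ^+ N.
Proof.
have mexp : measurable_fun setT (fun y => expR (dotp t y)) by mfun.
have md := measurable_dotpr xi.
have ip : rint leb (fun x => expR (dotp t x) * p x).
  exact/(rint_density mp p0 p_density mexp).
have -> : tilt g sigma (beta *: t) =
    (fun x => gau (Num.sqrt beta) t * (expR (dotp t x) * p x)).
  by apply/funext => x; exact: tiltE.
rewrite /ft oscZ// normcM normc_real ger0_norm ?(ltW (gau_gt0 _ _))//.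
have -> : osc leb (fun x => expR (dotp t x) * p x) (dotp xi) = laplace_fourier nu t xi.
  rewrite /laplace_fourier /osc; congr (_ +i* _).
    rewrite (Rint_density mp p0 p_density); last by mfun.
    by apply: eq_Rint => x; rewrite mulrAC.
  rewrite (Rint_density mp p0 p_density); last by mfun.
  by apply: eq_Rint => x; rewrite mulrAC.
rewrite nu_power normcX mulrC /W /laplace_ratio exprMn -/c; congr (_ * _).
rewrite /gau -expRM_natl; congr expR; rewrite dotpZl dotpZr.
have -> : N%:R = c ^+ 2 :> R by rewrite sqr_sqrtr.
by field; rewrite gt_eqF.
Qed.

Let W_pow s eta :
  W s eta ^+ N = normc (ft (tilt g sigma (beta *: (c *: s))) (c *: eta)).
Proof. by rewrite ft_tilt !scalerA mulVf ?gt_eqF// !scale1r. Qed.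

Lemma laplace_ratio_ge0 s eta : 0 <= laplace_ratio s eta.
Proof. by rewrite mulr_ge0 ?normc_ge0// ltW// gau_gt0. Qed.

Let V s := (\int[mu]_y expR (dotp s y)) * gau (Num.sqrt beta) s.

Let WV s : W s 0 = V s.
Proof.
rewrite /W /laplace_ratio /laplace_fourier.
have -> : dotp (0 : 'rV[R]_n) = fun=> 0 by apply/funext => x; rewrite dotp0l.
rewrite osc0 normc_real ger0_norm// Rint_ge0// => x; exact: expR_ge0.
Qed.

Let W_le s eta : W s eta <= V s.
Proof.
rewrite ler_wpM2r ?(ltW (gau_gt0 _ _))//.
apply: (le_trans (normc_osc_le (Hexp s) (measurable_dotpr eta))).
by rewrite le_eqVlt; apply/orP; left; apply/eqP; apply: eq_Rint => x; rewrite ger0_norm// expR_ge0.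
Qed.

Let V_lt1 s : s != 0 -> V s < 1.
Proof.
move=> s0; rewrite /V /gau expRN ltr_pdivrMr ?expR_gt0// mul1r sqrt_beta2.
exact: mgf_lt.
Qed.

Let V_le1 s : V s <= 1.
Proof.
have [->|s0] := eqVneq s 0; last exact/ltW/V_lt1.
rewrite /V gau0 mulr1 -[leRHS](Rint_cst mu 1) le_eqVlt; apply/orP; left; apply/eqP.
by apply: eq_Rint => x; rewrite dotp0l expR0.
Qed.

Lemma laplace_ratio_le1 s eta : laplace_ratio s eta <= 1.
Proof. exact: le_trans (W_le s eta) (V_le1 s). Qed.

(** Bernoulli's inequality 1 - w^N <= N (1 - w) on [0,1] carries a gap from the power N, which is a
    transform of a function, to W itself. *)
Let W_bernoulli s eta e : W s eta ^+ N <= 1 - e -> W s eta <= 1 - e / N%:R.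
Proof.
have w0 := laplace_ratio_ge0 s eta; have w1 := laplace_ratio_le1 s eta.
have h k : 1 - W s eta ^+ k <= k%:R * (1 - W s eta).
  elim: k => [|k IH]; first by rewrite expr0 subrr mul0r.
  rewrite exprS -natr1 mulrDl mul1r.
  rewrite (_ : 1 - W s eta * W s eta ^+ k =
    W s eta * (1 - W s eta ^+ k) + (1 - W s eta)); last by ring.
  rewrite lerD2r; apply: le_trans IH; apply: ler_piMl => //.
  by rewrite subr_ge0; apply: exprn_ile1.
move=> hN; have N0 : 0 < N%:R :> R by rewrite ltr0n.
rewrite lerBrDr -lerBrDl ler_pdivrMr// mulrC; apply: le_trans (h N).
by rewrite lerBrDr -lerBrDl.
Qed.

Let Rint_tilt s : \int[leb]_x tilt g sigma (beta *: (c *: s)) x = V s ^+ N.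
Proof.
rewrite -WV W_pow scaler0 /ft.
have -> : dotp (0 : 'rV[R]_n) = fun=> 0 by apply/funext => x; rewrite dotp0l.
rewrite osc0 normc_real ger0_norm// Rint_ge0// => x; exact: tilt_ge0.
Qed.

Lemma laplace_ratio_power : exists M (J : R), 0 <= J /\ forall s,
  rint leb (fun eta => laplace_ratio s eta ^+ M) /\
  \int[leb]_eta laplace_ratio s eta ^+ M <= J.
Proof.
have [q [J [J0 h]]] := tilt_fourier_power alpha_gt1 sigma_gt0 mg g0 g_powR.
exists (N * q)%N, J; split=> // s.
have [i1 i2] := h (beta *: (c *: s)).
pose f xi := normc (ft (tilt g sigma (beta *: (c *: s))) xi) ^+ q.
have E eta : laplace_ratio s eta ^+ (N * q) = f (c *: eta + 0).
  by rewrite exprM W_pow addr0.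
split.
  apply: (@eq_rint _ _ _ _ (fun eta => f (c *: eta + 0))) => [eta|]; first by rewrite E.
  by apply/rint_row_affine => //; exact: rint_measurable i1.
rewrite (eq_Rint _ E); apply: le_trans i2; rewrite (Rint_row_affine 0 c_gt0 i1).
apply: ler_peMl; last exact: exprn_ege1.
by apply: Rint_ge0 => x; rewrite exprn_ge0// normc_ge0.
Qed.

(** [ft_gap] fixes eps before the function and its center, so a single q serves all s. The mass of
    the tilted function is V(s)^N, at most 1 by the bound on the moment generating function. *)
Let W_gap_eta delta : 0 < delta ->
  exists2 q : R, q < 1 & forall s eta, delta <= nrm eta -> W s eta <= q.
Proof.
move=> d0.
have [q [J [J0 h]]] := tilt_fourier_power alpha_gt1 sigma_gt0 mg g0 g_powR.
have [K K0 hK] := tilt_moment alpha_gt1 sigma_gt0 mg g0 g_powR.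
have cd0 : 0 < c * delta by rewrite mulr_gt0.
have [eps e0 gap] := @ft_gap R n J K (c * delta) q J0 K0 cd0.
exists (1 - eps / N%:R); first by rewrite gtrBl divr_gt0// ltr0n.
move=> s eta he; apply: W_bernoulli; rewrite W_pow.
set b := beta *: (c *: s).
have [i1 _] := rint_tilt alpha_gt1 sigma_gt0 mg g0 g_powR b.
have [k1 k2] := hK b; have [j1 j2] := h b.
apply: (gap _ b) => //.
- by move=> x; exact: tilt_ge0.
- rewrite Rint_tilt exprn_ile1// -?WV; first exact: laplace_ratio_ge0.
- by rewrite nrmZ gtr0_norm// ler_wpM2l// ltW.
Qed.

Let nrm_continuous : continuous (@nrm R n).
Proof.
apply: continuous_of_nrm => x e e0; exists e => // y xy; apply: le_trans xy.
have h1 := nrmD (x - y) y; have h2 := nrmD (y - x) x; rewrite !subrK in h1 h2.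
have h3 : nrm (y - x) = nrm (x - y) by rewrite -nrmN opprB.
by rewrite ler_norml; apply/andP; split; lra.
Qed.

Let V_continuous : continuous V.
Proof.
move=> s; have h := @Rint_expR_continuous R n mu Hexp s.
apply: (cvgM h); rewrite /gau; apply: continuous_cvg; first exact: continuous_expR.
apply: cvgN; apply: cvgM; last exact: cvg_cst.
apply: cvgM; first exact: cvg_cst.
rewrite /dotp; apply: cvg_big => [|i _]; first exact: add_continuous.
by apply: cvgM; apply: coord_continuous.
Qed.

Let W_gap_s delta : 0 < delta ->
  exists2 q : R, q < 1 & forall s eta, delta <= nrm s -> W s eta <= q.
Proof.
move=> d0; have half : 0 < 2^-1 :> R by [].
have [rho hrho] := tilt_decay alpha_gt1 sigma_gt0 mg g0 g_powR half.
(* The tilted function is centered at beta c s, so it is beyond [rho] once nrm s reaches the outer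
   radius; the absolute value covers a negative [rho]. *)
pose A := [set s : 'rV[R]_n | delta <= nrm s <= `|rho| / (beta * c)].
have far s : `|rho| / (beta * c) <= nrm s -> V s <= 1 - 2^-1 / N%:R.
  move=> hs; rewrite -WV; apply: W_bernoulli.
  rewrite WV -Rint_tilt; apply: (@le_trans _ _ 2^-1); last by lra.
  apply: hrho; apply: (le_trans (ler_norm _)); rewrite !nrmZ (gtr0_norm beta_gt0) (gtr0_norm c_gt0) mulrA.
  have bc : 0 < beta * c by exact: mulr_gt0.
  by rewrite ler_pdivrMr// in hs; rewrite mulrC.
have far1 : 1 - 2^-1 / N%:R < 1 :> R by rewrite gtrBl divr_gt0// ltr0n.
(* The extreme value theorem needs a point in the shell; if the shell is empty, every s with nrm s
   >= delta is already far. *)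
have [[s0 As0]|A0] := pselect (A !=set0); last first.
  exists (1 - 2^-1 / N%:R) => // s eta hs; apply: le_trans (W_le s eta) _.
  apply: far; rewrite leNgt; apply/negP => hl; apply: A0; exists s.
  by rewrite /A /= hs ltW.
have cA : compact A.
  apply: bounded_closed_compact.
    exists (`|rho| / (beta * c)); split; first exact: num_real.
    move=> M hM s /= /andP[_ hs]; apply: (le_trans _ (ltW (le_lt_trans hs hM))).
    change (mx_norm s <= nrm s); rewrite mx_normrE; apply: bigmax_le; first exact: nrm_ge0.
    by move=> i _; rewrite (ord1 i.1); exact: coord_le_nrm.
  rewrite (_ : A = @nrm R n @^-1` `[delta, `|rho| / (beta * c)]%classic).
    by apply: preimage_closed => [x _|]; [exact: nrm_continuous|exact: interval_closed].
  by apply/seteqP; split=> s; rewrite /A /= in_itv.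
have [s1 As1 hmax] := @EVT_max_rV R n V A (ex_intro _ s0 As0) cA
  (continuous_subspaceT V_continuous).
have V1 : V s1 < 1.
  apply: V_lt1; move: As1; rewrite inE /A /= => /andP[h _].
  by rewrite -nrm_eq0 gt_eqF// (lt_le_trans d0).
exists (Num.max (V s1) (1 - 2^-1 / N%:R)); first by rewrite gt_max V1.
move=> s eta hs; apply: le_trans (W_le s eta) _; rewrite le_max.
case: (leP (`|rho| / (beta * c)) (nrm s)) => h; first by rewrite far// orbT.
by rewrite hmax// inE /A /= hs ltW.
Qed.

Lemma laplace_ratio_gap delta : 0 < delta ->
  exists q : R, [/\ 0 <= q, q < 1 & forall s eta,
    delta <= nrm s \/ delta <= nrm eta -> laplace_ratio s eta <= q].
Proof.
move=> d0; have [q1 q11 h1] := W_gap_s d0; have [q2 q21 h2] := W_gap_eta d0.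
exists (Num.max 0 (Num.max q1 q2)); split.
- by rewrite le_max lexx.
- by rewrite !gt_max ltr01 q11 q21.
by move=> s eta [/h1|/h2] h; rewrite !le_max h ?orbT.
Qed.

End laplace_decay.

(** * Taylor expansion at the origin *)

Section taylor_expansion.
Context {R : realType} {n : nat}.
Variable mu : probability 'rV[R]_n R.
Implicit Types (s t y eta : 'rV[R]_n).
Hypothesis Hexp : forall t, rint mu (fun y => expR (dotp t y)).
Hypothesis mean0 : forall i, \int[mu]_y y 0 i = 0.
Hypothesis cov1 : forall i j, \int[mu]_y (y 0 i * y 0 j) = (i == j)%:R.

(** Half the bilinear square of s + i eta; its exponential is the transform of the standard normal
    law. *)
Definition gauss_exponent s eta : R[i] :=
  ((dotp s s - dotp eta eta) / 2) +i* dotp s eta.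

Let mn := @measurable_nrm R n.

Let expR_ge_pow (x : R) k : 0 <= x -> x ^+ k <= k`!%:R * expR x.
Proof.
move=> x0; case: k => [|k].
  by rewrite expr0 fact0 mul1r -expR0 ler_expR.
rewrite mulrC -ler_pdivrMr ?ltr0n ?fact_gt0//.
by have := expR_ge1Dxn k x0; lra.
Qed.

Let rint_nrmX_expR k : rint mu (fun y => nrm y ^+ k * expR (nrm y)).
Proof.
apply: (rint_le (fun y : 'rV[R]_n => k`!%:R * expR (2 * nrm y))).
- by mfun.
- exact/rintZ/(rint_expR_nrm Hexp).
move=> y; have y0 := nrm_ge0 y.
rewrite ger0_norm ?mulr_ge0 ?exprn_ge0 ?expR_ge0//.
rewrite mulrDl mul1r expRD mulrA ler_wpM2r ?expR_ge0//.
exact: expR_ge_pow.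
Qed.

Let rint_poly k c (f : 'rV[R]_n -> R) : measurable_fun setT f -> 0 <= c ->
  (forall y, `|f y| <= c * nrm y ^+ k) -> rint mu f.
Proof.
move=> mf c0 h; apply: (rint_le _ mf (rintZ c (rint_nrmX_expR k))) => y.
apply: (le_trans (h y)); rewrite ler_wpM2l// ler_peMr ?exprn_ge0 ?nrm_ge0//.
by rewrite -expR0 ler_expR nrm_ge0.
Qed.

Let coord_int i : rint mu (fun y : 'rV[R]_n => y 0 i).
Proof.
apply: (@rint_poly 1 1) => //; first by mfun.
by move=> y; rewrite mul1r expr1; exact: coord_le_nrm.
Qed.

Let coord2_int i j : rint mu (fun y : 'rV[R]_n => y 0 i * y 0 j).
Proof.
apply: (@rint_poly 2 1) => //; first by mfun.
by move=> y; rewrite mul1r normrM expr2 ler_pM// coord_le_nrm.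
Qed.

Let rint_dotp t : rint mu (dotp t).
Proof.
apply: (@rint_poly 1 (nrm t)); [exact: measurable_dotpr|exact: nrm_ge0|].
by move=> y; rewrite expr1; exact: norm_dotp_le.
Qed.

Let Rint_dotp t : \int[mu]_y dotp t y = 0.
Proof.
rewrite /dotp Rint_sum => [|i]; last exact: rintZ.
by apply: big1 => i _; rewrite RintZ// mean0 mulr0.
Qed.

Let rint_dotp2 s t : rint mu (fun y => dotp s y * dotp t y).
Proof.
have ms := measurable_dotpr s; have mt := measurable_dotpr t.
apply: (@rint_poly 2 (nrm s * nrm t)); [by mfun|by rewrite mulr_ge0 ?nrm_ge0|].
move=> y; rewrite normrM expr2 mulrACA.
by apply: ler_pM => //; exact: norm_dotp_le.
Qed.

Let Rint_dotp2 s t : \int[mu]_y (dotp s y * dotp t y) = dotp s t.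
Proof.
transitivity (\int[mu]_y (\sum_i \sum_j (s 0 i * t 0 j) * (y 0 i * y 0 j))).
  apply: eq_Rint => y; rewrite /dotp mulr_suml; apply: eq_bigr => i _.
  by rewrite mulr_sumr; apply: eq_bigr => j _; rewrite mulrACA.
rewrite Rint_sum => [|i]; last by apply: rint_sum => j; exact: rintZ.
apply: eq_bigr => i _; rewrite Rint_sum => [|j]; last exact: rintZ.
rewrite (bigD1 i)//= RintZ// cov1 eqxx mulr1 big1 ?addr0// => j ji.
by rewrite RintZ// cov1 eq_sym (negbTE ji) mulr0.
Qed.

Let gauss_exponent_le s eta : normc (gauss_exponent s eta) <= (nrm s + nrm eta) ^+ 2.
Proof.
apply: (le_trans (normc_le_add _ _)).
have h1 := dotp_le_nrm_sqr s; have h2 := dotp_le_nrm_sqr eta.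
have h3 := norm_dotp_le s eta; have h4 := dotp_ge0 s; have h5 := dotp_ge0 eta.
have h6 := sqr_ge0 (nrm s); have h7 := sqr_ge0 (nrm eta).
have h8 : 0 <= nrm s * nrm eta by rewrite mulr_ge0 ?nrm_ge0.
have h9 : `|(dotp s s - dotp eta eta) / 2| <= nrm s ^+ 2 + nrm eta ^+ 2.
  by rewrite ler_norml; apply/andP; split; lra.
by rewrite sqrrD; lra.
Qed.

Let exp_sum2 (z : R[i]) : \sum_(j < 2) (j`!%:R^-1)%:C * z ^+ j = 1 + z.
Proof.
rewrite !big_ord_recr big_ord0 /= add0r expr0 expr1.
by rewrite fact0 (_ : 1`! = 1)%N// invr1 mulr1 mul1r.
Qed.

(** The exponent is quadratic in nrm s + nrm eta, so two Taylor terms of its exponential already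
    leave an error of order 4, enough for both rates. *)
Let gauss_second_order s eta : nrm s + nrm eta <= 1 ->
  normc (cexp (gauss_exponent s eta) - (1 + gauss_exponent s eta)) <=
  expR 1 * (nrm s + nrm eta) ^+ 4.
Proof.
move=> r1; set w := gauss_exponent s eta.
have r0 : 0 <= nrm s + nrm eta by rewrite addr_ge0 ?nrm_ge0.
have := cexp_taylor w 2; rewrite exp_sum2 => h.
have wr := gauss_exponent_le s eta; rewrite -/w in wr.
have w1 : normc w <= 1 by apply: (le_trans wr); exact: exprn_ile1.
apply: (le_trans h); rewrite mulrC; apply: ler_pM => //.
- by rewrite mulr_ge0// exprn_ge0// normc_ge0.
- by rewrite ler_expR; apply: le_trans w1; exact: Re_le_normc.
rewrite ler_pdivrMr// (_ : 4 = 2 * 2)%N// exprM.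
apply: (@le_trans _ _ (((nrm s + nrm eta) ^+ 2) ^+ 2)).
  by rewrite lerXn2r ?nnegrE ?normc_ge0 ?exprn_ge0.
by rewrite ler_peMr ?exprn_ge0// ler1n.
Qed.

Let jet k s eta y : R[i] :=
  \sum_(j < k) (j`!%:R^-1)%:C * (dotp s y +i* dotp eta y) ^+ j.

(** The remainder estimate is the same for both orders; the moment hypotheses enter only through the
    expectation of the jet. *)
Let laplace_taylor k s eta :
  rint mu (fun y => complex.Re (jet k s eta y)) ->
  rint mu (fun y => complex.Im (jet k s eta y)) ->
  \int[mu]_y complex.Re (jet k s eta y) +i* \int[mu]_y complex.Im (jet k s eta y) =
    1 + gauss_exponent s eta ->
  nrm s + nrm eta <= 1 ->
  normc (laplace_fourier mu s eta - cexp (gauss_exponent s eta)) <=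
  (\int[mu]_y (nrm y ^+ k * expR (nrm y))) * (nrm s + nrm eta) ^+ k +
  expR 1 * (nrm s + nrm eta) ^+ 4.
Proof.
move=> iR iI jE r1; set r := nrm s + nrm eta.
have r0 : 0 <= r by rewrite addr_ge0 ?nrm_ge0.
rewrite -[X in normc X](subrKA (1 + gauss_exponent s eta)).
apply: (le_trans (normcD_le _ _)); apply: lerD; last first.
  by rewrite normcB_sym; exact: gauss_second_order.
have ms := measurable_dotpr eta.
rewrite -jE /laplace_fourier /osc.
set a := Rintegral mu setT _; set b := Rintegral mu setT _.
set a' := Rintegral mu setT _; set b' := Rintegral mu setT _.
have -> : (a +i* b) - (a' +i* b') = (a - a') +i* (b - b') by [].
have ic := rint_cos (Hexp s) ms; have is' := rint_sin (Hexp s) ms.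
rewrite -!RintB// -RintZr//; apply: normc_Rint_le.
- exact: rintB.
- exact: rintB.
- by apply: eq_rint (rintZ (r ^+ k) (rint_nrmX_expR k)) => y; rewrite mulrC.
move=> y; pose z : R[i] := dotp s y +i* dotp eta y.
have -> : (expR (dotp s y) * cos (dotp eta y) - complex.Re (jet k s eta y)) +i*
    (expR (dotp s y) * sin (dotp eta y) - complex.Im (jet k s eta y)) =
    cexp z - jet k s eta y.
  apply: complexP; rewrite raddfB /= ?mul0r ?subr0 ?addr0//.
have y0 := nrm_ge0 y.
have d1 := norm_dotp_le s y; have d2 := norm_dotp_le eta y.
have zr : normc z <= r * nrm y.
  by apply: (le_trans (normc_le_add _ _)); rewrite /r mulrDl lerD.
apply: (le_trans (cexp_taylor z k)).
rewrite [leRHS]mulrC mulrA -exprMn; apply: ler_pM.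
- by rewrite mulr_ge0 ?exprn_ge0 ?normc_ge0// invr_ge0.
- exact: expR_ge0.
- rewrite ler_pdivrMr ?ltr0n ?fact_gt0//.
  apply: (@le_trans _ _ ((r * nrm y) ^+ k)).
    by rewrite lerXn2r ?nnegrE ?normc_ge0 ?mulr_ge0.
  by rewrite ler_peMr ?exprn_ge0 ?mulr_ge0// ler1n fact_gt0.
rewrite ler_expR /= ; apply: (le_trans d1); apply: ler_piMl => //.
by apply: le_trans r1; rewrite lerDl nrm_ge0.
Qed.

Let jet3E s eta y : jet 3 s eta y =
  (1 + dotp s y + (dotp s y * dotp s y - dotp eta y * dotp eta y) / 2) +i*
  (dotp eta y + dotp s y * dotp eta y).
Proof.
rewrite /jet big_ord_recr exp_sum2 /= (_ : 2`! = 2)%N// expr2 complex_mulE.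
by apply: complexP => /=; field.
Qed.

Let jet4E s eta y : jet 4 s eta y =
  (1 + dotp s y + (dotp s y * dotp s y - dotp eta y * dotp eta y) / 2 +
    (dotp s y ^+ 3 - 3 * dotp s y * dotp eta y ^+ 2) / 6) +i*
  (dotp eta y + dotp s y * dotp eta y +
    (3 * dotp s y ^+ 2 * dotp eta y - dotp eta y ^+ 3) / 6).
Proof.
rewrite /jet big_ord_recr /= -/(jet 3 s eta y) jet3E (_ : 3`! = 6)%N//.
rewrite !exprS expr0 !mulr1 !complex_mulE.
by apply: complexP => /=; field.
Qed.

Let jet_Re s eta := fun y =>
  1 + dotp s y + (dotp s y * dotp s y - dotp eta y * dotp eta y) / 2.
Let jet_Im s eta := fun y => dotp eta y + dotp s y * dotp eta y.

Let jet_Re_int s eta : rint mu (jet_Re s eta) /\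
  \int[mu]_y jet_Re s eta y = 1 + (dotp s s - dotp eta eta) / 2.
Proof.
have i1 := rint_cst mu 1; have i2 := rint_dotp s.
have i3 := rintB (rint_dotp2 s s) (rint_dotp2 eta eta).
have i4 : rint mu (fun y => (dotp s y * dotp s y - dotp eta y * dotp eta y) / 2).
  by apply: eq_rint (rintZ 2^-1 i3) => y; rewrite mulrC.
have i5 := rintD i1 i2; split; first exact: rintD i5 i4.
rewrite (RintD i5 i4) (RintD i1 i2) Rint_cst Rint_dotp addr0.
by rewrite (RintZr _ i3) (RintB (rint_dotp2 s s) (rint_dotp2 eta eta)) !Rint_dotp2.
Qed.

Let jet_Im_int s eta : rint mu (jet_Im s eta) /\
  \int[mu]_y jet_Im s eta y = dotp s eta.
Proof.
have i1 := rint_dotp eta; have i2 := rint_dotp2 s eta.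
by split; [exact: rintD|rewrite (RintD i1 i2) Rint_dotp Rint_dotp2 add0r].
Qed.

Let moment_ge0 k : 0 <= \int[mu]_y (nrm y ^+ k * expR (nrm y)).
Proof. by apply: Rint_ge0 => y; rewrite mulr_ge0 ?expR_ge0// exprn_ge0// nrm_ge0. Qed.

Lemma laplace_gauss_approx3 : exists2 C : R, 0 <= C &
  forall s eta, nrm s + nrm eta <= 1 ->
  normc (laplace_fourier mu s eta - cexp (gauss_exponent s eta)) <=
  C * (nrm s + nrm eta) ^+ 3.
Proof.
exists (\int[mu]_y (nrm y ^+ 3 * expR (nrm y)) + expR 1).
  by rewrite addr_ge0 ?expR_ge0.
move=> s eta r1; have r0 : 0 <= nrm s + nrm eta by rewrite addr_ge0 ?nrm_ge0.
have [iR eR] := jet_Re_int s eta; have [iI eI] := jet_Im_int s eta.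
have ER : (fun y => complex.Re (jet 3 s eta y)) = jet_Re s eta.
  by apply/funext => y; rewrite jet3E.
have EI : (fun y => complex.Im (jet 3 s eta y)) = jet_Im s eta.
  by apply/funext => y; rewrite jet3E.
have := @laplace_taylor 3 s eta; rewrite ER EI eR eI => /(_ iR iI) h.
apply: (le_trans (h _ r1)).
  by rewrite /gauss_exponent; apply: complexP; rewrite /= ?add0r.
rewrite mulrDl lerD2l ler_wpM2l ?expR_ge0// [leLHS]exprS.
by rewrite ler_piMl// exprn_ge0.
Qed.

Hypothesis mu_sym : forall A, measurable A -> mu A = mu (-%R @^-1` A).

Let Rint_odd (f : 'rV[R]_n -> R) : rint mu f -> (forall y, f (- y) = - f y) ->
  \int[mu]_y f y = 0.
Proof.
move=> fi fN; have mN : measurable_fun setT (-%R : 'rV[R]_n -> 'rV[R]_n).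
  by apply: (@measurable_rowN _ _ _ _ id); exact: measurable_id.
have := Rint_image mN mu_sym (rint_measurable fi).
by under [RHS]eq_Rint do rewrite fN; rewrite RintN// => h; lra.
Qed.

(** The third-order terms of the jet are odd in y, so symmetry annihilates them. The coefficients,
    and an exchange of s and eta, cover the real and the imaginary part. *)
Let cubic_int s eta (a b : R) : rint mu
  (fun y => (a * dotp s y ^+ 3 + b * (dotp s y * dotp eta y ^+ 2)) / 6) /\
  \int[mu]_y ((a * dotp s y ^+ 3 + b * (dotp s y * dotp eta y ^+ 2)) / 6) = 0.
Proof.
have ms := measurable_dotpr s; have mt := measurable_dotpr eta.
have d1 := norm_dotp_le s; have d2 := norm_dotp_le eta.
have i1 : rint mu (fun y => dotp s y ^+ 3).
  apply: (@rint_poly 3 (nrm s ^+ 3)); [by mfun|by rewrite exprn_ge0 ?nrm_ge0|move=> y].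
  by rewrite normrX -exprMn lerXn2r ?nnegrE ?mulr_ge0 ?nrm_ge0.
have i2 : rint mu (fun y => dotp s y * dotp eta y ^+ 2).
  apply: (@rint_poly 3 (nrm s * nrm eta ^+ 2)); [by mfun| |move=> y].
    by rewrite mulr_ge0 ?exprn_ge0 ?nrm_ge0.
  rewrite normrM normrX [nrm y ^+ 3]exprS mulrACA -exprMn; apply: ler_pM => //.
  by rewrite lerXn2r ?nnegrE ?mulr_ge0 ?nrm_ge0.
have i : rint mu (fun y =>
    (a * dotp s y ^+ 3 + b * (dotp s y * dotp eta y ^+ 2)) / 6).
  by apply: eq_rint (rintZ 6^-1 (rintD (rintZ a i1) (rintZ b i2))) => y; rewrite mulrC.
by split=> //; apply: Rint_odd i _ => y; rewrite !dotpNr; ring.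
Qed.

Lemma laplace_gauss_approx4 : exists2 C : R, 0 <= C &
  forall s eta, nrm s + nrm eta <= 1 ->
  normc (laplace_fourier mu s eta - cexp (gauss_exponent s eta)) <=
  C * (nrm s + nrm eta) ^+ 4.
Proof.
exists (\int[mu]_y (nrm y ^+ 4 * expR (nrm y)) + expR 1).
  by rewrite addr_ge0 ?expR_ge0.
move=> s eta r1.
have [iR eR] := jet_Re_int s eta; have [iI eI] := jet_Im_int s eta.
have [cR zR] := cubic_int s eta 1 (- 3).
have [cI zI] := cubic_int eta s (- 1) 3.
have ER : (fun y => complex.Re (jet 4 s eta y)) = (fun y => jet_Re s eta y +
    (1 * dotp s y ^+ 3 + - 3 * (dotp s y * dotp eta y ^+ 2)) / 6).
  by apply/funext => y; rewrite jet4E /= /jet_Re; ring.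
have EI : (fun y => complex.Im (jet 4 s eta y)) = (fun y => jet_Im s eta y +
    (- 1 * dotp eta y ^+ 3 + 3 * (dotp eta y * dotp s y ^+ 2)) / 6).
  by apply/funext => y; rewrite jet4E /= /jet_Im; ring.
have := @laplace_taylor 4 s eta; rewrite ER EI (RintD iR cR) (RintD iI cI) eR eI zR zI.
move=> /(_ (rintD iR cR) (rintD iI cI)) h.
rewrite mulrDl; apply: h r1.
by rewrite /gauss_exponent; apply: complexP; rewrite /= ?add0r ?addr0.
Qed.

End taylor_expansion.

(** * Comparison of powers *)

Lemma normc_subX_le (R : realType) (a b : R[i]) (Q : R) m :
  normc a <= Q -> normc b <= Q ->
  normc (a ^+ m.+1 - b ^+ m.+1) <= m.+1%:R * normc (a - b) * Q ^+ m.
Proof.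
move=> aQ bQ; have Q0 : 0 <= Q by apply: le_trans aQ; exact: normc_ge0.
elim: m => [|m IH]; first by rewrite !expr1 mul1r expr0 mulr1.
have -> : a ^+ m.+2 - b ^+ m.+2 = a * (a ^+ m.+1 - b ^+ m.+1) + (a - b) * b ^+ m.+1.
  by rewrite (exprS a m.+1) (exprS b m.+1); ring.
apply: (le_trans (normcD_le _ _)); rewrite !normcM normcX.
have h1 : normc a * normc (a ^+ m.+1 - b ^+ m.+1) <=
    Q * (m.+1%:R * normc (a - b) * Q ^+ m).
  by apply: ler_pM => //; exact: normc_ge0.
have h2 : normc (a - b) * normc b ^+ m.+1 <= normc (a - b) * Q ^+ m.+1.
  by rewrite ler_wpM2l ?normc_ge0// lerXn2r ?nnegrE ?normc_ge0.
apply: (le_trans (lerD h1 h2)).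
rewrite le_eqVlt; apply/orP; left; apply/eqP.
by rewrite (exprS Q m) -(natr1 m.+1); ring.
Qed.

Lemma expR_poly_bounded (R : realType) (a : R) j : 0 < a ->
  exists2 B : R, 0 <= B & forall m : nat, m%:R ^+ j * expR (- (a * m%:R)) <= B.
Proof.
move=> a0; exists (1 + j`!%:R / a ^+ j).
  by rewrite addr_ge0// divr_ge0// exprn_ge0// ltW.
move=> m; rewrite expRN ler_pdivrMr ?expR_gt0//.
have am : 0 <= a * m%:R by rewrite mulr_ge0// ltW.
have e1 : 1 <= expR (a * m%:R) by rewrite -[leLHS]expR0 ler_expR.
case: j => [|j].
  by rewrite expr0 fact0 expr0 divr1; lra.
have h := expR_ge1Dxn j am.
have aj : 0 < a ^+ j.+1 by rewrite exprn_gt0.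
have f0 : 0 < j.+1`!%:R :> R by rewrite ltr0n fact_gt0.
have h2 : m%:R ^+ j.+1 <= j.+1`!%:R / a ^+ j.+1 * expR (a * m%:R).
  rewrite mulrAC ler_pdivlMr// mulrC -exprMn.
  rewrite [leRHS]mulrC -ler_pdivrMr//; lra.
by apply: (le_trans h2); rewrite ler_wpM2r ?expR_ge0// lerDr.
Qed.

Section power_approximation.
Context {R : realType} {n : nat}.
Notation leb := (@lebesgue_row R n).
Variables (alpha : R) (mu : probability 'rV[R]_n R) (k M : nat) (C J : R).
Implicit Types (s t xi eta : 'rV[R]_n).
Let beta := conj_exponent alpha.
Let W := laplace_ratio alpha mu.
Let L := laplace_fourier mu.
Let g s : R := gau (Num.sqrt beta) s.

Hypotheses (alpha_gt1 : 1 < alpha) (k_ge3 : (3 <= k)%N) (k_le4 : (k <= 4)%N).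
Hypotheses (C_ge0 : 0 <= C) (J_ge0 : 0 <= J).
Hypothesis W_power : forall s, rint leb (fun eta => W s eta ^+ M) /\
  \int[leb]_eta W s eta ^+ M <= J.
Hypothesis W_gap : forall delta, 0 < delta ->
  exists q : R, [/\ 0 <= q, q < 1 & forall s eta,
    delta <= nrm s \/ delta <= nrm eta -> W s eta <= q].
Hypothesis approx : forall s eta, nrm s + nrm eta <= 1 ->
  normc (L s eta - cexp (gauss_exponent s eta)) <= C * (nrm s + nrm eta) ^+ k.

Let beta_gt1 : 1 < beta.
Proof. by rewrite /beta /conj_exponent ltr_pdivlMr ?subr_gt0//; lra. Qed.

(** The factor 8 (n+1) offsets the loss in [r_sqr], so that 2 kappa r^2 is at most half of
    min(beta-1, 1)(|s|^2 + |eta|^2). The Gaussian ratio then decays at rate 2 kappa, and only rate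
    kappa is kept in [Q], which leaves room for the Taylor error. *)
Let kappa := Num.min (beta - 1) 1 / (8 * n.+1%:R).

Let kappa_gt0 : 0 < kappa.
Proof. by rewrite divr_gt0 ?mulr_gt0// lt_min ltr01 subr_gt0 beta_gt1. Qed.

Let g_ge0 s : 0 <= g s. Proof. exact/ltW/gau_gt0. Qed.

Let W_ge0 s eta : 0 <= W s eta.
Proof. by rewrite mulr_ge0 ?normc_ge0// g_ge0. Qed.

Let r s eta := nrm s + nrm eta.

Let r_ge0 s eta : 0 <= r s eta. Proof. by rewrite addr_ge0 ?nrm_ge0. Qed.

Let r_sqr s eta : r s eta ^+ 2 <= 2 * n.+1%:R * (dotp s s + dotp eta eta).
Proof.
have h1 := nrm_sqr_le s; have h2 := nrm_sqr_le eta.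
have h3 := dotp_ge0 s; have h4 := dotp_ge0 eta.
have h5 : r s eta ^+ 2 <= 2 * (nrm s ^+ 2 + nrm eta ^+ 2).
  by rewrite /r; have := sqr_ge0 (nrm s - nrm eta); nra.
by rewrite -natr1; lra.
Qed.

Let G s eta := normc (cexp (gauss_exponent s eta)) * g s.

Let G_ge0 s eta : 0 <= G s eta. Proof. by rewrite mulr_ge0 ?normc_ge0. Qed.

Let G_le s eta : G s eta <= expR (- (2 * kappa * r s eta ^+ 2)).
Proof.
rewrite /G normc_cexp /g /gau -expRD ler_expR /= sqr_sqrtr ?(le_trans _ (ltW beta_gt1))//.
have h := r_sqr s eta; have h3 := dotp_ge0 s; have h4 := dotp_ge0 eta.
pose b := Num.min (beta - 1) 1.
have n0 : 0 < n.+1%:R :> R by rewrite ltr0n.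
have b0 : 0 < b by rewrite lt_min ltr01 subr_gt0 beta_gt1.
have b1 : b <= beta - 1 by rewrite ge_min lexx.
have b2 : b <= 1 by rewrite ge_min lexx orbT.
have h6 : 2 * kappa * r s eta ^+ 2 <= b / 2 * (dotp s s + dotp eta eta).
  apply: (@le_trans _ _ (2 * kappa * (2 * n.+1%:R * (dotp s s + dotp eta eta)))).
    by rewrite ler_wpM2l// mulr_ge0// ltW.
  rewrite le_eqVlt; apply/orP; left; apply/eqP.
  by rewrite /kappa -/b; field; rewrite gt_eqF.
have h7 : b * dotp s s <= (beta - 1) * dotp s s by rewrite ler_wpM2r.
have h8 : b * dotp eta eta <= dotp eta eta by rewrite ler_piMl.
lra.
Qed.

(** For r <= delta one has C r <= kappa exp(-2 kappa), so the error C r^3 is at most kappa r^2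
    exp(-2 kappa r^2); since 1 + y <= exp y, it costs only half of the rate 2 kappa. *)
Let delta := Num.min 1 (kappa / ((C + 1) * expR (2 * kappa))).

Let delta_gt0 : 0 < delta.
Proof. by rewrite lt_min ltr01 divr_gt0// mulr_gt0 ?expR_gt0// ltr_wpDl. Qed.

Let Q s eta := expR (- (kappa * r s eta ^+ 2)).

Let G_le_Q s eta : G s eta <= Q s eta.
Proof.
apply: (le_trans (G_le s eta)); rewrite ler_expR lerN2 ler_wpM2r ?sqr_ge0//.
by have := kappa_gt0; lra.
Qed.

Let W_le_Q s eta : r s eta <= delta -> W s eta <= Q s eta.
Proof.
move=> rd; have r0 := r_ge0 s eta; set u := r s eta in rd r0 *.
have u1 : u <= 1 by apply: (le_trans rd); rewrite ge_min lexx.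
have h1 : W s eta <= G s eta + C * u ^+ 3.
  rewrite /W /laplace_ratio -/beta -/(g s).
  have h := normcD_le (cexp (gauss_exponent s eta)) (L s eta - cexp (gauss_exponent s eta)).
  rewrite addrC subrK in h.
  apply: (le_trans (ler_wpM2r (g_ge0 s) h)); rewrite mulrDl lerD2l.
  have h2 : C * u ^+ k <= C * u ^+ 3.
    by rewrite ler_wpM2l// ler_wiXn2l.
  apply: le_trans h2; apply: le_trans (approx u1).
  by rewrite ler_piMr ?normc_ge0// gau_le1.
apply: (le_trans h1); apply: (le_trans (lerD (G_le s eta) (lexx _))).
rewrite -/u; have k0 := kappa_gt0.
have u2 : 0 <= u ^+ 2 by rewrite sqr_ge0.
have u21 : u ^+ 2 <= 1 by exact: exprn_ile1.
have e0 := expR_gt0 (2 * kappa).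
have hC : C * u <= kappa / expR (2 * kappa).
  apply: (@le_trans _ _ ((C + 1) * delta)).
    by apply: ler_pM => //; rewrite lerDl.
  have C1 : 0 < C + 1 by rewrite ltr_wpDl.
  apply: (@le_trans _ _ ((C + 1) * (kappa / ((C + 1) * expR (2 * kappa))))).
    by rewrite ler_wpM2l ?(ltW C1)// /delta ge_min lexx orbT.
  rewrite le_eqVlt; apply/orP; left; apply/eqP; field.
  by rewrite !gt_eqF.
have h3 : C * u ^+ 3 <= kappa * u ^+ 2 * expR (- (2 * kappa * u ^+ 2)).
  rewrite exprSr mulrA mulrAC [leRHS]mulrAC ler_wpM2r//.
  apply: (le_trans hC); rewrite -expRN ler_wpM2l ?(ltW k0)// ler_expR lerN2.
  by rewrite ler_piMr// mulr_ge0// ltW.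
apply: (@le_trans _ _ (expR (- (2 * kappa * u ^+ 2)) * (1 + kappa * u ^+ 2))).
  by rewrite [leRHS]mulrDr mulr1 lerD2l [leRHS]mulrC.
rewrite /Q -/u (_ : - (kappa * u ^+ 2) =
  - (2 * kappa * u ^+ 2) + kappa * u ^+ 2); last by ring.
by rewrite expRD ler_wpM2l ?expR_ge0// expR_ge1Dx.
Qed.

Let D m s eta :=
  normc (L s eta ^+ m - cexp (gauss_exponent s eta) ^+ m) * g s ^+ m.

(** Both transforms are multiplied by [g s] before telescoping: unweighted they may grow with s,
    while the weighted ones share the bound [Q]. *)
Let central m s eta : r s eta <= delta ->
  D m.+1 s eta <= m.+1%:R * (C * r s eta ^+ k) * Q s eta ^+ m.
Proof.
move=> rd; set a := L s eta; set b := cexp (gauss_exponent s eta).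
have gE j (x : R[i]) : ((g s)%:C * x) ^+ j = ((g s ^+ j)%:C) * x ^+ j.
  by rewrite exprMn rmorphXn.
have gn (x : R[i]) : normc ((g s)%:C * x) = normc x * g s.
  by rewrite normcM normc_real ger0_norm// mulrC.
have -> : D m.+1 s eta = normc (((g s)%:C * a) ^+ m.+1 - ((g s)%:C * b) ^+ m.+1).
  rewrite !gE -mulrBr normcM normc_real ger0_norm ?exprn_ge0//.
  by rewrite mulrC.
have qa : normc ((g s)%:C * a) <= Q s eta by rewrite gn; exact: W_le_Q.
have qb : normc ((g s)%:C * b) <= Q s eta by rewrite gn; exact: G_le_Q.
apply: (le_trans (normc_subX_le m qa qb)).
rewrite ler_wpM2r ?exprn_ge0 ?expR_ge0// ler_wpM2l//.
rewrite -mulrBr gn; apply: (@le_trans _ _ (normc (a - b))).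
  by rewrite ler_piMr ?normc_ge0// gau_le1.
apply: approx; apply: (le_trans rd); by rewrite ge_min lexx.
Qed.

(** Beyond delta both powers are small separately, so the triangle inequality suffices. Half of the
    Gaussian rate becomes exponential decay in m through r > delta; the other half is kept for
    integrability in xi. *)
Let outside m s eta : delta < r s eta -> D m s eta <=
  W s eta ^+ m + expR (- (kappa * delta ^+ 2 * m%:R)) * Q s eta ^+ m.
Proof.
move=> rd; apply: (@le_trans _ _ (W s eta ^+ m + G s eta ^+ m)).
  have -> : W s eta ^+ m = normc (L s eta ^+ m) * g s ^+ m.
    by rewrite normcX /W /laplace_ratio exprMn.
  have -> : G s eta ^+ m = normc (cexp (gauss_exponent s eta) ^+ m) * g s ^+ m.
    by rewrite normcX /G exprMn.
  by rewrite -mulrDl; apply: ler_wpM2r; [exact: exprn_ge0|exact: normcB_le].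
rewrite lerD2l; apply: (@le_trans _ _ ((expR (- (2 * kappa * r s eta ^+ 2))) ^+ m)).
  by rewrite lerXn2r ?nnegrE ?expR_ge0// G_le.
rewrite /Q -!expRM_natl -expRD ler_expR.
have d2 : delta ^+ 2 <= r s eta ^+ 2 by rewrite lerXn2r ?nnegrE ?(ltW rd) ?(ltW delta_gt0).
have m0 : 0 <= m%:R :> R by [].
have := ler_wpM2l (mulr_ge0 m0 (ltW kappa_gt0)) d2; lra.
Qed.

Let sg := Num.sqrt (kappa / 2).

Let sg_gt0 : 0 < sg. Proof. by rewrite sqrtr_gt0 divr_gt0. Qed.

Let gau_sgE xi : gau sg xi = expR (- (kappa / 4 * dotp xi xi)).
Proof.
rewrite /gau sqr_sqrtr; last by rewrite divr_ge0// ltW.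
by congr expR; field.
Qed.

(** For k = 3 and k = 4 alike x^k <= 1 + x^4, and with y = kappa x^2 / 4 one has x^4 = (32 /
    kappa^2) y^2/2, which exp y absorbs. *)
Let poly_gauss (x : R) : 0 <= x ->
  x ^+ k * expR (- (kappa / 2 * x ^+ 2)) <=
  (1 + 32 / kappa ^+ 2) * expR (- (kappa / 4 * x ^+ 2)).
Proof.
move=> x0; have k0 := kappa_gt0.
have -> : - (kappa / 2 * x ^+ 2) = - (kappa / 4 * x ^+ 2) - kappa / 4 * x ^+ 2 by field.
rewrite expRD mulrA mulrAC ler_wpM2r ?expR_ge0// expRN ler_pdivrMr ?expR_gt0//.
have y0 : 0 <= kappa / 4 * x ^+ 2 by rewrite mulr_ge0 ?sqr_ge0// divr_ge0// ltW.
have h := expR_ge1Dxn 1 y0.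
have xk : x ^+ k <= 1 + x ^+ 4.
  case: (leP x 1) => x1.
    by apply: (@le_trans _ _ 1); [exact: exprn_ile1|rewrite lerDl exprn_ge0].
  apply: (@le_trans _ _ (x ^+ 4)); last by rewrite lerDr.
  by rewrite ler_weXn2l// ltW.
apply: (le_trans xk).
have -> : x ^+ 4 = 32 / kappa ^+ 2 * ((kappa / 4 * x ^+ 2) ^+ 2 / 2).
  by field; rewrite gt_eqF.
have h2 : (kappa / 4 * x ^+ 2) ^+ 2 / 2 <= expR (kappa / 4 * x ^+ 2).
  by apply: le_trans h; rewrite lerDr.
have h1 : 1 <= expR (kappa / 4 * x ^+ 2) by rewrite -[leLHS]expR0 ler_expR.
rewrite [leRHS]mulrDl mul1r; apply: lerD => //; apply: ler_wpM2l => //.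
exact: divr_ge0 _ (sqr_ge0 _).
Qed.

Let rho t xi := nrm t + nrm xi.

Let rho_gauss t xi : expR (- (kappa / 4 * rho t xi ^+ 2)) <= gau sg xi.
Proof.
have k4 : 0 <= kappa / 4 by exact: divr_ge0 (ltW kappa_gt0) _.
rewrite gau_sgE ler_expR lerN2; apply: ler_wpM2l => //.
apply: (le_trans (dotp_le_nrm_sqr xi)).
by rewrite lerXn2r ?nnegrE ?addr_ge0 ?nrm_ge0// lerDr nrm_ge0.
Qed.

Section scaling.
Variables (m : nat) (t : 'rV[R]_n).
Hypothesis m_ge2 : (2 <= m)%N.
Let c : R := Num.sqrt m%:R.
Let s := c^-1 *: t.

Let c_gt0 : 0 < c. Proof. by rewrite sqrtr_gt0 ltr0n (leq_trans _ m_ge2). Qed.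

Let c2 : c ^+ 2 = m%:R. Proof. by rewrite sqr_sqrtr. Qed.

Let rE xi : r s (c^-1 *: xi) = c^-1 * rho t xi.
Proof. by rewrite /r /s !nrmZ gtr0_norm ?invr_gt0// -mulrDr. Qed.

Let mr2 xi : m%:R * r s (c^-1 *: xi) ^+ 2 = rho t xi ^+ 2.
Proof. by rewrite rE -c2; field; rewrite gt_eqF. Qed.

Let central_scaled xi : r s (c^-1 *: xi) <= delta -> D m s (c^-1 *: xi) <=
  C * (1 + 32 / kappa ^+ 2) * (m%:R / c ^+ k) * gau sg xi.
Proof.
move=> rd; have [m' mE] : exists m', m = m'.+1 by exists m.-1; rewrite prednK// (leq_trans _ m_ge2).
have h := central m' rd; rewrite -mE in h; apply: (le_trans h).
have rho0 : 0 <= rho t xi by rewrite addr_ge0 ?nrm_ge0.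
have QE : Q s (c^-1 *: xi) ^+ m' <= expR (- (kappa / 2 * rho t xi ^+ 2)).
  rewrite /Q -expRM_natl ler_expR -mr2.
  (* Telescoping leaves m - 1 factors [Q]; as m >= 2 this is at least m/2 of them, which gives the
     rate kappa/2. *)
  have m'm : m%:R <= 2 * m'%:R :> R.
    have : 1 <= m'%:R :> R by rewrite ler1n; move: m_ge2; rewrite mE.
    by rewrite mE -natr1; lra.
  have h2 := mulr_ge0 (ltW kappa_gt0) (sqr_ge0 (r s (c^-1 *: xi))).
  have := ler_wpM2l h2 m'm; lra.
apply: (@le_trans _ _ (m%:R * (C * r s (c^-1 *: xi) ^+ k) *
    expR (- (kappa / 2 * rho t xi ^+ 2)))).
  by rewrite ler_wpM2l// !mulr_ge0// exprn_ge0.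
have -> : m%:R * (C * r s (c^-1 *: xi) ^+ k) * expR (- (kappa / 2 * rho t xi ^+ 2)) =
   C * (m%:R / c ^+ k) * (rho t xi ^+ k * expR (- (kappa / 2 * rho t xi ^+ 2))).
  by rewrite rE exprMn exprVn; ring.
rewrite [leRHS](_ : _ = C * (m%:R / c ^+ k) * ((1 + 32 / kappa ^+ 2) * gau sg xi)); last by ring.
have K0 : 0 <= 1 + 32 / kappa ^+ 2 by rewrite addr_ge0// divr_ge0// exprn_ge0// ltW.
rewrite ler_wpM2l//.
  by rewrite mulr_ge0// divr_ge0// exprn_ge0// ltW.
by apply: (le_trans (poly_gauss rho0)); rewrite ler_wpM2l// rho_gauss.
Qed.

Variable q : R.
Hypotheses (q_ge0 : 0 <= q) (m_geM : (M <= m)%N).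
Hypothesis W_q : forall s' eta,
  delta / 2 <= nrm s' \/ delta / 2 <= nrm eta -> W s' eta <= q.

(** The first summand is the central estimate, the second the normal law outside it. In the last,
    W^m is split as W^(m-M) W^M: the gap bounds the first factor and [W_power] integrates the
    second. *)
Let majorant xi :=
  (C * (1 + 32 / kappa ^+ 2) * (m%:R / c ^+ k) +
   expR (- (kappa * delta ^+ 2 * m%:R))) * gau sg xi +
  q ^+ (m - M) * W s (c^-1 *: xi) ^+ M.

Let D_le_majorant xi : D m s (c^-1 *: xi) <= majorant xi.
Proof.
have K0 : 0 <= C * (1 + 32 / kappa ^+ 2) * (m%:R / c ^+ k).
  have k2 : 0 <= 32 / kappa ^+ 2 by exact: divr_ge0 _ (sqr_ge0 _).
  have ck : 0 <= m%:R / c ^+ k by rewrite divr_ge0// exprn_ge0// ltW.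
  by apply: mulr_ge0 => //; apply: mulr_ge0 => //; rewrite ler_wpDr.
have gs0 : 0 <= gau sg xi by exact/ltW/gau_gt0.
rewrite /majorant mulrDl.
case: (leP (r s (c^-1 *: xi)) delta) => rd.
  apply: (le_trans (central_scaled rd)); rewrite -addrA lerDl.
  by rewrite addr_ge0 ?mulr_ge0 ?expR_ge0 ?exprn_ge0.
apply: (le_trans (outside m rd)); rewrite addrC; apply: lerD; last first.
  rewrite -{1}(subnK m_geM) exprD ler_wpM2r ?exprn_ge0//.
  rewrite lerXn2r ?nnegrE//; apply: W_q.
  case: (leP (delta / 2) (nrm s)) => h1; first by left.
  by right; move: rd; rewrite /r; lra.
rewrite -[leLHS]add0r; apply: lerD; first by rewrite mulr_ge0.
rewrite ler_wpM2l ?expR_ge0//; apply: le_trans (rho_gauss t xi).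
rewrite /Q -expRM_natl ler_expR -mr2.
have h2 := mulr_ge0 (mulr_ge0 (ltW kappa_gt0) (sqr_ge0 (r s (c^-1 *: xi)))) (ler0n R m).
lra.
Qed.

Let majorant_int : rint leb majorant /\ \int[leb]_xi majorant xi <=
  (C * (1 + 32 / kappa ^+ 2) * (m%:R / c ^+ k) +
   expR (- (kappa * delta ^+ 2 * m%:R))) * \int[leb]_xi gau sg xi +
  q ^+ (m - M) * (c ^+ n * J).
Proof.
have gi := @rint_gau R n sg sg_gt0.
have [wi wJ] := W_power s.
have c'0 : 0 < c^-1 by rewrite invr_gt0.
have wi' : rint leb (fun xi => W s (c^-1 *: xi) ^+ M).
  have h := proj2 (rint_row_affine 0 c'0 (rint_measurable wi)) wi.
  by apply: eq_rint h => xi; rewrite addr0.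
have wE : \int[leb]_xi (W s (c^-1 *: xi) ^+ M) <= c ^+ n * J.
  have E : \int[leb]_xi (W s (c^-1 *: xi) ^+ M) = c ^+ n * \int[leb]_eta (W s eta ^+ M).
    have -> := Rint_row_affine 0 c'0 wi.
    rewrite mulrA -exprMn mulfV ?gt_eqF// expr1n mul1r.
    by apply: eq_Rint => xi; rewrite addr0.
  by rewrite E; apply: ler_wpM2l => //; rewrite exprn_ge0// ltW.
split; first by apply: rintD; exact: rintZ.
rewrite RintD; [|exact: rintZ|exact: rintZ].
by rewrite !RintZ// lerD2l ler_wpM2l// exprn_ge0.
Qed.

Lemma exists_majorant : exists h, [/\ rint leb h, \int[leb]_xi h xi <=
  (C * (1 + 32 / kappa ^+ 2) * (m%:R / c ^+ k) +
   expR (- (kappa * delta ^+ 2 * m%:R))) * \int[leb]_xi gau sg xi +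
  q ^+ (m - M) * (c ^+ n * J) & forall xi, D m s (c^-1 *: xi) <= h xi].
Proof. by have [i1 i2] := majorant_int; exists majorant; split. Qed.

End scaling.

Lemma laplace_power_approx : exists (B : R) (m0 : nat), (0 < m0)%N /\
  forall m t, (m0 <= m)%N -> exists h, [/\ rint leb h,
    \int[leb]_xi h xi <= B * (m%:R / Num.sqrt m%:R ^+ k) & forall xi,
    let s := (Num.sqrt m%:R)^-1 *: t in let eta := (Num.sqrt m%:R)^-1 *: xi in
    normc (L s eta ^+ m - cexp (gauss_exponent s eta) ^+ m) * g s ^+ m <= h xi].
Proof.
have d2 : 0 < delta / 2 by rewrite divr_gt0.
have [q1 [q10 q11 hq1]] := W_gap d2.
(* Raising the bound to a positive number gives it a logarithm, so its powers are exponentials in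
   m. *)
pose q := Num.max q1 2^-1.
have q0 : 0 < q by rewrite lt_max invr_gt0 ltr0n orbT.
have q1' : q < 1 by rewrite gt_max q11 invf_lt1// ltr1n.
have hq s' eta : delta / 2 <= nrm s' \/ delta / 2 <= nrm eta -> W s' eta <= q.
  by move=> /hq1 h; rewrite le_max h.
pose b := - ln q; have b0 : 0 < b by rewrite oppr_gt0 ln_lt0// q0 q1'.
have qE j : q ^+ j = expR (- (b * j%:R)).
  by rewrite /b mulNr opprK mulrC expRM_natl lnK ?posrE.
have kd : 0 < kappa * delta ^+ 2 by rewrite mulr_gt0// exprn_gt0.
have [B1 B10 hB1] := expR_poly_bounded 1 kd.
(* Of the n + 1 powers of m, n pay for the Jacobian c^n <= m^n and one for the rate 1/m. *)
have [B2 B20 hB2] := expR_poly_bounded n.+1 b0.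
pose K := C * (1 + 32 / kappa ^+ 2).
pose I := \int[leb]_xi gau sg xi.
have I0 : 0 <= I by apply: Rint_ge0 => xi; exact/ltW/gau_gt0.
exists ((K + B1) * I + q ^- M * B2 * J), (maxn 2 M).
split; first by rewrite leq_max.
move=> m t; rewrite geq_max => /andP[m2 mM].
have [h [h1 h2 h3]] := exists_majorant t m2 (ltW q0) mM hq.
exists h; split=> //; apply: (le_trans h2).
rewrite -/K -/I; set c := Num.sqrt m%:R.
have m0 : 0 < m%:R :> R by rewrite ltr0n (leq_trans _ m2).
have m1 : 1 <= m%:R :> R by rewrite ler1n (leq_trans _ m2).
have c0 : 0 < c by rewrite sqrtr_gt0.
have c2 : c ^+ 2 = m%:R by rewrite sqr_sqrtr// ltW.
have c1 : 1 <= c by rewrite -sqrtr1 ler_wsqrtr.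
have cm : c <= m%:R by rewrite -c2 expr2 ler_peMr// ltW.
set rate := m%:R / c ^+ k.
(* As k <= 4, the rate is at least 1/m, so every exponentially small term fits under it. *)
have rate_ge : m%:R^-1 <= rate.
  rewrite /rate ler_pdivlMr ?exprn_gt0// mulrC ler_pdivrMr// -expr2 -c2 -exprM.
  by rewrite ler_weXn2l.
have r0 : 0 <= rate by apply: le_trans rate_ge; rewrite invr_ge0 ltW.
have e1 : expR (- (kappa * delta ^+ 2 * m%:R)) <= B1 * rate.
  apply: (@le_trans _ _ (B1 / m%:R)); last by rewrite ler_wpM2l.
  by rewrite ler_pdivlMr// mulrC; have := hB1 m; rewrite expr1.
have e2 : q ^+ (m - M) * (c ^+ n * J) <= q ^- M * B2 * J * rate.
  have qM : 0 < q ^+ M by rewrite exprn_gt0.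
  have -> : q ^+ (m - M) = q ^- M * q ^+ m.
    by rewrite -{2}(subnK mM) exprD mulrCA mulVf ?mulr1// gt_eqF.
  rewrite -!mulrA ler_wpM2l ?invr_ge0 ?(ltW qM)//.
  rewrite [leRHS]mulrCA [leLHS]mulrA [leLHS]mulrC; apply: ler_wpM2l => //.
  apply: (@le_trans _ _ (B2 / m%:R)); last by rewrite ler_wpM2l.
  rewrite ler_pdivlMr//; apply: le_trans (hB2 m).
  rewrite qE mulrC mulrA exprS -!mulrA ler_wpM2l ?(ltW m0)//.
  by rewrite mulrC ler_wpM2r ?expR_ge0// lerXn2r ?nnegrE ?(ltW m0) ?(ltW c0).
rewrite [leRHS]mulrDl; apply: lerD => //; rewrite [leRHS]mulrAC ler_wpM2r//.
by rewrite [leRHS]mulrDl lerD2l.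
Qed.

End power_approximation.

(** * Approximation of the density *)

Section density_approximation.
Context {R : realType} {n : nat}.
Notation leb := (@lebesgue_row R n).
Implicit Types (t x xi eta : 'rV[R]_n).

Lemma gauss_exponent_scale t xi m : (0 < m)%N ->
  gauss_exponent ((Num.sqrt m%:R)^-1 *: t) ((Num.sqrt m%:R)^-1 *: xi) *+ m =
  gauss_exponent t xi.
Proof.
move=> m0; have c0 : 0 < Num.sqrt m%:R :> R by rewrite sqrtr_gt0 ltr0n.
have c2 : Num.sqrt m%:R ^+ 2 = m%:R :> R by rewrite sqr_sqrtr.
move: c0 c2; set c := Num.sqrt _ => c0 c2.
by apply: complexP; rewrite raddfMn /= -[LHS]mulr_natr -c2 !dotpZl !dotpZr;
  field; rewrite gt_eqF.
Qed.

Lemma gau_scale s t m : (0 < m)%N ->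
  gau s ((Num.sqrt m%:R)^-1 *: t) ^+ m = gau s t.
Proof.
move=> m0; have c0 : 0 < Num.sqrt m%:R :> R by rewrite sqrtr_gt0 ltr0n.
have c2 : Num.sqrt m%:R ^+ 2 = m%:R :> R by rewrite sqr_sqrtr.
move: c0 c2; set c := Num.sqrt _ => c0 c2; rewrite /gau -expRM_natl -c2 dotpZl dotpZr; congr expR.
by field; rewrite gt_eqF.
Qed.

Lemma normc_cexp_gauss_exponent t xi :
  normc (cexp (gauss_exponent t xi)) = expR (dotp t t / 2) * gau 1 xi.
Proof. by rewrite normc_cexp /gau -expRD /= expr1n mul1r; congr expR; field. Qed.

Let gauss_kernel t x xi := complex.Re (cexp (gauss_exponent t xi) * expi (- dotp xi x)).

Let gauss_kernelE t x xi :
  gauss_kernel t x xi = expR (dotp t t / 2) * (gau 1 xi * cos (dotp xi (t - x))).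
Proof.
rewrite /gauss_kernel /cexp -mulrA -expiD ReZ /= dotpBr (dotpC t xi) mulrA.
by congr (_ * _); rewrite /gau -expRD expr1n mul1r; congr expR; field.
Qed.

Lemma rint_gauss_kernel t x : rint leb
  (fun xi => complex.Re (cexp (gauss_exponent t xi) * expi (- dotp xi x))).
Proof.
have gi := @rint_gau R n 1 ltr01.
have h : rint leb (fun xi => gau 1 xi * cos (dotp xi (t - x))).
  by apply: rint_cos => //; mfun.
apply: eq_rint (rintZ (expR (dotp t t / 2)) h) => xi.
by rewrite -/(gauss_kernel t x xi) gauss_kernelE.
Qed.

Lemma Rint_gauss_kernel t x : ((2 * pi) ^+ n)^-1 *
  \int[leb]_xi complex.Re (cexp (gauss_exponent t xi) * expi (- dotp xi x)) =
  expR (dotp t x) * gauss_density x.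
Proof.
have gi := @rint_gau R n 1 ltr01.
have h : rint leb (fun xi => gau 1 xi * cos (dotp xi (t - x))).
  by apply: rint_cos => //; mfun.
rewrite (eq_Rint _ (gauss_kernelE t x)) RintZ// Rint_gau_cos// divr1 invr1.
have w0 := @sqrt2pi_gt0 R; rewrite /gauss_density enorm_sqr.
have pi2 : 0 < 2 * pi :> R by rewrite mulr_gt0// pi_gt0.
have -> : (2 * pi) `^ (- (n%:R / 2)) = (Num.sqrt (2 * pi) ^+ n)^-1 :> R.
  by rewrite powRN [n%:R / 2]mulrC powRrM powR12_sqrt ?(ltW pi2)// powR_mulrn ?sqrtr_ge0.
have -> : (2 * pi) ^+ n = Num.sqrt (2 * pi) ^+ n * Num.sqrt (2 * pi) ^+ n :> R.
  by rewrite -exprMn -expr2 sqr_sqrtr// ltW.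
have -> : gau 1 (t - x) = expR (- (dotp t t / 2)) * (expR (dotp t x) * expR (- (dotp x x / 2))).
  by rewrite /gau -!expRD dotp_sqrB; congr expR; field.
have e0 := expR_gt0 (dotp t t / 2).
rewrite (expRN (dotp t t / 2)); field.
by rewrite (gt_eqF e0) (gt_eqF (exprn_gt0 n w0)).
Qed.

Variables (alpha : R) (mu : probability 'rV[R]_n R) (k M : nat) (C J : R).
Hypotheses (alpha_gt1 : 1 < alpha) (k_ge3 : (3 <= k)%N) (k_le4 : (k <= 4)%N).
Hypotheses (C_ge0 : 0 <= C) (J_ge0 : 0 <= J).
Hypothesis W_power : forall s, rint leb (fun eta => laplace_ratio alpha mu s eta ^+ M) /\
  \int[leb]_eta laplace_ratio alpha mu s eta ^+ M <= J.
Hypothesis W_gap : forall delta, 0 < delta ->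
  exists q : R, [/\ 0 <= q, q < 1 & forall s eta,
    delta <= nrm s \/ delta <= nrm eta -> laplace_ratio alpha mu s eta <= q].
Hypothesis approx : forall s eta, nrm s + nrm eta <= 1 ->
  normc (laplace_fourier mu s eta - cexp (gauss_exponent s eta)) <=
  C * (nrm s + nrm eta) ^+ k.
Variable nu : nat -> probability 'rV[R]_n R.
Hypothesis nu_exp : forall m t, rint (nu m) (fun y => expR (dotp t y)).
Hypothesis nu_power : forall m t xi, laplace_fourier (nu m) t xi =
  laplace_fourier mu ((Num.sqrt m%:R)^-1 *: t) ((Num.sqrt m%:R)^-1 *: xi) ^+ m.

Let beta := conj_exponent alpha.

Let beta_gt0 : 0 < beta.
Proof. by rewrite divr_gt0 ?subr_gt0// (lt_trans ltr01). Qed.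

Lemma density_approx : exists (c : R) (m0 : nat), forall m, (m0 <= m)%N ->
  exists p : 'rV[R]_n -> R,
    [/\ continuous p, measurable_fun setT p, forall x, 0 <= p x,
        forall A, measurable A -> nu m A = (\int[leb]_(x in A) (p x)%:E)%E &
        forall x, `|p x - gauss_density x| <= c * (m%:R / Num.sqrt m%:R ^+ k) *
          expR (- (enorm x ^+ 2 / (2 * beta)))].
Proof.
have [B [m0 [m00 hB]]] :=
  laplace_power_approx alpha_gt1 k_ge3 k_le4 C_ge0 J_ge0 W_power W_gap approx.
exists (((2 * pi) ^+ n)^-1 * B), m0 => m m0m.
have m_gt0 : (0 < m)%N by exact: leq_trans m0m.
have majorant t : exists h, [/\ rint leb h,
    \int[leb]_xi h xi <= B * (m%:R / Num.sqrt m%:R ^+ k) &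
    forall xi, normc (laplace_fourier (nu m) t xi - cexp (gauss_exponent t xi)) *
      gau (Num.sqrt beta) t <= h xi].
  have [h [h1 h2 h3]] := hB m t m0m; exists h; split=> // xi.
  by have := h3 xi; rewrite /= -cexp_natM gauss_exponent_scale// gau_scale// -nu_power.
(* The transform is at most a Gaussian plus a multiple of the majorant; the comparison with the
   normal law thus also supplies the integrability that inversion requires. *)
have Hft t : rint leb (fun xi => normc (laplace_fourier (nu m) t xi)).
  have [h [h1 _ h3]] := majorant t.
  have g0 := @gau_gt0 R n (Num.sqrt beta) t.
  have gi := @rint_gau R n 1 ltr01.
  apply: (rint_le (fun xi : 'rV[R]_n => expR (dotp t t / 2) * gau 1 xi +
    (gau (Num.sqrt beta) t)^-1 * h xi)).
  - apply: (@measurable_normc_osc _ _ _ _ R (nu m) _ (fun z => dotp z.1 z.2)).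
    + exact: nu_exp.
    + by move=> x; exact: expR_ge0.
    + by mfun.
  - by apply: rintD; exact: rintZ.
  move=> xi; rewrite ger0_norm ?normc_ge0// -normc_cexp_gauss_exponent.
  rewrite -[X in normc X <= _](subrK (cexp (gauss_exponent t xi))).
  apply: (le_trans (normcD_le _ _)); rewrite addrC lerD2l.
  by rewrite mulrC ler_pdivlMr.
pose p := fourier_inverse (nu m) 0.
have p_ge0 x : 0 <= p x by exact: fourier_inverse_ge0.
exists p; split=> //.
- exact: (fourier_inverse_continuous (nu_exp m) Hft).
- exact: (measurable_fourier_inverse (nu_exp m) Hft).
- exact: (fourier_inverse_density (nu_exp m) Hft).
move=> x; pose t := beta^-1 *: x.
have [h [h1 h2 h3]] := majorant t.
have g0 := @gau_gt0 R n (Num.sqrt beta) t.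
have e0 := expR_gt0 (dotp t x).
have pE : p x = (expR (dotp t x))^-1 * fourier_inverse (nu m) t x.
  by rewrite (fourier_inverse_tilt (nu_exp m) Hft) mulKf// gt_eqF.
have -> : gauss_density x = (expR (dotp t x))^-1 * (((2 * pi) ^+ n)^-1 *
    \int[leb]_xi complex.Re (cexp (gauss_exponent t xi) * expi (- dotp xi x))).
  by rewrite Rint_gauss_kernel mulKf// gt_eqF.
have pin : 0 < ((2 * pi) ^+ n)^-1 :> R by rewrite invr_gt0 exprn_gt0// mulr_gt0// pi_gt0.
have i1 : rint leb (fun xi =>
    complex.Re (laplace_fourier (nu m) t xi * expi (- dotp xi x))).
  apply: rint_le (Hft t) _ => [|xi].
    have E : (fun xi => complex.Re (laplace_fourier (nu m) t xi * expi (- dotp xi x))) =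
       (fun xi => \int[nu m]_y (expR (dotp t y) * cos (dotp xi y - dotp xi x))).
      by apply/funext => xi; rewrite Re_osc_phase//; exact: measurable_dotpr.
    rewrite E; apply: (@measurable_osc_cos _ _ _ _ R (nu m) _
      (fun w => dotp w.1 w.2 - dotp w.1 x)).
    + exact: nu_exp.
    + by move=> y; exact: expR_ge0.
    + by mfun.
  by apply: (le_trans (Re_le_normc _)); rewrite normcM normc_expi mulr1.
have i2 := rint_gauss_kernel t x.
rewrite pE /fourier_inverse -!mulrBr -RintB// !normrM.
rewrite (ger0_norm (ltW pin)) gtr0_norm ?invr_gt0//.
have le1 : `|\int[leb]_xi (complex.Re (laplace_fourier (nu m) t xi * expi (- dotp xi x)) -
    complex.Re (cexp (gauss_exponent t xi) * expi (- dotp xi x)))| <=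
    (gau (Num.sqrt beta) t)^-1 * (B * (m%:R / Num.sqrt m%:R ^+ k)).
  apply: (le_trans (Rint_norm (rintB i1 i2))).
  apply: (@le_trans _ _ (\int[leb]_xi ((gau (Num.sqrt beta) t)^-1 * h xi))).
    apply: le_Rint; [exact/rint_norm/rintB|exact: rintZ|move=> xi].
    rewrite -[_ - _](raddfB (@complex.Re R)) -mulrBl.
    apply: (le_trans (Re_le_normc _)); rewrite normcM normc_expi mulr1.
    by rewrite mulrC ler_pdivlMr.
  by rewrite RintZ// ler_wpM2l// invr_ge0 ltW.
have ie0 : 0 <= (expR (dotp t x))^-1 by rewrite invr_ge0 ltW.
apply: (le_trans (ler_wpM2l ie0 (ler_wpM2l (ltW pin) le1))).
have -> : expR (- (enorm x ^+ 2 / (2 * beta))) =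
    (expR (dotp t x))^-1 * (gau (Num.sqrt beta) t)^-1.
  rewrite enorm_sqr /gau -!expRN -expRD /t dotpZl dotpZl dotpZr sqr_sqrtr ?(ltW beta_gt0)//.
  by congr expR; field; rewrite gt_eqF.
by rewrite le_eqVlt; apply/orP; left; apply/eqP; ring.
Qed.

End density_approximation.

(** * From the hypotheses on the random vectors to their laws *)

Section moments_of_the_law.
Context dsp (T : measurableType dsp) (R : realType) (P : probability T R) (n : nat).
Variable X : {RV P >-> 'rV[R]_n}.
Let mu := distribution P X.

Let mX : measurable_fun setT X. Proof. by []. Qed.

Let muE A : measurable A -> mu A = P (X @^-1` A). Proof. by []. Qed.

Let mexp (t : 'rV[R]_n) : measurable_fun setT (fun y => expR (dotp t y)).
Proof. by mfun. Qed.

(** A strict upper bound, even by an extended real, forces the expectation to be finite; at t = 0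
    the integrand is 1. *)
Lemma rint_expR_of_mgf (f : 'rV[R]_n -> \bar R) :
  (forall t, t != 0 -> ('E_P[fun w => expR (dotp t (X w))] < f t)%E) ->
  forall t, rint mu (fun y => expR (dotp t y)).
Proof.
move=> h t; have [->|t0] := eqVneq t 0.
  by apply: eq_rint (rint_cst mu 1) => y; rewrite dotp0l expR0.
apply/(rint_image mX muE (mexp t)); apply: rint_of_finite.
- by have mx := mX; mfun.
- by move=> w; exact: expR_ge0.
apply: lt_le_trans (leey (f t)); have := h t t0.
by rewrite unlock.
Qed.

Hypothesis Hexp : forall t, rint mu (fun y => expR (dotp t y)).

Let HexpX t : rint P (fun w => expR (dotp t (X w))).
Proof. exact/(rint_image mX muE (mexp t)). Qed.

Lemma Rint_expR_lt t (c : R) : ('E_P[fun w => expR (dotp t (X w))] < c%:E)%E ->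
  \int[mu]_y expR (dotp t y) < c.
Proof.
move=> h; rewrite (Rint_image mX muE (mexp t)) -lte_fin (Rint_EFin (HexpX t)).
by move: h; rewrite unlock.
Qed.

Lemma Rint_coord0 : mean_zero X -> forall i, \int[mu]_y y 0 i = 0.
Proof.
move=> h i; have mi : measurable_fun setT (fun y : 'rV[R]_n => y 0 i) by mfun.
rewrite (Rint_image mX muE mi); have := h i; rewrite unlock /Rintegral.
by move=> ->.
Qed.

Lemma Rint_coord2 : mean_zero X -> identity_covariance X ->
  forall i j, \int[mu]_y (y 0 i * y 0 j) = (i == j)%:R.
Proof.
move=> h0 h i j.
have mij : measurable_fun setT (fun y : 'rV[R]_n => y 0 i * y 0 j) by mfun.
rewrite (Rint_image mX muE mij); have := h i j.
rewrite covariance.unlock !h0 unlock /= /Rintegral => E.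
transitivity (fine ((i == j)%:R%:E : \bar R)) => //; rewrite -E; congr fine.
apply: eq_integral => w _; congr (_%:E).
by transitivity ((X w 0 i - 0) * (X w 0 j - 0)) => //; rewrite !subr0.
Qed.

Lemma symmetric_law : symmetric_about_origin X ->
  forall A, measurable A -> mu A = mu (-%R @^-1` A).
Proof. by move=> h A mA; rewrite /mu -[LHS]/(P (X @^-1` A)) -h. Qed.

End moments_of_the_law.

(** Either a missing density or an infinite integral would make the divergence +oo, the factor
    1/(alpha - 1) being positive. *)
Lemma finite_renyi_density dsp (T : measurableType dsp) (R : realType)
    (P : probability T R) (n : nat) (Y : {RV P >-> 'rV[R]_n}) (alpha : R) :
  1 < alpha -> renyi_gauss alpha Y \is a fin_num ->
  exists p, is_density Y p /\
    rint (lebr n) (fun x => (p x / gauss_density x) `^ alpha * gauss_density x).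
Proof.
move=> a1; rewrite /renyi_gauss; case: pselect => [Yp|//].
case: cid => p pY /= pf; exists p; split=> //.
have [mp p0 _] := pY.
have mphi : measurable_fun setT (@gauss_density R n).
  rewrite (_ : @gauss_density R n = fun x =>
    (2 * pi) `^ (- (n%:R / 2)) * expR (- (dotp x x / 2))); first by mfun.
  by apply/funext => x; rewrite /gauss_density enorm_sqr.
have phi_gt0 x : 0 < gauss_density x :> R by rewrite mulr_gt0 ?expR_gt0// powR_gt0// mulr_gt0// pi_gt0.
apply: rint_of_finite.
- rewrite (_ : (fun _ => _) = fun x : 'rV[R]_n => (p x * ((2 * pi) `^ (n%:R / 2) * expR (dotp x x / 2))) `^ alpha *
    gauss_density x); first by mfun.
  apply/funext => x; congr (_ `^ _ * _); congr (_ * _).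
  by rewrite /gauss_density invfM powRN invrK -expRN opprK enorm_sqr.
- by move=> x; rewrite mulr_ge0 ?powR_ge0// ltW.
rewrite ltNge leye_eq; apply/negP => /eqP E.
move: pf; rewrite /renyi_gauss_density E /= mulry gtr0_sg ?mul1e//.
by rewrite invr_gt0 subr_gt0.
Qed.

Section density_of_normalized_sums.
Context dsp (T : measurableType dsp) (R : realType) (P : probability T R) (d : nat).
Variables (alpha : R) (X : nat -> {RV P >-> 'rV[R]_d}).
Hypotheses (alpha_gt1 : 1 < alpha) (X_iid : iid X).
Hypotheses (X_mean : mean_zero (X 0%N)) (X_cov : identity_covariance (X 0%N)).
Hypothesis finite_div : exists n0 : nat,
  (0 < n0)%N /\ renyi_gauss alpha (normalized_sum X n0) \is a fin_num.
Hypothesis X_mgf : forall t : 'rV[R]_d, t != 0 ->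
  ('E_P[fun w => expR (dotp t (X 0%N w))] <
   (expR (conj_exponent alpha * enorm t ^+ 2 / 2))%:E)%E.

Let mu := distribution P (X 0%N).

Let Hexp : forall t, rint mu (fun y => expR (dotp t y)).
Proof. exact: rint_expR_of_mgf X_mgf. Qed.

(** Telescoping adds m errors of size (sqrt m)^-k, so the order k of the expansion alone determines
    the rate: k = 3 gives 1/sqrt m and k = 4 gives 1/m. *)
Lemma normalized_sum_density k C : (3 <= k)%N -> (k <= 4)%N -> 0 <= C ->
  (forall s eta, nrm s + nrm eta <= 1 ->
    normc (laplace_fourier mu s eta - cexp (gauss_exponent s eta)) <=
    C * (nrm s + nrm eta) ^+ k) ->
  exists c : R, \forall m \near \oo, exists p : 'rV[R]_d -> R,
    [/\ continuous p, is_density (normalized_sum X m) p &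
        forall x, `|p x - gauss_density x| <=
          c * (m%:R / Num.sqrt m%:R ^+ k) *
          expR (- (enorm x ^+ 2 / (2 * conj_exponent alpha)))].
Proof.
move=> k3 k4 C0 approx; have [n0 [n00 fin]] := finite_div.
have [p0 [[mp0 p00 p0E] p0i]] := finite_renyi_density alpha_gt1 fin.
have mgf t : t != 0 -> \int[mu]_y expR (dotp t y) <
    expR (conj_exponent alpha * dotp t t / 2).
  by move=> /X_mgf; rewrite enorm_sqr; exact: Rint_expR_lt.
have nu_exp m t := rint_normalized_sum_expR X_iid Hexp m t.
have nu_pow m t xi := laplace_normalized_sum X_iid Hexp m t xi.
have [M [J [J0 Wp]]] :=
  laplace_ratio_power alpha_gt1 n00 (nu_exp n0) (nu_pow n0) mp0 p00 p0E p0i.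
have Wg := laplace_ratio_gap alpha_gt1 n00 Hexp (nu_exp n0) (nu_pow n0) mp0 p00 p0E p0i mgf.
have [c [m0 h]] := density_approx alpha_gt1 k3 k4 C0 J0 Wp Wg approx nu_exp nu_pow.
exists c; exists m0 => // m /= /h [p [cp mp pge pE pb]].
by exists p; split=> //; split.
Qed.

End density_of_normalized_sums.

(* X 0 is the generic vector X; X 1, X 2, ... are the summands. *)
Theorem theorem1p3 (R : realType) (alpha : R) (d : nat)
    (dsp : measure_display) (T : measurableType dsp) (P : probability T R)
    (X : nat -> {RV P >-> 'rV[R]_d})
    (alpha_gt1 : 1 < alpha) (d_gt0 : (0 < d)%N)
    (X_iid : iid X)
    (X_mean : mean_zero (X 0%N))
    (X_cov : identity_covariance (X 0%N))
    (finite_div : exists n0 : nat,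
       (0 < n0)%N /\ renyi_gauss alpha (normalized_sum X n0) \is a fin_num)
    (X_mgf : forall t : 'rV[R]_d, t != 0 ->
       ('E_P[fun w => expR (dotp t (X 0%N w))] <
        (expR (conj_exponent alpha * enorm t ^+ 2 / 2))%:E)%E) :
  (exists c : R, \forall n \near \oo, exists p : 'rV[R]_d -> R,
     [/\ continuous p, is_density (normalized_sum X n) p &
         forall x, `|p x - gauss_density x| <=
           c / Num.sqrt n%:R *
           expR (- (enorm x ^+ 2 / (2 * conj_exponent alpha)))]) /\
  (symmetric_about_origin (X 0%N) ->
   exists c : R, \forall n \near \oo, exists p : 'rV[R]_d -> R,
     [/\ continuous p, is_density (normalized_sum X n) p &
         forall x, `|p x - gauss_density x| <=
           c / n%:R *
           expR (- (enorm x ^+ 2 / (2 * conj_exponent alpha)))]).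
Proof.
have Hexp := rint_expR_of_mgf X_mgf.
have mean0 := Rint_coord0 X_mean.
have cov1 := Rint_coord2 X_mean X_cov.
have sq (m : nat) : Num.sqrt m%:R ^+ 2 = m%:R :> R by rewrite sqr_sqrtr.
split=> [|X_sym].
  have [C C0 approx] := laplace_gauss_approx3 Hexp mean0 cov1.
  have [c hc] := normalized_sum_density alpha_gt1 X_iid finite_div X_mgf
    (isT : (3 <= 3)%N) (isT : (3 <= 4)%N) C0 approx.
  exists c; apply: filterS hc => m [p [cp dp hp]]; exists p; split=> // x.
  apply: (le_trans (hp x)); rewrite le_eqVlt; apply/orP; left; apply/eqP.
  (* At m = 0 both rates are 0 by the convention that the inverse of 0 is 0. *)
  congr (_ * _ * _); have [->|m0] := posnP m; first by rewrite sqrtr0 mul0r invr0.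
  by rewrite -[X in X / _](sq m); field; rewrite gt_eqF// sqrtr_gt0 ltr0n.
have [C C0 approx] := laplace_gauss_approx4 Hexp mean0 cov1 (symmetric_law X_sym).
have [c hc] := normalized_sum_density alpha_gt1 X_iid finite_div X_mgf
  (isT : (3 <= 4)%N) (isT : (4 <= 4)%N) C0 approx.
exists c; apply: filterS hc => m [p [cp dp hp]]; exists p; split=> // x.
apply: (le_trans (hp x)); rewrite le_eqVlt; apply/orP; left; apply/eqP.
congr (_ * _ * _); have [->|m0] := posnP m; first by rewrite mul0r invr0.
have m0' : 0 < m%:R :> R by rewrite ltr0n.
by rewrite (exprM _ 2 2) sq; field; rewrite gt_eqF.
Qed.
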